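(* Let $A,B$ be finite sets, let $(M^{(a)})_{a\in A}$ be a family of $B\times B$ matrices with non-negative entries, each of which is irreducible and aperiodic, and let $x=(x(b))_{b\in B}$, $y=(y(b))_{b\in B}$ be vectors with strictly positive components. Let $\eta=(\eta_1,\dots,\eta_N)\in A^N$ be distributed according to the probability measure $$\mu_N(\eta)=\frac{\sum_{b,b'\in B}y(b)\big(\prod_{i=1}^N M^{(\eta_i)}\big)_{b,b'}x(b')}{Z_N},\qquad Z_N=\sum_{b,b'\in B}y(b)(M^N)_{b,b'}x(b'),\qquad M=\sum_{a\in A}M^{(a)},$$ and let $\lambda$ be the maximal (Perron) eigenvalue of $M$. (i) The empirical measure $\hat\nu^2_N$ of order two satisfies a large deviation principle on $\mathcal M^1_{st}(A^2)$ with speed $N$ and rate functional $$I^2(\nu^2)=\inf\left\{\sum_{a,a'\in A;\,b,b'\in B}\mathcal C^2[(a,b),(a',b')]\log\frac{\mathcal C^2[(a,b),(a',b')]}{\mathcal C^1[(a,b)]\,M^{(a)}_{b,b'}}+\log\lambda\right\},$$ where the infimum is over all $\mathcal C^2\in\mathcal M^1_{st}\big((A\times B)^2\big)$ such that $\sum_{b,b'\in B}\mathcal C^2[(a,b),(a',b')]=\nu^2(a,a')$ for all $a,a'\in A$, and $\mathcal C^1(a,b)=\sum_{(a',b')\in A\times B}\mathcal C^2[(a,b),(a',b')]$. (ii) The generalized spatial empirical measure $\hat\Pi^2_N$ satisfies a large deviation principle on $\mathcal M([0,1];\mathcal M^+(A^2))$ with speed $N$ and rate functional $$J^2(\Pi^2)=\begin{cases}\displaystyle\int_0^1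 I^2\big(\Pi^2(x)\big)\,dx, & \text{if } \Pi^2=\Pi^2(x)\,dx \text{ with } \Pi^2(x)\in\mathcal M^1_{st}(A^2)\text{ for almost all }x\in[0,1],\\ +\infty,&\text{otherwise.}\end{cases}$$
   Context: A non-negative square matrix $M$ indexed by $B$ is irreducible if the directed graph with edges $\{(b,b'):M_{b,b'}>0\}$ is strongly connected; it is aperiodic if for each $b$ the greatest common divisor of $\{k\ge 1:(M^k)_{b,b}>0\}$ is $1$. For a finite set $S$, $\mathcal M^1_{st}(S^2)$ is the set of probability measures $\nu$ on $S^2$ with $\sum_{s'}\nu(s,s')=\sum_{s'}\nu(s',s)$ for all $s\in S$ (used for $S=A$ and $S=A\times B$). For $\eta\in A^N$ indices are taken modulo $N$ ($\eta_{N+1}=\eta_1$), and $$\hat\nu^2_N=\frac1N\sum_{i=1}^N\delta_{(\eta_i,\eta_{i+1})}\in\mathcal M^1_{st}(A^2),\qquad \hat\Pi^2_N=\frac1N\sum_{i=1}^N\delta_{(\eta_i,\eta_{i+1})}\,\delta_{i/N}(dx).$$ $\mathcal M([0,1];\mathcal M^+(A^2))$ is the set of families $(\Pi(\xi;dx))_{\xi\in A^2}$ of positive finite Borel measures on $[0,1]$ with the topology of (componentwise) weak convergence; $\hat\Pi^2_N$ is the element whose $\xi$-component is $\frac1N\sum_{i:(\eta_i,\eta_{i+1})=\xi}\delta_{i/N}$. If $\Pi$ is absolutely continuous with respect to Lebesgue measure, the same symbol denotes its density, $\Pi=\Pi(x)dx$, with $\Pi(x)\in\mathcal M^+(A^2)$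 for a.e. $x$. Conventions: $0\log(0/\cdot)=0$, and $c\log(c/0)=+\infty$ for $c>0$. *)

(* Defs.v *)
From HB Require Import structures.
From mathcomp Require Import all_boot all_order all_algebra.
From mathcomp Require Import all_classical all_reals all_analysis.
From mathcomp Require Import complex.

Set Implicit Arguments.
Unset Strict Implicit.
Unset Printing Implicit Defensive.

Import Order.TTheory GRing.Theory Num.Theory.
Import numFieldNormedType.Exports.

Local Open Scope complex_scope.
Local Open Scope charge_scope.
Local Open Scope classical_set_scope.
Local Open Scope ring_scope.

(* P n : law at step n, v n : speed.  A rate functional is, as usual,
   [0,+oo]-valued and lower semicontinuous (not necessarily good).  Note
   [lne 0 = -oo] and [ereal_inf set0 = +oo]. *)
Definition LDP (R : realType) (T : topologicalType) (v : nat -> R)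
    (P : nat -> set T -> \bar R) (I : T -> \bar R) : Prop :=
  [/\ forall t, (0 <= I t)%E,
      lower_semicontinuous I,
      forall F : set T, closed F ->
        (limn_esup (fun n => ((v n)^-1)%:E * lne (P n F))
           <= - ereal_inf (I @` F))%E
    & forall G : set T, open G ->
        (- ereal_inf (I @` G)
           <= limn_einf (fun n => ((v n)^-1)%:E * lne (P n G)))%E].

Definition nonneg_mx (R : realType) n (M : 'M[R]_n) : Prop :=
  forall i j, 0 <= M i j.

Definition irreducible_mx (R : realType) n (M : 'M[R]_n) : Prop :=
  forall i j, connect (fun k l => 0 < M k l) i j.

Definition is_gcd (E : set nat) (g : nat) : Prop :=
  (forall k, E k -> (g %| k)%N) /\
  (forall d, (forall k, E k -> (d %| k)%N) -> (d %| g)%N).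

Definition aperiodic_mx (R : realType) n (M : 'M[R]_n) : Prop :=
  forall i, is_gcd [set k : nat | (1 <= k)%N /\ 0 < (M ^+ k) i i] 1%N.

(* Maximal in the Perron-Frobenius sense: in modulus, among all the complex
   eigenvalues. *)
Definition perron_eigenvalue (R : realType) n (M : 'M[R]_n) (lam : R) : Prop :=
  eigenvalue M lam /\
  forall z : R[i],
    eigenvalue (map_mx (real_complex R) M) z ->
    `|z| <= real_complex R lam.

(* A measure on the finite set S^2 is identified with its mass function, so
   that weak convergence is pointwise convergence; the set [Mst R S], seen as
   a type, carries the induced topology. *)
Definition Mst (R : realType) (S : finType) : set {ptws (S * S)%type -> R} :=
  [set nu | [/\ forall p, 0 <= nu p,
                \sum_p nu p = 1
              & forall s, \sum_s' nu (s, s') = \sum_s' nu (s', s)]].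
Arguments Mst R S : clear implicits.

Section MatrixProductMeasure.
Context (R : realType) (A B : finType).
Variables (M : A -> 'M[R]_#|B|) (x y : B -> R).

(* B x B matrices are 'M_#|B|, through the enumeration of B. *)
Definition mxent (L : 'M[R]_#|B|) (b b' : B) : R :=
  L (enum_rank b) (enum_rank b').

Definition sandwich (L : 'M[R]_#|B|) : R :=
  \sum_(b : B) \sum_(b' : B) y b * mxent L b b' * x b'.

Definition partition_function (N : nat) : R :=
  sandwich ((\sum_(a : A) M a) ^+ N).

Definition mpm (N : nat) (eta : {ffun 'I_N -> A}) : R :=
  sandwich (\prod_(i < N) M (eta i)) / partition_function N.

Definition mpm_prob (N : nat) (E : set {ffun 'I_N -> A}) : \bar R :=
  (\sum_(eta | eta \in E) mpm eta)%:E.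

End MatrixProductMeasure.

Section EmpiricalPairMeasure.
Context (R : realType) (A : finType).

(* [ordS] is the successor modulo N, which implements eta_{N+1} = eta_1. *)
Definition emp_pair (N : nat) (eta : {ffun 'I_N -> A}) : {ptws (A * A)%type -> R} :=
  fun xi => N%:R^-1 * \sum_(i < N) ((eta i, eta (ordS i)) == xi)%:R.

Lemma emp_pair_Mst n (eta : {ffun 'I_n.+1 -> A}) : emp_pair eta \in Mst R A.
Proof.
apply/mem_set; split => [p||s].
- by rewrite mulr_ge0 ?invr_ge0 ?sumr_ge0.
- rewrite /emp_pair -mulr_sumr exchange_big/=.
  rewrite (eq_bigr (fun=> 1)) => [|i _].
    by rewrite sumr_const card_ord mulVf// pnatr_eq0.
  rewrite (bigD1 (eta i, eta (ordS i)))//= eqxx big1 ?addr0// => p.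
  by rewrite eq_sym => /negPf ->.
- rewrite /emp_pair -!mulr_sumr exchange_big/= [in RHS]exchange_big/=.
  congr (_ * _).
  have E1 (a b : A) : \sum_(c : A) ((a, b) == (s, c))%:R = (a == s)%:R :> R.
    rewrite (bigD1 b)//= big1 ?addr0 => [|c cb].
      by rewrite xpair_eqE eqxx andbT.
    by rewrite xpair_eqE [b == c]eq_sym (negPf cb) andbF.
  have E2 (a b : A) : \sum_(c : A) ((a, b) == (c, s))%:R = (b == s)%:R :> R.
    rewrite (bigD1 a)//= big1 ?addr0 => [|c ca].
      by rewrite xpair_eqE eqxx.
    by rewrite xpair_eqE [a == c]eq_sym (negPf ca).
  under eq_bigr do rewrite E1.
  under [in RHS]eq_bigr do rewrite E2.
  exact: (reindex_inj (@ordS_inj _)).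
Qed.

Definition nu2_hat n (eta : {ffun 'I_n.+1 -> A}) : Mst R A :=
  exist _ (emp_pair eta) (emp_pair_Mst eta).

End EmpiricalPairMeasure.

(* Families, indexed by a finite set K, of finite positive Borel measures on
   [0,1], the latter being finite Borel measures on the line which do not
   charge the complement of [0,1]. *)
Record path_measure (R : realType) (K : finType) := PathMeasure {
  path_family :> K -> {finite_measure set (measurableTypeR R) -> \bar R};
  path_carried : forall xi, path_family xi (~` `[0, 1]) = 0%E }.

Definition test_function (R : realType) :=
  {f : R -> R | {within `[0, 1], continuous f}}.

Definition path_eval (R : realType) (K : finType) (Pi : path_measure R K) :
    {ptws (K * test_function R)%type -> R} :=
  fun xf => \int[Pi xf.1]_(t in `[0, 1]) sval xf.2 t.

HB.instance Definition _ (R : realType) (K : finType) :=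
  gen_eqMixin (path_measure R K).
HB.instance Definition _ (R : realType) (K : finType) :=
  gen_choiceMixin (path_measure R K).
HB.instance Definition _ (R : realType) (K : finType) :=
  Topological.copy (path_measure R K) (initial_topology (@path_eval R K)).

Section SpatialEmpiricalMeasure.
Context (R : realType) (A : finType) (N : nat) (eta : {ffun 'I_N -> A}).

(* Ordinals start at 0: the site i : 'I_N is at position (i + 1) / N. *)
Definition emp_spatial (xi : A * A) (E : set (measurableTypeR R)) : \bar R :=
  ((N%:R^-1)%:E * \sum_(i < N | (eta i, eta (ordS i)) == xi)
     \d_((i.+1%:R / N%:R)%R : measurableTypeR R) E)%E.

Section Measure.
Variable xi : A * A.

Let c : {nonneg R} := (N%:R^-1)%:nng.

Let m (k : nat) : {measure set (measurableTypeR R) -> \bar R} :=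
  if insub k is Some i then
    if (eta i, eta (ordS i)) == xi then
      (\d_((k.+1%:R / N%:R)%R : measurableTypeR R) : {measure set _ -> \bar R})
    else (mzero : {measure set _ -> \bar R})
  else (mzero : {measure set _ -> \bar R}).

Let emp_spatialE : emp_spatial xi = mscale c (msum m N).
Proof.
apply/funext => E; rewrite /emp_spatial /mscale /msum/=; congr (_ * _)%E.
rewrite big_mkcond; apply: eq_bigr => i _; rewrite /m valK.
by case: ifP.
Qed.

Let emp_spatial0 : emp_spatial xi set0 = 0%E.
Proof. by rewrite emp_spatialE measure0. Qed.

Let emp_spatial_ge0 E : (0 <= emp_spatial xi E)%E.
Proof. by rewrite emp_spatialE. Qed.

Let emp_spatial_sigma_additive : semi_sigma_additive (emp_spatial xi).
Proof. by rewrite emp_spatialE; exact: measure_semi_sigma_additive. Qed.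

HB.instance Definition _ := isMeasure.Build _ _ _ (emp_spatial xi)
  emp_spatial0 emp_spatial_ge0 emp_spatial_sigma_additive.

Let emp_spatial_fin : fin_num_fun (emp_spatial xi).
Proof.
move=> E mE; rewrite /emp_spatial fin_numM// sum_fin_num.
by apply/allP => _ /mapP[i _ ->]; rewrite diracE.
Qed.

HB.instance Definition _ :=
  @Measure_isFinite.Build _ _ _ (emp_spatial xi) emp_spatial_fin.

End Measure.

Lemma emp_spatial_carried xi : emp_spatial xi (~` `[0, 1]) = 0%E.
Proof.
rewrite /emp_spatial big1 ?mule0// => i _.
rewrite diracE memNset//=; apply: contrapT; apply.
have N0 : (0 < N%:R :> R) by rewrite ltr0n (leq_ltn_trans _ (ltn_ord i)).
by rewrite in_itv/= divr_ge0//= ler_pdivrMr// mul1r ler_nat.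
Qed.

Definition Pi2_hat : path_measure R (A * A)%type :=
  @PathMeasure R (A * A)%type (fun xi => emp_spatial xi) emp_spatial_carried.

End SpatialEmpiricalMeasure.
Arguments Pi2_hat R {A N} eta.
Arguments nu2_hat R {A n} eta.

(* c log (c / d), meant for c, d >= 0 only. *)
Definition clog (R : realType) (c d : R) : \bar R :=
  if c == 0 then 0%E else if d == 0 then +oo%E else (c * ln (c / d))%:E.

Section RateFunctionals.
Context (R : realType) (A B : finType).
Variables (M : A -> 'M[R]_#|B|) (lam : R).

Definition first_marginal (S : finType) (C2 : S * S -> R) (s : S) : R :=
  \sum_(s' : S) C2 (s, s').

Definition pair_cost (C2 : (A * B) * (A * B) -> R) : \bar R :=
  (\sum_(p : A * B) \sum_(p' : A * B)
     clog (C2 (p, p')) (first_marginal C2 p * mxent (M p.1) p.2 p'.2)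
   + (ln lam)%:E)%E.

(* I2 is written on all functions on A^2; outside of [Mst R A] the infimum is
   over the empty set, hence equal to +oo. *)
Definition I2 (nu2 : A * A -> R) : \bar R :=
  ereal_inf [set pair_cost C2 | C2 in
    Mst R (A * B)%type `&`
    [set C2 | forall a a' : A,
       \sum_(b : B) \sum_(b' : B) C2 ((a, b), (a', b')) = nu2 (a, a')]].

Definition path_density (K : finType) (Pi : path_measure R K)
    (t : measurableTypeR R) : {ptws K -> R} :=
  fun xi => fine ('d (charge_of_finite_measure (Pi xi))
                    '/d (@lebesgue_measure R) t).

Definition J2 (Pi : path_measure R (A * A)%type) : \bar R :=
  if `[< (forall xi, Pi xi `<< @lebesgue_measure R) /\
         {ae @lebesgue_measure R, forall t, (t : R) \in `[0, 1] ->
            Mst R A (path_density Pi t)} >]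
  then (\int[@lebesgue_measure R]_(t in `[0%R, 1%R]) I2 (path_density Pi t))%E
  else +oo%E.

End RateFunctionals.

(* Main.v *)
From HB Require Import structures.
Require Import Defs.
From mathcomp Require Import all_boot all_order all_algebra.
From mathcomp Require Import all_classical all_reals all_analysis.
From mathcomp Require Import measurable_realfun complex.
From mathcomp Require Import zify ring lra.

Set Implicit Arguments.
Unset Strict Implicit.
Unset Printing Implicit Defensive.

Import Order.TTheory GRing.Theory Num.Theory.
Import numFieldNormedType.Exports.
Local Open Scope charge_scope.
Local Open Scope classical_set_scope.
Local Open Scope ring_scope.

(** A letter sequence is the visible part of a path of states in [A * B], and its
probability is a sum over hidden paths of products of the edge weights
[W ((a, b), (a', b')) = M a b b'], up to bounded boundary factors and the normalization, which is of order
[lam ^+ N] because [M] has a positive left eigenvector ([mpm_prob_paths],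
[path_weight_bounds], [partition_function_bounds]). Hence both principles are
statements about weighted paths, seen through their empirical flux, that is the
number of steps along each edge in each of finitely many blocks of sites. The
cost of a flux [C] is [flux_cost], the sum of [C e ln (C e / (C1 e.1 W e))]; it is
homogeneous and, by the log-sum inequality, convex.

Lower bound ([mpm_lower_bound]). Prescribe a stationary flux [C k] in block [k].
Replacing the weights by the Markov kernels of the [C k] changes the weight of
every path whose counts are near the prescribed ones by the exponential of the
cost, and such paths have probability at least 1/2 for the Markov chain, by a
second moment estimate for the martingale provided by the Poisson equation
([block_count_second_moment]). The chain is irreducible once a little of a flux
with full support is mixed in ([path_lower_bound]).

Upper bound ([cluster_of_mass]). Paths that have the same counts [c] at the dyadic
times of level [J] weigh together at most [exp (- cost c)] ([type_class_le]), and
there are only [exp (o(N))] such classes when [J] grows slowly. A set of mass at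
least [exp (- N l)] therefore contains the letters of a path whose cost is at most
[l] up to [o(1)] at all dyadic levels at once. Along an ultrafilter the cumulative
fluxes of these paths converge to some [G : R -> edges -> R], and the costs of the
dyadic increments of [G] are at most [l].

The passage from these two estimates to a large deviation principle is the same
for both empirical measures ([ldp_criterion]): what is left is to show that the
empirical measures along the ultrafilter converge, and that the rate of the limit
is at most [l]. The lower semicontinuity of the rate is obtained by the same
compactness, applied to shrinking neighbourhoods, and the rate is nonnegative
because probabilities are at most 1.

For the measure of order two the limit is the marginal of [G 1]
([ldp_pair_measure]). For the spatial measure it is the family of measures whose
distribution functions are the marginals of [G], since convergence of the
distribution functions is convergence in the space of families of measures
([cvg_path_measure_cdf]). By Lebesgue differentiation along dyadic intervals the
increments of [G], divided by their length, converge almost everywhere to a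
stationary flux whose marginal is the density, and Fatou's lemma turns the dyadic
bounds into a bound of the integral of [I2] ([J2_le_of_flux]). Conversely
([density_approx]), a family of measures of finite rate is followed in each block
by the average of fluxes that are nearly optimal on the cells of a partition on
which the density is nearly constant; averaging costs nothing, by convexity. *)

(** * The cost of a flux *)

Section xlnx.
Context {R : realType}.
Implicit Types t c d r : R.

Definition xlnx t : R := t * ln t.

Lemma ln_le_sub1 t : 0 < t -> ln t <= t - 1.
Proof.
by move=> t0; rewrite -[t in ln t](subrK 1) addrC; apply: le_ln1Dx; lra.
Qed.

(** The square root gives the continuity of [t ln t] at 0, and a bound for the
entropy of the path types. *)
Lemma xlnx_bound t : `|t| <= 1 -> `|xlnx t| <= 2 * Num.sqrt `|t|.
Proof.
move=> t1; have [t0|t0] := leP t 0.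
  by rewrite /xlnx ln0// mulr0 normr0 mulr_ge0// sqrtr_ge0.
have s0 : 0 < Num.sqrt t by rewrite sqrtr_gt0.
have st : Num.sqrt t ^+ 2 = t by rewrite sqr_sqrtr// ltW.
move: t1; rewrite (gtr0_norm t0) => t1.
have lt0 : ln t <= 0 by rewrite ln_le0.
rewrite /xlnx normrM (gtr0_norm t0) (ler0_norm lt0).
have : ln ((Num.sqrt t)^-1) <= (Num.sqrt t)^-1 - 1 by rewrite ln_le_sub1// invr_gt0.
rewrite lnV ?posrE// => h.
have lnt : ln t = 2 * ln (Num.sqrt t) by rewrite -{1}st lnXn// mulr_natl.
rewrite lnt -{1}st.
have hs : Num.sqrt t * (- ln (Num.sqrt t)) <= 1.
  apply: le_trans (_ : Num.sqrt t * ((Num.sqrt t)^-1 - 1) <= _).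
    by rewrite ler_pM2l.
  by rewrite mulrBr mulfV ?gt_eqF//; lra.
rewrite expr2; set u := Num.sqrt t in hs s0 *.
rewrite (_ : u * u * _ = 2 * u * (u * - ln u)); last by ring.
rewrite -[leRHS]mulr1 ler_pM2l//; lra.
Qed.

Lemma continuous_xlnx : continuous xlnx.
Proof.
move=> t; have [t0|t0|->] := ltgtP t 0.
- apply: (@cvg_trans _ (nbhs (0 : R))); last first.
    by rewrite /xlnx ln0 ?mulr0 ?ltW.
  have := @cst_continuous _ _ (0 : R) t; apply: cvg_trans.
  apply: near_eq_cvg; near=> s; rewrite /= /xlnx ln0 ?mulr0//.
  by apply: ltW; near: s; apply: lt_nbhsl.
- by apply: cvgM; [exact: cvg_id|exact: continuous_ln].
- rewrite /continuous_at {2}/xlnx mul0r.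
  apply/cvgr0Pnorm_le => e e0; near=> s.
  have s1 : `|s| <= 1.
    near: s; exact: (@nbhs0_le R R^o).
  apply: le_trans (xlnx_bound s1) _.
  have : `|s| <= (e / 2) ^+ 2.
    near: s; apply: (@nbhs0_le R R^o).
    by rewrite exprn_gt0// divr_gt0.
  move/ler_wsqrtr; rewrite sqrtr_sqr (@ger0_norm _ (e / 2)); first lra.
  by rewrite divr_ge0// ltW.
Unshelve. all: by end_near. Qed.

(** The supporting plane of the homogeneous convex function [c ln (c / d)] along the
ray [c = r d]: the log-sum inequality is the sum of two instances for one [r]. *)
Lemma mul_ln_tangent c d r : 0 <= c -> 0 <= d -> (0 < c -> 0 < d) -> 0 < r ->
  c * ln r <= c * ln (c / d) + r * d - c.
Proof.
move=> c0 d0 cd r0; have [c1|] := ltP 0 c; last first.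
  move=> c1; have -> : c = 0 by apply/eqP; rewrite eq_le c0 c1.
  by rewrite !mul0r add0r subr0 mulr_ge0// ltW.
have d1 := cd c1.
have q0 : 0 < r * d / c by rewrite !mulr_gt0// invr_gt0.
have := ln_le_sub1 q0.
rewrite (_ : r * d / c = r / (c / d)); last first.
  by field; rewrite !gt_eqF.
rewrite ln_div ?posrE ?divr_gt0// => h.
have := ler_wpM2l c0 h.
rewrite (_ : c * (r / (c / d) - 1) = r * d - c); first lra.
by field; rewrite !gt_eqF.
Qed.

Lemma log_sum_ineq c c' d d' : 0 <= c -> 0 <= d -> (0 < c -> 0 < d) ->
  0 <= c' -> 0 <= d' -> (0 < c' -> 0 < d') ->
  (c + c') * ln ((c + c') / (d + d')) <= c * ln (c / d) + c' * ln (c' / d').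
Proof.
move=> c0 d0 cd c'0 d'0 c'd'.
have [s0|s0] := leP (c + c') 0.
  have -> : c = 0 by lra.
  have -> : c' = 0 by lra.
  by rewrite addr0 !mul0r addr0.
have t0 : 0 < d + d'.
  have [/cd|] := ltP 0 c; first lra.
  by move=> ?; have /c'd' : 0 < c'; lra.
have r0 : 0 < (c + c') / (d + d') by rewrite divr_gt0.
have h1 := mul_ln_tangent c0 d0 cd r0.
have h2 := mul_ln_tangent c'0 d'0 c'd' r0.
have e : (c + c') / (d + d') * (d + d') = c + c' by rewrite divfK// gt_eqF.
rewrite mulrDr in e.
rewrite mulrDl; lra.
Qed.

End xlnx.

Lemma cvg_sumr (R : realType) (T : Type) (F : set_system T) {FF : Filter F}
    (I : Type) (r : seq I) (P : pred I) (f : I -> T -> R) (l : I -> R) :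
  (forall i, P i -> f i t @[t --> F] --> l i) ->
  \sum_(i <- r | P i) f i t @[t --> F] --> \sum_(i <- r | P i) l i.
Proof. by move=> fl; apply: cvg_big => //; exact: add_continuous. Qed.

Section flux_cost.
Context {R : realType} {S : finType} (W : S * S -> R).
Implicit Types c : S * S -> R.

(** Fluxes of finite cost. On them the convention of the logarithm at 0 is
harmless, and [flux_cost] agrees with the extended-real cost. *)
Definition carried c := forall e, 0 <= c e /\ (0 < c e -> 0 < W e).

Definition flux_cost c : R :=
  \sum_e c e * ln (c e / (first_marginal c e.1 * W e)).

Lemma first_marginal_ge c e : carried c -> c e <= first_marginal c e.1.
Proof.
move=> cc; rewrite /first_marginal (bigD1 e.2)//= -surjective_pairing lerDl.
by apply: sumr_ge0 => s _; have [] := cc (e.1, s).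
Qed.

Lemma first_marginal_sum c s : \sum_(e | e.1 == s) c e = first_marginal c s.
Proof.
rewrite /first_marginal (eq_bigr (fun e => c (e.1, e.2))); last by case.
rewrite (eq_bigl (fun e => (e.1 == s) && true)); last by move=> e; rewrite andbT.
rewrite -(pair_big (fun x => x == s) xpredT (fun x y => c (x, y)))/=.
by rewrite big_pred1_eq.
Qed.

(** Splitting the logarithm shows that the cost is continuous: the entropies are,
and the logarithms of the weights enter linearly. *)
Lemma flux_costE c : carried c ->
  flux_cost c = \sum_e xlnx (c e) - \sum_s xlnx (first_marginal c s)
                - \sum_e c e * ln (W e).
Proof.
move=> cc.
have -> : \sum_s xlnx (first_marginal c s) =
          \sum_e c e * ln (first_marginal c e.1).
  rewrite [RHS](partition_big fst xpredT)//=; apply: eq_bigr => s _.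
  rewrite /xlnx -{1}first_marginal_sum mulr_suml.
  by apply: eq_bigr => e /eqP ->.
rewrite -!sumrB; apply: eq_bigr => e _.
have [c0 cW] := cc e.
have [c1|c1] := ltP 0 (c e); last first.
  have -> : c e = 0 by lra.
  by rewrite /xlnx !mul0r !subr0.
have m0 : 0 < first_marginal c e.1 := lt_le_trans c1 (first_marginal_ge e cc).
have w0 := cW c1.
by rewrite ln_div ?posrE ?mulr_gt0// lnM ?posrE// /xlnx; ring.
Qed.

Lemma carriedZ a c : 0 <= a -> carried c -> carried (fun e => a * c e).
Proof.
move=> a0 cc e; have [c0 cW] := cc e; split; first exact: mulr_ge0.
by move=> ac; apply: cW; rewrite lt_neqAle c0 andbT; apply: contraTN ac => /eqP<-;
   rewrite mulr0 ltxx.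
Qed.

Lemma carriedD c c' : carried c -> carried c' -> carried (fun e => c e + c' e).
Proof.
move=> cc cc' e; have [c0 cW] := cc e; have [c0' cW'] := cc' e.
split; first exact: addr_ge0.
have [/cW//|c1 h] := ltP 0 (c e); apply: cW'; lra.
Qed.

Lemma carried0 : carried (fun=> 0).
Proof. by move=> e; rewrite ltxx. Qed.

Lemma flux_costZ a c : 0 <= a ->
  flux_cost (fun e => a * c e) = a * flux_cost c.
Proof.
rewrite le_eqVlt => /predU1P[<-|a0].
  by rewrite mul0r /flux_cost big1// => e _; rewrite mul0r mul0r.
rewrite /flux_cost mulr_sumr; apply: eq_bigr => e _.
rewrite -mulrA; congr (_ * (_ * ln _)).
by rewrite /first_marginal -mulr_sumr -mulrA -mulf_div divff ?mul1r ?gt_eqF.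
Qed.

(** Together with homogeneity this is convexity. *)
Lemma sub_flux_costD c c' : (forall e, 0 <= W e) -> carried c -> carried c' ->
  flux_cost (fun e => c e + c' e) <= flux_cost c + flux_cost c'.
Proof.
move=> W0 cc cc'; rewrite /flux_cost -big_split/=; apply: ler_sum => e _.
have -> : first_marginal (fun e => c e + c' e) e.1 =
    first_marginal c e.1 + first_marginal c' e.1.
  by rewrite /first_marginal big_split.
rewrite [(_ + _) * W e]mulrDl.
have pos b : carried b -> 0 <= first_marginal b e.1 * W e.
  by move=> bb; rewrite mulr_ge0//; apply: sumr_ge0 => s _; have [] := bb (e.1, s).
have spos b : carried b -> 0 < b e -> 0 < first_marginal b e.1 * W e.
  move=> bb b0; rewrite mulr_gt0//.
    exact: lt_le_trans b0 (first_marginal_ge e bb).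
  by have [_] := bb e; apply.
by apply: log_sum_ineq; [case: (cc e)|exact: pos|exact: spos|
  case: (cc' e)|exact: pos|exact: spos].
Qed.

Lemma flux_cost_sum (I : finType) (a : I -> R) (c : I -> S * S -> R) :
  (forall e, 0 <= W e) -> (forall i, 0 <= a i) ->
  (forall i, a i != 0 -> carried (c i)) ->
  carried (fun e => \sum_i a i * c i e) /\
  flux_cost (fun e => \sum_i a i * c i e) <= \sum_i a i * flux_cost (c i).
Proof.
move=> W0 a0 cc.
pose f (s : seq I) : S * S -> R := fun e => \sum_(i <- s) a i * c i e.
suff [h1 h2] : carried (f (index_enum I)) /\
  flux_cost (f (index_enum I)) <= \sum_i a i * flux_cost (c i) by [].
elim: (index_enum I) => [|i s [IH1 IH2]].
  have -> : f [::] = fun=> 0 by apply/funext => e; rewrite /f big_nil.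
  rewrite big_nil; split; first exact: carried0.
  by rewrite /flux_cost big1// => e _; rewrite mul0r.
have -> : f (i :: s) = fun e => a i * c i e + f s e.
  by apply/funext => e; rewrite /f big_cons.
have cci : carried (fun e => a i * c i e).
  have [->|ai] := eqVneq (a i) 0; last by apply: carriedZ => //; exact: cc.
  by move=> e; rewrite mul0r ltxx.
split; first exact: carriedD.
apply: le_trans (sub_flux_costD W0 cci IH1) _.
by rewrite big_cons flux_costZ// lerD2l.
Qed.

Lemma flux_cost_cvg (T : Type) (F : set_system T) {FF : ProperFilter F}
    (c : T -> S * S -> R) (d : S * S -> R) :
  (\forall t \near F, carried (c t)) ->
  (forall e, c t e @[t --> F] --> d e) ->
  carried d /\ flux_cost (c t) @[t --> F] --> flux_cost d.
Proof.
move=> cc cd.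
have dd : carried d.
  move=> e; split.
    apply: (cvgr_to_ge (cd e)); near=> t.
    by have [] := (near cc t _) e.
  move=> d0; have [t []] : exists t, carried (c t) /\ 0 < c t e.
    apply: (@filter_ex _ F); near=> t; split; first by near: t.
    by near: t; exact: cvgr_gt (cd e) _ d0.
  by move=> /(_ e)[_ h] /h.
split => //; rewrite (flux_costE dd).
pose g t : R := \sum_e xlnx (c t e) - \sum_s xlnx (first_marginal (c t) s)
                - \sum_e c t e * ln (W e).
apply: (@cvg_trans _ (g @ F)).
  by apply: near_eq_cvg; near=> t; rewrite /g flux_costE//; near: t.
apply: cvgB; first apply: cvgB.
- apply: cvg_sumr => e _.
  by apply: continuous_cvg; [exact: continuous_xlnx|exact: cd].
- apply: cvg_sumr => s _.
  apply: continuous_cvg; first exact: continuous_xlnx.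
  by apply: cvg_sumr => s' _; exact: cd.
- apply: cvg_sumr => e _; apply: cvgM; [exact: cd|exact: cvg_cst].
Unshelve. all: by end_near. Qed.

End flux_cost.

(** Limits along an ultrafilter replace diagonal subsequences throughout. *)
Lemma ultra_cvg_itv (R : realType) (T : Type) (F : set_system T)
    (FF : UltraFilter F) (f : T -> R) (a b : R) :
  (\forall t \near F, a <= f t <= b) -> exists l : R, f @ F --> l.
Proof.
move=> fab; have FP := @ultra_proper _ _ FF.
have [|l [_ fl]] := @segment_compact R a b (f @ F) (fmap_proper_filter f FP).
  by near=> t; rewrite /= in_itv/=; near: t.
exists l => V Vl.
have [//|FVC] := in_ultra_setVsetC (f @^-1` V) FF.
have [|t [tV /tV]//] := fl (~` V) V _ Vl.
by [].
Unshelve. all: by end_near. Qed.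

(** * Weighted paths of an inhomogeneous chain *)

Section path_sums.
Context {R : realType} {S : finType}.

Definition site n (p : {ffun 'I_n.+1 -> S}) (i : nat) : S := p (inord i).

Definition step n (p : {ffun 'I_n.+1 -> S}) (i : nat) : S * S :=
  (site p i, site p i.+1).

Definition path_extend n (p : {ffun 'I_n.+1 -> S}) (s : S) :
    {ffun 'I_n.+2 -> S} :=
  [ffun i : 'I_n.+2 => if (i < n.+1)%N then site p i else s].

Lemma site_extend n (p : {ffun 'I_n.+1 -> S}) s i : (i <= n)%N ->
  site (path_extend p s) i = site p i.
Proof. by move=> lein; rewrite {1}/site ffunE inordK ?ltnS ?lein// leqW. Qed.

Lemma site_extend_last n (p : {ffun 'I_n.+1 -> S}) s :
  site (path_extend p s) n.+1 = s.
Proof. by rewrite {1}/site ffunE inordK// ltnn. Qed.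

Lemma step_extend n (p : {ffun 'I_n.+1 -> S}) s i : (i < n)%N ->
  step (path_extend p s) i = step p i.
Proof. by move=> ltin; rewrite /step !site_extend// ltnW. Qed.

Lemma step_extend_last n (p : {ffun 'I_n.+1 -> S}) s :
  step (path_extend p s) n = (site p n, s).
Proof. by rewrite /step site_extend_last site_extend. Qed.

(** Sums over paths are computed by induction on the last step. *)
Lemma sum_path_extend (V : nmodType) n (F : {ffun 'I_n.+2 -> S} -> V) :
  \sum_p F p = \sum_(p : {ffun 'I_n.+1 -> S}) \sum_s F (path_extend p s).
Proof.
rewrite pair_big/=.
pose h (ps : {ffun 'I_n.+1 -> S} * S) := path_extend ps.1 ps.2.
pose g (p : {ffun 'I_n.+2 -> S}) := ([ffun i : 'I_n.+1 => site p i], site p n.+1).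
rewrite (reindex h)//=; exists g => [[p s] _|p _].
  rewrite /g /h /=; congr (_, _); last by rewrite site_extend_last.
  by apply/ffunP => i; rewrite ffunE site_extend ?leq_ord// /site inord_val.
apply/ffunP => i; rewrite /h /g/= ffunE /site.
have [ltin|lein] := ltnP i n.+1.
  by rewrite ffunE inordK// /site inord_val.
congr (p _); apply/val_inj; rewrite /= inordK//.
by apply/eqP; rewrite eqn_leq lein -ltnS ltn_ord.
Qed.

Definition path_prod n (q : nat -> S * S -> R) (p : {ffun 'I_n.+1 -> S}) : R :=
  \prod_(i < n) q i (step p i).

Definition path_sum n (D : nat -> S * S -> R) (p : {ffun 'I_n.+1 -> S}) : R :=
  \sum_(i < n) D i (step p i).

Lemma path_prod_extend n q (p : {ffun 'I_n.+1 -> S}) s :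
  path_prod q (path_extend p s) = path_prod q p * q n (site p n, s).
Proof.
rewrite /path_prod big_ord_recr/= step_extend_last; congr (_ * _).
by apply: eq_bigr => i _; rewrite step_extend.
Qed.

Lemma path_sum_extend n D (p : {ffun 'I_n.+1 -> S}) s :
  path_sum D (path_extend p s) = path_sum D p + D n (site p n, s).
Proof.
rewrite /path_sum big_ord_recr/= step_extend_last; congr (_ + _).
by apply: eq_bigr => i _; rewrite step_extend.
Qed.

Lemma path_prod_ge0 n q (p : {ffun 'I_n.+1 -> S}) :
  (forall i e, 0 <= q i e) -> 0 <= path_prod q p.
Proof. by move=> q0; apply: prodr_ge0. Qed.

(** The chain starts from the counting measure on the states, whence the factor
[#|S|] here and below. *)
Lemma sum_path_prod_le n q : (forall i e, 0 <= q i e) ->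
  (forall i s, \sum_s' q i (s, s') <= 1) ->
  \sum_(p : {ffun 'I_n.+1 -> S}) path_prod q p <= #|S|%:R.
Proof.
move=> q0 q1; elim: n => [|n IH].
  rewrite (eq_bigr (fun=> 1)) => [|p _]; last by rewrite /path_prod big_ord0.
  by rewrite sumr_const card_ffun card_ord expn1.
apply: le_trans IH; rewrite sum_path_extend; apply: ler_sum => p _.
under eq_bigr do rewrite path_prod_extend.
by rewrite -mulr_sumr ler_piMr// path_prod_ge0.
Qed.

Lemma sum_path_prod_eq n q : (forall i s, \sum_s' q i (s, s') = 1) ->
  \sum_(p : {ffun 'I_n.+1 -> S}) path_prod q p = #|S|%:R.
Proof.
move=> q1; elim: n => [|n IH].
  rewrite (eq_bigr (fun=> 1)) => [|p _]; last by rewrite /path_prod big_ord0.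
  by rewrite sumr_const card_ffun card_ord expn1.
rewrite -IH sum_path_extend; apply: eq_bigr => p _.
under eq_bigr do rewrite path_prod_extend.
by rewrite -mulr_sumr q1 mulr1.
Qed.

(** The sums of [D i] along an inhomogeneous Markov chain with kernels [q i]
are a martingale, so that the increments are orthogonal. *)
Lemma second_moment n q D (K : R) : (forall i e, 0 <= q i e) ->
  (forall i s, \sum_s' q i (s, s') = 1) ->
  (forall i s, \sum_s' q i (s, s') * D i (s, s') = 0) ->
  (forall i e, `|D i e| <= K) ->
  \sum_(p : {ffun 'I_n.+1 -> S}) path_prod q p * path_sum D p ^+ 2 <=
  #|S|%:R * n%:R * K ^+ 2.
Proof.
move=> q0 q1 qD DK; elim: n => [|n IH].
  rewrite mulr0 mul0r big1// => p _.
  by rewrite /path_sum big_ord0 expr0n mulr0.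
rewrite sum_path_extend -natr1 mulrDr mulr1 mulrDl.
have -> : #|S|%:R * K ^+ 2 =
    \sum_(p : {ffun 'I_n.+1 -> S}) path_prod q p * K ^+ 2.
  by rewrite -mulr_suml sum_path_prod_eq.
apply: (le_trans _ (lerD IH (lexx _))); rewrite -big_split/=.
apply: ler_sum => p _.
under eq_bigr do rewrite path_prod_extend path_sum_extend sqrrD.
set X := path_sum D p; set s := site p n.
have -> : \sum_s' path_prod q p * q n (s, s') *
    (X ^+ 2 + X * D n (s, s') *+ 2 + D n (s, s') ^+ 2) =
    path_prod q p * (X ^+ 2 * (\sum_s' q n (s, s'))
      + X * 2 * (\sum_s' q n (s, s') * D n (s, s'))
      + \sum_s' q n (s, s') * D n (s, s') ^+ 2).
  rewrite !mulr_sumr -!big_split/= mulr_sumr; apply: eq_bigr => s' _; ring.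
rewrite q1 qD mulr0 mulr1 addr0 -mulrDr ler_wpM2l ?path_prod_ge0// lerD2l.
rewrite -[leRHS]mul1r -(q1 n s) mulr_suml; apply: ler_sum => s' _.
rewrite ler_wpM2l// -real_normK ?num_real// ler_sqr ?nnegrE//.
by rewrite (le_trans _ (DK n (s, s'))).
Qed.

Section blocks.
Variables (m : nat) (blk : nat -> 'I_m) (W : S * S -> R).

Definition block_count n (p : {ffun 'I_n.+1 -> S}) (k : 'I_m) (e : S * S) : R :=
  \sum_(i < n) ((blk i == k) && (step p i == e))%:R.

Lemma path_sum_count n (p : {ffun 'I_n.+1 -> S}) (g : 'I_m -> S * S -> R) :
  path_sum (fun i => g (blk i)) p = \sum_k \sum_e block_count p k e * g k e.
Proof.
rewrite /path_sum.
under [in RHS]eq_bigr => k _ do under eq_bigr => e _ do rewrite mulr_suml.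
rewrite pair_big/= exchange_big/=; apply: eq_bigr => i _.
rewrite (bigD1 (blk i, step p i))//= !eqxx mul1r big1 ?addr0// => -[k e] /=.
rewrite xpair_eqE negb_and => /orP[|]; rewrite eq_sym => /negPf ->.
  by rewrite mul0r.
by rewrite andbF mul0r.
Qed.

Lemma path_prod_exp n (p : {ffun 'I_n.+1 -> S}) (f : 'I_m -> S * S -> R) :
  (forall i, (i < n)%N -> 0 < f (blk i) (step p i)) ->
  path_prod (fun i => f (blk i)) p =
  expR (\sum_k \sum_e block_count p k e * ln (f k e)).
Proof.
move=> f0; rewrite -(path_sum_count p (fun k e => ln (f k e))) /path_sum expR_sum.
by apply: eq_bigr => i _; rewrite lnK// posrE f0.
Qed.

Definition kernel_of (C : S * S -> R) (e : S * S) : R :=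
  C e / first_marginal C e.1.

(** Change of measure between the weights [W] and the Markov kernels whose
flux in block [k] is [C k]. *)
Lemma path_prod_tilt n (p : {ffun 'I_n.+1 -> S}) (C : 'I_m -> S * S -> R) :
  (forall i, (i < n)%N -> 0 < kernel_of (C (blk i)) (step p i)) ->
  (forall i, (i < n)%N -> 0 < W (step p i)) ->
  path_prod (fun=> W) p = path_prod (fun i => kernel_of (C (blk i))) p *
    expR (- \sum_k \sum_e block_count p k e *
            ln (C k e / (first_marginal (C k) e.1 * W e))).
Proof.
move=> C0 W0.
rewrite expRN -path_prod_exp => [|i ltin]; last first.
  by rewrite invfM mulrA divr_gt0 ?W0//; exact: C0.
rewrite /path_prod -prodf_div; apply: eq_bigr => i _.
have := C0 i (ltn_ord i); rewrite /kernel_of => /lt0r_neq0.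
rewrite mulf_eq0 invr_eq0 negb_or => /andP[cne mne].
have wne := lt0r_neq0 (W0 i (ltn_ord i)).
by field; rewrite cne mne wne.
Qed.

(** A class of paths with prescribed block counts [c] weighs at most
[exp (- cost c)]: seen from the Markov kernels of [c], all its paths have the
same weight, and their total probability is at most 1 from each
starting state. *)
Lemma type_class_le n (T : {pred {ffun 'I_n.+1 -> S}})
    (c : 'I_m -> S * S -> R) : (forall e, 0 <= W e) ->
  (forall p, p \in T -> block_count p = c) ->
  \sum_(p in T) path_prod (fun=> W) p <=
  #|S|%:R * expR (- \sum_k flux_cost W (c k)).
Proof.
move=> W0 Tc.
have [[p0 p0T]|T0] := pselect (exists p, p \in T); last first.
  rewrite big1 ?mulr_ge0 ?expR_ge0// => p pT.
  by case: T0; exists p.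
have c0 k e : 0 <= c k e by rewrite -(Tc _ p0T) sumr_ge0.
have m0 k s : 0 <= first_marginal (c k) s by apply: sumr_ge0.
have Q0 k e : 0 <= kernel_of (c k) e by rewrite divr_ge0.
have Q1 k s : \sum_s' kernel_of (c k) (s, s') <= 1.
  rewrite /kernel_of/= -mulr_suml -/(first_marginal (c k) s).
  have [->|ne0] := eqVneq (first_marginal (c k) s) 0; first by rewrite mul0r.
  by rewrite mulfV.
rewrite -sumrN.
apply: (@le_trans _ _ (\sum_(p : {ffun 'I_n.+1 -> S})
    path_prod (fun i => kernel_of (c (blk i))) p *
    expR (\sum_k - flux_cost W (c k)))); last first.
  by rewrite -mulr_suml ler_wpM2r ?expR_ge0// sum_path_prod_le.
rewrite big_mkcond/=; apply: ler_sum => p _.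
case: ifPn => pT; last by rewrite mulr_ge0 ?expR_ge0// path_prod_ge0.
have [pW|pW] := pselect (forall i, (i < n)%N -> 0 < W (step p i)); last first.
  rewrite [leLHS](_ : _ = 0) ?mulr_ge0 ?expR_ge0 ?path_prod_ge0//.
  move/existsNP : pW => [i /not_implyP[ltin /negP]]; rewrite -leNgt => Wi.
  rewrite /path_prod (bigD1 (Ordinal ltin))//=.
  by have -> : W (step p i) = 0; [apply/eqP; rewrite eq_le Wi W0|rewrite mul0r].
rewrite (@path_prod_tilt _ p c)//.
  by rewrite sumrN /flux_cost (Tc _ pT).
move=> i ltin.
have ci : 0 < c (blk i) (step p i).
  rewrite -(Tc _ pT) /block_count (bigD1 (Ordinal ltin))//= !eqxx ltr_wpDr//.
  exact: sumr_ge0.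
rewrite divr_gt0// (lt_le_trans ci)//.
rewrite /first_marginal (bigD1 (step p i).2)//= lerDl.
exact: sumr_ge0.
Qed.

End blocks.
End path_sums.

(** * Perron-Frobenius theory *)

Section perron.
Context {R : realType} {n : nat}.
Implicit Types (M : 'M[R]_n) (v : 'rV[R]_n).

(** A state without successors has no return times, and 1 is not a gcd of the
empty set. *)
Lemma aperiodic_row_pos M i : nonneg_mx M -> aperiodic_mx M ->
  exists j, 0 < M i j.
Proof.
move=> M0 /(_ i)[_ h]; apply: contrapT => /forallNP Mi.
have Mi0 j : M i j = 0.
  by apply/eqP; rewrite eq_le M0 andbT leNgt; apply/negP; exact: Mi.
suff : (2 %| 1)%N by [].
apply: h => -[|k] /= [k1 Mk]; first by [].
move: Mk; rewrite exprS mxE big1 ?ltxx// => j _.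
by rewrite Mi0 mul0r.
Qed.

Lemma expmx_ge0 M k : nonneg_mx M -> nonneg_mx (M ^+ k).
Proof.
move=> M0; elim: k => [|k IH] i j.
  by rewrite expr0 mxE mulrb; case: eqP.
by rewrite exprS mxE sumr_ge0// => l _; rewrite mulr_ge0.
Qed.

Lemma connect_expmx_gt0 M i j : nonneg_mx M ->
  connect (fun k l => 0 < M k l) i j -> exists k, 0 < (M ^+ k) i j.
Proof.
move=> M0 /connectP[s]; elim: s i => [|l s IH] i /=.
  by move=> _ ->; exists 0%N; rewrite expr0 mxE eqxx.
move=> /andP[il ls] /(IH _ ls)[k kl]; exists k.+1.
rewrite exprS mxE (bigD1 l)//= ltr_wpDr ?mulr_gt0//.
by apply: sumr_ge0 => t _; rewrite mulr_ge0//; exact: expmx_ge0.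
Qed.

Lemma irreducible_sum_expmx M : nonneg_mx M -> irreducible_mx M ->
  exists K, forall i j, 0 < (\sum_(k < K) M ^+ k) i j.
Proof.
move=> M0 Mirr.
have /choice[f fP] : forall ij : 'I_n * 'I_n, exists k, 0 < (M ^+ k) ij.1 ij.2.
  by move=> ij; apply: connect_expmx_gt0.
exists (\max_ij f ij).+1 => i j; rewrite summxE.
have fij : (f (i, j) < (\max_ij f ij).+1)%N by rewrite ltnS leq_bigmax.
rewrite (bigD1 (Ordinal fij))//= ltr_wpDr ?(fP (i, j))//.
by apply: sumr_ge0 => k _; exact: expmx_ge0.
Qed.

Lemma complex_eigenvalue M (r : R) : eigenvalue M r ->
  eigenvalue (map_mx (real_complex R) M) (real_complex R r).
Proof.
move=> /eigenvalueP[v vM v0]; apply/eigenvalueP.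
exists (map_mx (real_complex R) v); last by rewrite map_mx_eq0.
by rewrite -map_mxM vM map_mxZ.
Qed.

Lemma perron_ge0 M r : perron_eigenvalue M r -> 0 <= r.
Proof.
move=> [/complex_eigenvalue Mr /(_ _ Mr)].
rewrite normc_def/= expr0n addr0 sqrtr_sqr lecR => h.
exact: le_trans h.
Qed.

(** Collatz-Wielandt: the largest [r] for which some probability vector
satisfies [r v <= v M] is an eigenvalue with a positive eigenvector. It is at
least [lam], as the modulus of an eigenvector for [lam] shows, and at most [lam],
which is maximal among the eigenvalues. *)
Lemma perron_left_eigenvector M lam : (0 < n)%N -> nonneg_mx M ->
  irreducible_mx M -> perron_eigenvalue M lam ->
  exists v, (forall j, 0 < v 0 j) /\ v *m M = lam *: v.
Proof.
move=> n0 M0 Mirr Mlam.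
have [K KM] := irreducible_sum_expmx M0 Mirr.
set P := \sum_(k < K) M ^+ k in KM.
have MP : M *m P = P *m M.
  rewrite /P mulmx_sumr mulmx_suml; apply: eq_bigr => k _.
  exact: (commrX k (commr_refl M)).
pose E : set R := [set r | exists v, [/\ forall j, 0 <= v 0 j,
   \sum_j v 0 j = 1 & forall j, r * v 0 j <= (v *m M) 0 j]].
(* The modulus of an eigenvector is a subsolution. *)
have Elam : E lam.
  have [/eigenvalueP[u uM u0] _] := Mlam.
  have lam0 := perron_ge0 Mlam.
  pose t := \sum_j `|u 0 j|.
  have t0 : 0 < t.
    have /rV0Pn[j uj] := u0.
    by rewrite /t (bigD1 j)//= ltr_wpDr ?normr_gt0// sumr_ge0.
  exists (\row_j (t^-1 * `|u 0 j|)); split.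
  - by move=> j; rewrite mxE mulr_ge0 ?invr_ge0// ltW.
  - by under eq_bigr do rewrite mxE; rewrite -mulr_sumr mulVf// gt_eqF.
  - move=> j; rewrite !mxE mulrCA.
    under eq_bigr do rewrite mxE -mulrA.
    rewrite -mulr_sumr ler_pM2l ?invr_gt0//.
    have := congr1 (fun w : 'rV_n => `|w 0 j|) uM; rewrite !mxE normrM (ger0_norm lam0) => <-.
    apply: le_trans (ler_norm_sum _ _ _) _; apply: ler_sum => i _.
    by rewrite normrM (ger0_norm (M0 _ _)).
have Eub : has_ubound E.
  exists (\sum_j \sum_i M i j) => r [v [v0 v1 rv]].
  rewrite -[leLHS]mulr1 -v1 mulr_sumr; apply: ler_sum => j _.
  apply: le_trans (rv j) _; rewrite mxE; apply: ler_sum => i _.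
  rewrite ler_piMl// -v1 (bigD1 i)//= lerDl; exact: sumr_ge0.
have Esup : has_sup E by split => //; exists lam.
pose rs := sup E.
have lamrs : lam <= rs by exact: ub_le_sup.
(* The supremum is attained, by compactness of the simplex. *)
have [v [v0 v1 vrs]] : E rs.
  have /choice[w wP] : forall k : nat, exists v, [/\ forall j, 0 <= v 0 j,
      \sum_j v 0 j = 1 & forall j, (rs - k.+1%:R^-1) * v 0 j <= (v *m M) 0 j].
    move=> k; have k0 : 0 < (k.+1%:R^-1 : R) by rewrite invr_gt0.
    have [r [v [v0 v1 rv]] rk] := sup_adherent k0 Esup.
    exists v; split => // j; apply: le_trans (rv j).
    by rewrite ler_wpM2r// ltW.
  have [U [UU Uoo]] := ultraFilterLemma (@eventually_filter).
  have UP := @ultra_proper _ _ UU.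
  have /choice[l lP] : forall j, exists l : R, w k 0 j @[k --> U] --> l.
    move=> j; apply: (@ultra_cvg_itv _ _ _ UU _ 0 1); near=> k.
    have [w0 w1 _] := wP k; rewrite w0/= -w1 (bigD1 j)//= lerDl.
    exact: sumr_ge0.
  exists (\row_j l j); split.
  - move=> j; rewrite mxE; apply: cvgr_to_ge (lP j) _; near=> k.
    by have [->] := wP k.
  - under eq_bigr do rewrite mxE.
    have h : \sum_j w k 0 j @[k --> U] --> \sum_j l j.
      by apply: cvg_sumr => j _; exact: lP.
    apply/eqP; rewrite eq_le; apply/andP; split.
      by apply: cvgr_to_le h _; near=> k; have [_ ->] := wP k.
    by apply: cvgr_to_ge h _; near=> k; have [_ ->] := wP k.
  - move=> j; rewrite !mxE -subr_ge0.
    have h : (w k *m M) 0 j - (rs - k.+1%:R^-1) * w k 0 j @[k --> U] -->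
        \sum_i (\row_j l j) 0 i * M i j - (rs - 0) * l j.
      apply: cvgB.
        under eq_fun do rewrite mxE; apply: cvg_sumr => i _; rewrite mxE.
        by apply: cvgM; [exact: lP|exact: cvg_cst].
      apply: cvgM; last exact: lP.
      apply: cvgB; first exact: cvg_cst.
      apply: cvg_trans (@cvg_harmonic R); exact: cvg_app.
    rewrite subr0 in h; apply: cvgr_to_ge h _; near=> k.
    by rewrite subr_ge0; have [_ _] := wP k; exact.
pose d := v *m M - rs *: v.
have d0 j : 0 <= d 0 j by rewrite !mxE subr_ge0; have := vrs j; rewrite mxE.
have pos (u : 'rV[R]_n) : (forall j, 0 <= u 0 j) -> u != 0 ->
    forall j, 0 < (u *m P) 0 j.
  move=> u0 /rV0Pn[i ui] j; rewrite mxE (bigD1 i)//= ltr_wpDr//.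
    by apply: sumr_ge0 => k _; rewrite mulr_ge0// ltW.
  by rewrite mulr_gt0// lt_neqAle eq_sym ui u0.
have vn0 : v != 0.
  apply: contra_eqN v1 => /eqP ->.
  by rewrite big1 ?(eq_sym 0) ?oner_eq0// => j _; rewrite mxE.
(* A strict inequality in one coordinate becomes strict in all of them after
   multiplication by the positive matrix [P], and the supremum could be raised. *)
have vM : v *m M = rs *: v.
  apply/eqP; rewrite -subr_eq0; apply: contraT => dn0.
  have dP := pos d d0 dn0.
  have wP := pos v v0 vn0.
  pose w := v *m P.
  have wM : w *m M - rs *: w = d *m P.
    by rewrite /w /d mulmxBl -mulmxA -MP mulmxA scalemxAl.
  pose eps := (1 + \sum_j w 0 j / (d *m P) 0 j)^-1.
  have eps0 : 0 < 1 + \sum_j w 0 j / (d *m P) 0 j.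
    rewrite ltr_wpDr// sumr_ge0// => j _.
    by apply: divr_ge0; apply: ltW; [exact: wP|exact: dP].
  pose t := \sum_j w 0 j.
  have t0 : 0 < t.
    rewrite /t (bigD1 (Ordinal n0))//=; apply: ltr_wpDr; last exact: wP.
    by apply: sumr_ge0 => j _; apply: ltW; exact: wP.
  suff : E (rs + eps).
    move=> /(ub_le_sup Eub); rewrite -/rs gerDl leNgt invr_gt0 => /negP[].
    by [].
  exists (t^-1 *: w); split.
  - by move=> j; rewrite mxE mulr_ge0 ?invr_ge0 ?ltW//; exact: wP.
  - under eq_bigr do rewrite mxE.
    by rewrite -mulr_sumr mulVf// gt_eqF.
  - move=> j; rewrite -scalemxAl [leRHS]mxE [X in _ * X <= _]mxE mulrCA.
    rewrite ler_pM2l ?invr_gt0//.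
    have -> : (w *m M) 0 j = rs * w 0 j + (d *m P) 0 j.
      by rewrite -[w *m M](subrK (rs *: w)) wM mxE addrC [X in X + _]mxE.
    rewrite mulrDl lerD2l.
    rewrite mulrC ler_pdivrMr//.
    rewrite -[w 0 j](@divfK _ ((d *m P) 0 j)) ?gt_eqF// mulrC ler_pM2l//.
    rewrite (bigD1 j)//= addrCA lerDl addr_ge0// sumr_ge0// => k _.
    by apply: divr_ge0; apply: ltW; [exact: wP|exact: dP].
have rslam : rs <= lam.
  have [_ /(_ (real_complex R rs))] := Mlam.
  move=> /(_ (complex_eigenvalue _)) h.
  have : eigenvalue M rs by apply/eigenvalueP; exists v.
  move=> /h; rewrite normc_def/= expr0n addr0 sqrtr_sqr lecR => {}h.
  exact: le_trans (ler_norm _) h.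
have rsE : rs = lam by apply/eqP; rewrite eq_le rslam lamrs.
exists v; split; last by rewrite -rsE.
have vP k : v *m M ^+ k = rs ^+ k *: v.
  elim: k => [|k IH]; first by rewrite !expr0 scale1r mulmx1.
  by rewrite exprSr mulmxA IH -scalemxAl vM scalerA exprSr.
move=> j; rewrite lt_neqAle v0 andbT eq_sym.
have := pos v v0 vn0 j; rewrite /P mulmx_sumr summxE => h.
apply: contraTneq h => vj; rewrite big1 ?ltxx// => k _.
by rewrite vP mxE vj mulr0.
Unshelve. all: by end_near. Qed.

End perron.

(** * Matrix products as sums over hidden paths *)

Section path_weight.
Context {R : realType} {A B : finType}.
Variables (M : A -> 'M[R]_#|B|) (x y : B -> R).

Definition edge_weight (e : (A * B) * (A * B)) : R :=
  mxent (M e.1.1) e.1.2 e.2.2.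

Definition final_weight (u : B -> R) (s : A * B) : R :=
  \sum_b' mxent (M s.1) s.2 b' * u b'.

Definition path_weight (u : B -> R) n (p : {ffun 'I_n.+1 -> A * B}) : R :=
  y (site p 0).2 * path_prod (fun=> edge_weight) p * final_weight u (site p n).

Definition letters n (p : {ffun 'I_n.+1 -> A * B}) : {ffun 'I_n.+1 -> A} :=
  [ffun i => (p i).1].

Lemma letters_extend n (p : {ffun 'I_n.+1 -> A * B}) s :
  letters (path_extend p s) = path_extend (letters p) s.1.
Proof. by apply/ffunP => i; rewrite !ffunE; case: ifP => // _; rewrite /site ffunE. Qed.

Lemma mxentM (L L' : 'M[R]_#|B|) b b' :
  mxent (L *m L') b b' = \sum_c mxent L b c * mxent L' c b'.
Proof.
rewrite /mxent mxE (reindex enum_rank)//=.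
by apply: onW_bij; exact: enum_rank_bij.
Qed.

Lemma sandwich_mulr (u : B -> R) (L L' : 'M[R]_#|B|) :
  sandwich u y (L *m L') = sandwich (fun c => \sum_b' mxent L' c b' * u b') y L.
Proof.
apply: eq_bigr => b _.
under eq_bigr do rewrite mxentM mulr_sumr mulr_suml.
rewrite exchange_big/=; apply: eq_bigr => c _.
rewrite mulr_sumr; apply: eq_bigr => b' _; ring.
Qed.

(** Expanding the matrix products along the hidden states. The final vector [u] is
general because the induction removes the last matrix and applies it to [u]. *)
Lemma sum_sandwich n (u : B -> R) (F : {ffun 'I_n.+1 -> A} -> R) :
  \sum_eta F eta * sandwich u y (\prod_(i < n.+1) M (eta i)) =
  \sum_p F (letters p) * path_weight u p.
Proof.
elim: n u F => [|n IH] u F; last first.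
  rewrite !sum_path_extend exchange_big/=.
  rewrite (eq_bigr (fun a => \sum_p F (path_extend (letters p) a) *
     path_weight (fun c => \sum_b' mxent (M a) c b' * u b') p)); last first.
    move=> a _; rewrite -(IH _ (fun eta => F (path_extend eta a))).
    apply: eq_bigr => eta _.
    have lasta : path_extend eta a ord_max = a.
      have := site_extend_last eta a; rewrite /site => {2}<-; congr (_ _).
      by apply/val_inj; rewrite /= inordK.
    rewrite big_ord_recr/= sandwich_mulr lasta; congr (_ * sandwich _ _ _).
    apply: eq_bigr => i _; congr (M _).
    have := site_extend eta a (leq_ord i); rewrite /site inord_val => <-.
    by congr (_ _); apply/val_inj; rewrite /= inordK// ltnS ltnW.
  rewrite exchange_big/=; apply: eq_bigr => p _.
  rewrite (eq_bigr (fun s => F (path_extend (letters p) s.1) *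
     (y (site p 0).2 * path_prod (fun=> edge_weight) p *
      edge_weight (site p n, s) * final_weight u s))); last first.
    move=> s _; rewrite letters_extend /path_weight site_extend//.
    by rewrite path_prod_extend site_extend_last !mulrA.
  rewrite -(pair_bigA _ (fun a b => F (path_extend (letters p) a) *
     (y (site p 0).2 * path_prod (fun=> edge_weight) p *
      edge_weight (site p n, (a, b)) * final_weight u (a, b))))/=.
  apply: eq_bigr => a _; rewrite -mulr_sumr /path_weight; congr (_ * _).
  rewrite {1}/final_weight mulr_sumr; apply: eq_bigr => b _.
  by rewrite /edge_weight/= /final_weight/= !mulrA.
pose h (s : A * B) : {ffun 'I_1 -> A * B} := [ffun=> s].
pose g (a : A) : {ffun 'I_1 -> A} := [ffun=> a].
rewrite (reindex h)/=; last first.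
  exists (fun p => p ord0) => [s _|p _]; first by rewrite ffunE.
  by apply/ffunP => i; rewrite ffunE (ord1 i).
rewrite (reindex g)/=; last first.
  exists (fun p => p ord0) => [s _|p _]; first by rewrite ffunE.
  by apply/ffunP => i; rewrite ffunE (ord1 i).
rewrite (eq_bigr (fun s => F (g s.1) * (y s.2 * final_weight u s))); last first.
  move=> s _; congr (F _ * _).
    by apply/ffunP => i; rewrite !ffunE.
  by rewrite /path_weight /path_prod big_ord0 mulr1 /site ffunE.
rewrite -(pair_bigA _ (fun a b => F (g a) * (y b * final_weight u (a, b))))/=.
apply: eq_bigr => a _; rewrite -mulr_sumr; congr (_ * _).
rewrite big_ord_recl big_ord0 mulr1 ffunE; apply: eq_bigr => b _.
by rewrite /final_weight mulr_sumr; apply: eq_bigr => b' _; rewrite mulrA.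
Qed.

Lemma mpm_prob_paths n (E : set {ffun 'I_n.+1 -> A}) :
  mpm_prob M x y E =
  ((\sum_(p : {ffun 'I_n.+1 -> A * B} | letters p \in E) path_weight x p) /
   partition_function M x y n.+1)%:E.
Proof.
congr (_%:E); rewrite -mulr_suml; congr (_ / _).
rewrite big_mkcond [RHS]big_mkcond/=.
have /= := @sum_sandwich n x (fun eta => (eta \in E)%:R).
rewrite (eq_bigr _ (fun _ _ => etrans (mulr_natl _ _) (mulrb _ _))) => ->.
by apply: eq_bigr => p _; rewrite mulr_natl mulrb.
Qed.

Lemma partition_function_sum n :
  partition_function M x y n = \sum_(eta : {ffun 'I_n -> A})
    sandwich x y (\prod_(i < n) M (eta i)).
Proof.
rewrite /partition_function.
have -> : (\sum_a M a) ^+ n = \sum_(eta : {ffun 'I_n -> A}) \prod_(i < n) M (eta i).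
  by rewrite -(bigA_distr_bigA (fun (_ : 'I_n) a => M a)) prodr_const card_ord.
rewrite /sandwich [RHS]exchange_big; apply: eq_bigr => b _.
rewrite [RHS]exchange_big; apply: eq_bigr => b' _.
by rewrite /mxent summxE mulr_sumr mulr_suml.
Qed.

Hypotheses (M_ge0 : forall a, nonneg_mx (M a)) (x_gt0 : forall b, 0 < x b)
  (y_gt0 : forall b, 0 < y b).

Lemma edge_weight_ge0 e : 0 <= edge_weight e. Proof. exact: M_ge0. Qed.

Lemma path_weight_ge0 n (p : {ffun 'I_n.+1 -> A * B}) : 0 <= path_weight x p.
Proof.
rewrite !mulr_ge0 ?(ltW (y_gt0 _))// ?path_prod_ge0// => [_ e|].
  exact: edge_weight_ge0.
by apply: sumr_ge0 => b _; rewrite mulr_ge0 ?(ltW (x_gt0 _))//; exact: M_ge0.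
Qed.

Lemma mpm_ge0 n (eta : {ffun 'I_n -> A}) : 0 <= partition_function M x y n ->
  0 <= mpm M x y eta.
Proof.
move=> Z0; rewrite divr_ge0//; apply: sumr_ge0 => b _; apply: sumr_ge0 => b' _.
rewrite mulr_ge0 ?(ltW (x_gt0 _))// mulr_ge0 ?(ltW (y_gt0 _))//.
suff : nonneg_mx (\prod_(i < n) M (eta i)) by exact.
elim/big_ind : _ => // [i j|L L' L0 L'0 i j].
  by rewrite mxE mulrb; case: eqP.
by rewrite mxE sumr_ge0// => k _; rewrite mulr_ge0.
Qed.

Lemma mpm_prob_le1 n (E : set {ffun 'I_n -> A}) :
  0 < partition_function M x y n -> (mpm_prob M x y E <= 1)%E.
Proof.
move=> Z0; rewrite lee_fin.
apply: (@le_trans _ _ (\sum_(eta : {ffun 'I_n -> A}) mpm M x y eta)).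
  rewrite [leRHS](bigID (fun eta => eta \in E))/= lerDl sumr_ge0// => eta _.
  by rewrite mpm_ge0// ltW.
by rewrite -mulr_suml -partition_function_sum mulfV// gt_eqF.
Qed.

End path_weight.

Section partition_function_growth.
Context {R : realType} {A B : finType}.
Variables (M : A -> 'M[R]_#|B|) (x y : B -> R) (lam : R).
Hypotheses (A_gt0 : (0 < #|A|)%N) (B_gt0 : (0 < #|B|)%N)
  (M_ge0 : forall a, nonneg_mx (M a)) (M_irr : forall a, irreducible_mx (M a))
  (M_aper : forall a, aperiodic_mx (M a)) (x_gt0 : forall b, 0 < x b)
  (y_gt0 : forall b, 0 < y b) (lamP : perron_eigenvalue (\sum_a M a) lam).

Lemma sum_nonneg_mx : nonneg_mx (\sum_a M a).
Proof. by move=> i j; rewrite summxE sumr_ge0// => a _; exact: M_ge0. Qed.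

Lemma le_sum_mx a i j : M a i j <= (\sum_a M a) i j.
Proof.
rewrite summxE (bigD1 a)//= lerDl sumr_ge0// => a' _; exact: M_ge0.
Qed.

Lemma sum_irreducible_mx : irreducible_mx (\sum_a M a).
Proof.
have /card_gt0P[a _] := A_gt0; move=> i j.
apply: connect_sub (M_irr a i j) => k l Mkl; apply: connect1.
exact: lt_le_trans (le_sum_mx a k l).
Qed.

Lemma positive_eigenvector : exists v : B -> R,
  (forall b, 0 < v b) /\
  forall n b', \sum_b v b * mxent ((\sum_a M a) ^+ n) b b' = lam ^+ n * v b'.
Proof.
have [v [v0 vM]] := perron_left_eigenvector B_gt0 sum_nonneg_mx sum_irreducible_mx lamP.
exists (fun b => v 0 (enum_rank b)); split => // n b'.
have vMn k : v *m (\sum_a M a) ^+ k = lam ^+ k *: v.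
  elim: k => [|k IH]; first by rewrite !expr0 scale1r mulmx1.
  by rewrite exprSr mulmxA IH -scalemxAl vM scalerA exprSr.
have := congr1 (fun w : 'rV_#|B| => w 0 (enum_rank b')) (vMn n).
rewrite !mxE => <-; rewrite (reindex enum_rank)//=.
by apply: onW_bij; exact: enum_rank_bij.
Qed.

Lemma lam_gt0 : 0 < lam.
Proof.
have [v [v0 vM]] := positive_eigenvector.
have /card_gt0P[a _] := A_gt0; have /card_gt0P[b _] := B_gt0.
have [j Mj] := aperiodic_row_pos (enum_rank b) (M_ge0 a) (M_aper a).
have := vM 1%N (enum_val j); rewrite !expr1 => h.
suff : 0 < lam * v (enum_val j) by rewrite pmulr_lgt0.
rewrite -h (bigD1 b)//= ltr_wpDr//.
  by apply: sumr_ge0 => b' _; rewrite mulr_ge0 ?(ltW (v0 _))//; exact: sum_nonneg_mx.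
rewrite mulr_gt0// /mxent enum_valK.
exact: lt_le_trans Mj (le_sum_mx a _ _).
Qed.

(** The boundary vectors are comparable to the positive eigenvector, on which the
powers of the matrix act as powers of [lam]. *)
Lemma partition_function_bounds : exists c C : R, [/\ 0 < c, 0 < C &
  forall n, c * lam ^+ n <= partition_function M x y n <= C * lam ^+ n].
Proof.
have [v [v0 vM]] := positive_eigenvector.
have /card_gt0P[b0 _] := B_gt0.
pose k := \sum_b v b / y b; pose K := \sum_b y b / v b.
pose D := \sum_b v b * x b.
have sum_pos (f : B -> R) : (forall b, 0 < f b) -> 0 < \sum_b f b.
  move=> f0; rewrite (bigD1 b0)//= ltr_wpDr// sumr_ge0// => b _; exact: ltW.
have k0 : 0 < k by apply: sum_pos => b; rewrite divr_gt0.
have K0 : 0 < K by apply: sum_pos => b; rewrite divr_gt0.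
have D0 : 0 < D by apply: sum_pos => b; rewrite mulr_gt0.
have vk b : k^-1 * v b <= y b.
  rewrite mulrC ler_pdivrMr// mulrC -ler_pdivrMr// /k (bigD1 b)//= lerDl.
  by rewrite sumr_ge0// => b' _; rewrite ltW ?divr_gt0.
have yK b : y b <= K * v b.
  rewrite -ler_pdivrMr// /K (bigD1 b)//= lerDl.
  by rewrite sumr_ge0// => b' _; rewrite ltW ?divr_gt0.
have E n : \sum_b \sum_b' v b * mxent ((\sum_a M a) ^+ n) b b' * x b' = lam ^+ n * D.
  rewrite exchange_big/= /D mulr_sumr; apply: eq_bigr => b' _.
  by rewrite -mulr_suml vM mulrA.
have Mn0 n b b' : 0 <= mxent ((\sum_a M a) ^+ n) b b'.
  exact: (expmx_ge0 n sum_nonneg_mx).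
exists (k^-1 * D), (K * D); split; rewrite ?mulr_gt0 ?invr_gt0// => n.
rewrite -2!mulrA ![D * _]mulrC -!E !mulr_sumr /partition_function /sandwich.
apply/andP; split; apply: ler_sum => b _; rewrite mulr_sumr; apply: ler_sum => b' _.
  by rewrite 2!mulrA ler_wpM2r ?(ltW (x_gt0 _))// ler_wpM2r//; exact: vk.
by rewrite 2!mulrA ler_wpM2r ?(ltW (x_gt0 _))// ler_wpM2r//; exact: yK.
Qed.

Lemma partition_function_gt0 n : 0 < partition_function M x y n.
Proof.
have [c [C [c0 _ /(_ n)/andP[h _]]]] := partition_function_bounds.
by apply: lt_le_trans h; rewrite mulr_gt0// exprn_gt0// lam_gt0.
Qed.

End partition_function_growth.

(** * Poisson equation and fully supported fluxes *)

Section harmonic.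
Context {R : realType} {S : finType} (Q : S * S -> R).
Hypotheses (Q_ge0 : forall e, 0 <= Q e) (Q_row : forall s, \sum_s' Q (s, s') = 1)
  (Q_irr : forall s s', connect (fun s s' => 0 < Q (s, s')) s s').

(** Maximum principle: where a harmonic function is maximal, it is maximal at all
successors. *)
Lemma harmonic_const (u : S -> R) :
  (forall s, \sum_s' Q (s, s') * u s' = u s) -> forall s s', u s = u s'.
Proof.
move=> hu.
suff h (s0 : S) : exists t, forall s, u s = u t.
  by move=> s s'; have [t ut] := h s; rewrite (ut s) (ut s').
have [t _ tmax] := @arg_maxP _ _ S s0 xpredT u erefl.
exists t => s; have /connectP[p tp ->] := Q_irr t s.
suff h q s1 : u s1 = u t -> path (fun s s' => 0 < Q (s, s')) s1 q ->
    u (last s1 q) = u t by exact: h tp.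
elim: q s1 => [//|s2 q IH] s1 us1 /= /andP[Qs]; apply: IH.
have h0 : \sum_s' Q (s1, s') * (u t - u s') = 0.
  under eq_bigr do rewrite mulrBr.
  by rewrite sumrB -mulr_suml Q_row hu us1 mul1r subrr.
have /psumr_eq0P/(_ h0)/(_ s2 erefl)/eqP : forall s', true -> 0 <= Q (s1, s') * (u t - u s').
  by move=> s' _; rewrite mulr_ge0// subr_ge0; exact: tmax.
by rewrite mulf_eq0 gt_eqF//= subr_eq0 => /eqP.
Qed.

(** The range of [1 - Q] has codimension one, by the maximum principle, and
lies in the hyperplane orthogonal to the invariant measure. *)
Lemma poisson_equation (pi : S -> R) (g : S -> R) : (forall s, 0 < pi s) ->
  (forall s', \sum_s pi s * Q (s, s') = pi s') ->
  \sum_s pi s * g s = 0 ->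
  exists u : S -> R, forall s, u s - \sum_s' Q (s, s') * u s' = g s.
Proof.
move=> pi0 piQ pig.
have [S0|/card_gt0P[s0 _]] := posnP #|S|.
  by exists (fun=> 0) => s; move/card0_eq/(_ s) : S0.
have ev (f : S -> R) : \sum_(i < #|S|) f (enum_val i) = \sum_s f s.
  rewrite (reindex (@enum_rank S))/=; last by apply: onW_bij; exact: enum_rank_bij.
  by apply: eq_bigr => s _; rewrite enum_rankK.
pose L : 'M[R]_#|S| := \matrix_(i, j) ((i == j)%:R - Q (enum_val j, enum_val i)).
pose v : 'cV[R]_#|S| := \col_i pi (enum_val i).
pose w : 'rV[R]_#|S| := \row_j g (enum_val j).
have uL (u : 'rV[R]_#|S|) j : (u *m L) 0 j =
    u 0 j - \sum_s' Q (enum_val j, s') * u 0 (enum_rank s').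
  rewrite mxE; under eq_bigr do rewrite mxE mulrBr.
  rewrite sumrB (bigD1 j)//= eqxx mulr1 big1 ?addr0; last first.
    by move=> i /negPf ->; rewrite mulr0.
  congr (_ - _); rewrite -ev; apply: eq_bigr => i _.
  by rewrite enum_valK mulrC.
have rkK : (\rank (kermx L) <= 1)%N.
  apply: leq_trans (rank_leq_row (const_mx 1 : 'rV[R]_#|S|)); apply: mxrankS.
  apply/row_subP => i; apply/submxP; exists (kermx L i (enum_rank s0))%:M.
  apply/rowP => j; rewrite mul_scalar_mx !mxE mulr1.
  pose u := row i (kermx L).
  have uL0 : u *m L = 0 by rewrite -row_mul mulmx_ker row0.
  have h s : \sum_s' Q (s, s') * u 0 (enum_rank s') = u 0 (enum_rank s).
    have := uL u (enum_rank s); rewrite uL0 mxE enum_rankK => /eqP.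
    by rewrite eq_sym subr_eq0 => /eqP ->.
  have := harmonic_const h (enum_val j) s0.
  by rewrite enum_valK !mxE.
have Lv : (L <= kermx v)%MS.
  apply/sub_kermxP; apply/matrixP => i k; rewrite !mxE.
  under eq_bigr do rewrite !mxE mulrBl.
  rewrite sumrB (bigD1 i)//= eqxx mul1r big1 ?addr0; last first.
    by move=> j; rewrite eq_sym => /negPf ->; rewrite mul0r.
  have := piQ (enum_val i); rewrite -ev.
  under eq_bigr do rewrite mulrC.
  by move=> ->; rewrite subrr.
have vr : \rank v = 1%N.
  apply/eqP; rewrite eqn_leq rank_leq_col/= lt0n mxrank_eq0.
  apply/eqP => /matrixP/(_ (enum_rank s0) 0); rewrite !mxE enum_rankK => /eqP.
  by rewrite gt_eqF.
have rkL : (\rank (kermx v) <= \rank L)%N.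
  move: rkK; rewrite !mxrank_ker vr leq_subLR => h.
  by rewrite leq_subLR addnC.
have vL : (kermx v <= L)%MS.
  by rewrite -(mxrank_leqif_sup Lv) eqn_leq mxrankS.
have /submxP[u uE] : (w <= L)%MS.
  apply: submx_trans vL; apply/sub_kermxP; apply/matrixP => i k; rewrite !mxE.
  under eq_bigr do rewrite !mxE mulrC.
  by rewrite (ev (fun s => pi s * g s)).
exists (fun s => u 0 (enum_rank s)) => s.
have := uL u (enum_rank s); rewrite -uE mxE enum_rankK => <-.
by [].
Qed.

End harmonic.

Section full_flux.
Context {R : realType} {S : finType} (W : S * S -> R).
Hypotheses (W_ge0 : forall e, 0 <= W e)
  (W_irr : forall s s', connect (fun s s' => 0 < W (s, s')) s s')
  (W_row : forall s, exists s', 0 < W (s, s')).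

Definition state_mx : 'M[R]_#|S| := \matrix_(i, j) W (enum_val i, enum_val j).

(** The flux of a stationary cyclic walk: an edge is completed to a loop by a
weighted walk, and the trace is cyclic. *)
Lemma full_flux : (0 < #|S|)%N -> exists C : S * S -> R,
  [/\ Mst R S C, carried W C & forall e, 0 < W e -> 0 < C e].
Proof.
move=> /card_gt0P[s0 _].
have P0 : nonneg_mx state_mx by move=> i j; rewrite mxE.
have Pirr : irreducible_mx state_mx.
  move=> i j; have /connectP[p] := W_irr (enum_val i) (enum_val j).
  elim: p i => [|s p IH] i /=; first by move=> _ /enum_val_inj ->.
  move=> /andP[Wis sp] /esym lastp.
  apply: (@connect_trans _ _ (enum_rank s)).
    by apply: connect1; rewrite mxE enum_rankK.
  by apply: IH; rewrite enum_rankK.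
have [K KP] := irreducible_sum_expmx P0 Pirr.
set G := \sum_(k < K) state_mx ^+ k in KP.
have GP : state_mx *m G = G *m state_mx.
  rewrite /G mulmx_sumr mulmx_suml; apply: eq_bigr => k _.
  exact: (commrX k (commr_refl state_mx)).
have ev (f : 'I_#|S| -> R) : \sum_i f i = \sum_s f (enum_rank s).
  rewrite (reindex (@enum_rank S))//=.
  by apply: onW_bij; exact: enum_rank_bij.
pose C0 (e : S * S) := W e * G (enum_rank e.2) (enum_rank e.1).
have C00 e : 0 <= C0 e by rewrite mulr_ge0// ltW.
have C0st s : \sum_s' C0 (s, s') = \sum_s' C0 (s', s).
  have := congr1 (fun L : 'M[R]_#|S| => L (enum_rank s) (enum_rank s)) GP.
  rewrite !mxE !ev.
  under eq_bigr do rewrite mxE !enum_rankK.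
  under [RHS]eq_bigr do rewrite mxE !enum_rankK mulrC.
  by [].
have C0pos e : (0 < W e) -> 0 < C0 e by move=> We; rewrite mulr_gt0.
pose t := \sum_e C0 e.
have t0 : 0 < t.
  have [s1 Ws1] := W_row s0.
  by rewrite /t (bigD1 (s0, s1))//= ltr_wpDr ?sumr_ge0// C0pos.
exists (fun e => t^-1 * C0 e); split.
- split.
  + by move=> e; rewrite mulr_ge0// invr_ge0 ltW.
  + by rewrite -mulr_sumr mulVf// gt_eqF.
  + by move=> s; rewrite -!mulr_sumr C0st.
- move=> e; split; first by rewrite mulr_ge0// invr_ge0 ltW.
  rewrite pmulr_rgt0 ?invr_gt0// => h; rewrite lt_neqAle W_ge0 andbT.
  by apply: contraTneq h; rewrite /C0 => <-; rewrite mul0r ltxx.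
- by move=> e We; rewrite mulr_gt0 ?invr_gt0// C0pos.
Qed.

End full_flux.

(** * Law of large numbers in blocks *)

(** Among sites [0 .. N-1], block [k] of [m.+1] consists of those [i] with
[k * N < i.+1 * m.+1 <= k.+1 * N]. *)
Definition block_of (m N i : nat) : 'I_m.+1 := inord ((i.+1 * m.+1).-1 %/ N).

Definition block_start (m N k : nat) : nat := (k * N %/ m.+1)%N.

Lemma leq_block_start m N k i :
  (block_start m N k <= i)%N = (k * N < i.+1 * m.+1)%N.
Proof. by rewrite /block_start -ltnS ltn_divLR. Qed.

Lemma block_ofE m N i (k : 'I_m.+1) : (i < N)%N ->
  (block_of m N i == k) = (block_start m N k <= i < block_start m N k.+1)%N.
Proof.
move=> ltiN; have N0 : (0 < N)%N by apply: leq_ltn_trans ltiN.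
rewrite ltnNge !leq_block_start -leqNgt.
rewrite -val_eqE /= inordK; last first.
  rewrite ltn_divLR//; move: ltiN; rewrite mulSn => h.
  have : (i.+1 * m.+1 <= m.+1 * N)%N by rewrite mulnC leq_mul2l h orbT.
  by rewrite mulSn addSn.
set j := (i.+1 * m.+1)%N.
have j0 : (0 < j)%N by rewrite muln_gt0.
rewrite eqn_leq -ltnS ltn_divLR// leq_divRL// andbC.
by congr (_ && _); rewrite -(prednK j0) ltnS.
Qed.

Lemma block_start_le m N k : (block_start m N k <= block_start m N k.+1)%N.
Proof. by rewrite leq_div2r// leq_mul2r leqnSn orbT. Qed.

(** The endpoints only serve to bound the sum by twice the supremum of [v]. *)
Lemma telescope_interval (V : zmodType) (v : nat -> V) a b n : (a <= b)%N ->
  exists i j, \sum_(0 <= i < n) (v i.+1 - v i) *+ (a <= i < b)%N = v i - v j.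
Proof.
move=> ab; pose clamp j := maxn a (minn j b).
exists (clamp n), (clamp 0%N).
rewrite -(@telescope_sumr _ 0%N n (fun j => v (clamp j)))//.
apply: eq_bigr => i _; rewrite /clamp; case: (boolP (a <= i < b)%N) => h.
  have -> : maxn a (minn i.+1 b) = i.+1 by lia.
  have -> : maxn a (minn i b) = i by lia.
  by rewrite mulr1n.
have -> : maxn a (minn i.+1 b) = maxn a (minn i b) by lia.
by rewrite subrr.
Qed.

Lemma count_interval (a b n : nat) : (a <= b <= n)%N ->
  (\sum_(0 <= i < n) (a <= i < b) = b - a)%N.
Proof.
move=> /andP[ab bn].
elim: n b ab bn => [|n IH] b ab bn; first by rewrite big_geq//; lia.
rewrite big_nat_recr//=.
have [bn1|bn1] := leqP b n.
  by rewrite IH//; lia.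
have -> : b = n.+1 by lia.
have [an|an] := leqP a n; last first.
  by rewrite big_nat big1 => [|i]; lia.
rewrite -(_ : n - a = \sum_(0 <= i < n) (a <= i < n.+1))%N; first lia.
rewrite -(IH n)//; apply: eq_big_nat => i /andP[_ h]; lia.
Qed.

Section law_of_large_numbers.
Context {R : realType} {S : finType} (m : nat).
Variable C : 'I_m.+1 -> S * S -> R.
Hypotheses (C_st : forall k, Mst R S (C k))
  (C_marg : forall k s, 0 < first_marginal (C k) s)
  (C_irr : forall k s s', connect (fun s s' => 0 < C k (s, s')) s s').

Let Q k := kernel_of (C k).

Lemma kernel_ge0 k e : 0 <= Q k e.
Proof. by have [C0 _ _] := C_st k; apply: divr_ge0 => //; exact: ltW. Qed.

Lemma kernel_row k s : \sum_s' Q k (s, s') = 1.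
Proof.
by rewrite /Q /kernel_of/= -mulr_suml -/(first_marginal _ _) mulfV// gt_eqF.
Qed.

(** Corrected by the increment of a solution of the Poisson equation, a centred
observable has conditional mean 0 at every step. *)
Lemma poisson_step k (f : S * S -> R) : \sum_e C k e * f e = 0 ->
  exists u : S -> R, forall s,
    \sum_s' Q k (s, s') * (f (s, s') + u s' - u s) = 0.
Proof.
move=> Cf; have [C0 C1 Cst] := C_st k.
have QC s s' : first_marginal (C k) s * Q k (s, s') = C k (s, s').
  by rewrite /Q /kernel_of/= mulrC divfK// gt_eqF.
have Qirr s s' : connect (fun s s' => 0 < Q k (s, s')) s s'.
  apply: connect_sub (C_irr k s s') => t t' Ct.
  by apply: connect1; rewrite /Q /kernel_of divr_gt0.
have [||u hu] := poisson_equation (kernel_ge0 k) (kernel_row k) Qirr (C_marg k)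
    (g := fun s => \sum_s' Q k (s, s') * f (s, s')).
- by move=> s'; under eq_bigr do rewrite QC; rewrite -Cst.
- rewrite -[RHS]Cf [RHS](eq_bigr (fun e => C k (e.1, e.2) * f (e.1, e.2))); last by case.
  rewrite -(pair_bigA _ (fun s s' => C k (s, s') * f (s, s')))/=.
  by apply: eq_bigr => s _; rewrite mulr_sumr; apply: eq_bigr => s' _; rewrite mulrA QC.
exists u => s.
under eq_bigr do rewrite -addrA mulrDr mulrBr.
by rewrite big_split/= sumrB -hu -mulr_suml kernel_row mul1r subrKA subrr.
Qed.

Let B n := block_of m n.+1.

Lemma block_size n (k : 'I_m.+1) :
  `|\sum_(i < n) ((B n i == k)%:R : R) - n.+1%:R / m.+1%:R| <= 2.
Proof.
pose a := block_start m n.+1 k; pose b := block_start m n.+1 k.+1.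
have ab : (a <= b)%N by exact: block_start_le.
have bn : (b <= n.+1)%N.
  rewrite -[leqRHS](@mulKn _ m.+1)// leq_div2r// leq_mul2r; apply/orP; right.
  exact: ltn_ord.
have sE : \sum_(i < n.+1) ((B n i == k)%:R : R) = (b - a)%N%:R.
  rewrite -(@count_interval a b n.+1) ?ab// natr_sum [RHS]big_mkord.
  by apply: eq_bigr => i _; rewrite block_ofE.
have m0 : 0 < (m.+1%:R : R) by rewrite ltr0n.
have fl j : (block_start m n.+1 j)%:R <= j%:R * n.+1%:R / m.+1%:R :> R /\
    j%:R * n.+1%:R / m.+1%:R <= (block_start m n.+1 j)%:R + 1 :> R.
  split; first by rewrite ler_pdivlMr// -!natrM ler_nat leq_divM.
  by rewrite ler_pdivrMr// natr1 -!natrM ler_nat ltnW// ltn_ceil.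
move: sE; rewrite big_ord_recr/=; set c := (_ == _)%:R => sE.
have -> : \sum_(i < n) ((B n i == k)%:R : R) = (b - a)%N%:R - c by rewrite -sE addrK.
have c01 : 0 <= c <= 1 by rewrite /c; case: eqP; rewrite ?lexx ler01.
have [a1 a2] := fl k; have [b1 b2] := fl k.+1.
have e : k.+1%:R * n.+1%:R / m.+1%:R =
    k%:R * n.+1%:R / m.+1%:R + n.+1%:R / m.+1%:R :> R.
  by rewrite -[k.+1%:R]natr1 !mulrDl mul1r.
rewrite -/a in a1 a2; rewrite -/b in b1 b2.
have /andP[c0 c1] := c01.
rewrite natrB// ler_norml; move: a1 a2 b1 b2; rewrite e.
move: (k%:R * n.+1%:R / m.+1%:R) (n.+1%:R / m.+1%:R) a%:R b%:R c c0 c1 {c01 sE}.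
by move=> X Y a' b' c' c0 c1 a1 a2 b1 b2; apply/andP; split; lra.
Qed.

(** The deviation of a block count is a martingale, to which the second moment
estimate applies, up to a telescoping sum and a rounding error that stay
bounded. *)
Lemma block_count_second_moment : exists2 K : R, 0 <= K &
  forall n k e, \sum_(p : {ffun 'I_n.+1 -> S})
    path_prod (fun i => Q (B n i)) p *
    (block_count (B n) p k e - C k e * (n.+1%:R / m.+1%:R)) ^+ 2 <= K * n.+1%:R.
Proof.
suff /choice[K KP] : forall ke : 'I_m.+1 * (S * S), exists K : R, 0 <= K /\
    forall n, \sum_(p : {ffun 'I_n.+1 -> S})
    path_prod (fun i => Q (B n i)) p *
    (block_count (B n) p ke.1 ke.2 - C ke.1 ke.2 * (n.+1%:R / m.+1%:R)) ^+ 2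
    <= K * n.+1%:R.
  exists (\sum_ke K ke).
    by apply: sumr_ge0 => ke _; have [] := KP ke.
  move=> n k e; have [_ /(_ n) h] := KP (k, e).
  apply: le_trans h _; rewrite ler_wpM2r// (bigD1 (k, e))//= lerDl.
  by apply: sumr_ge0 => ke _; have [] := KP ke.
move=> [k e] /=.
have [C0 C1 Cst] := C_st k.
pose f (e' : S * S) : R := (e' == e)%:R - C k e.
have Cf : \sum_e' C k e' * f e' = 0.
  rewrite /f; under eq_bigr do rewrite mulrBr.
  rewrite sumrB -mulr_suml C1 mul1r (bigD1 e)//= eqxx mulr1 big1 ?addr0 ?subrr//.
  by move=> e' /negPf ->; rewrite mulr0.
have [u hu] := poisson_step Cf.
pose U := \sum_s `|u s|.
have uU s : `|u s| <= U by rewrite /U (bigD1 s)//= lerDl sumr_ge0.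
pose c := `|C k e|.
pose D n i (e' : S * S) : R :=
  if B n i == k then f e' + u e'.2 - u e'.1 else 0.
have U0 : 0 <= U by apply: sumr_ge0.
have c0 : 0 <= c by exact: normr_ge0.
pose L := 1 + c + 2 * U; pose L' := 2 * U + 2 * c.
have DL n i e' : `|D n i e'| <= L.
  rewrite /D; case: ifP => _; last by rewrite normr0 /L; lra.
  have f1 : `|f e'| <= 1 + c.
    rewrite (le_trans (ler_normB _ _))// lerD//.
    by case: eqP; rewrite ?normr1 ?normr0.
  apply: le_trans (ler_normB _ _) _; have := uU e'.1; have := uU e'.2.
  have := ler_normD (f e') (u e'.2); rewrite /L; lra.
exists (2 * #|S|%:R * L ^+ 2 + 2 * #|S|%:R * L' ^+ 2); split.
  by apply: addr_ge0; apply: mulr_ge0; rewrite ?sqr_ge0 ?mulr_ge0.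
move=> n.
have dev (p : {ffun 'I_n.+1 -> S}) : block_count (B n) p k e - C k e * (n.+1%:R / m.+1%:R) =
    path_sum (D n) p -
    (\sum_(i < n) (B n i == k)%:R * (u (site p i.+1) - u (site p i)) -
     C k e * (\sum_(i < n) ((B n i == k)%:R) - n.+1%:R / m.+1%:R)).
  set X : R := \sum_(i < n) (_ * (u _ - u _)).
  set Y : R := \sum_(i < n) ((B n i == k)%:R : R).
  have h : block_count (B n) p k e - C k e * Y = path_sum (D n) p - X.
    rewrite /block_count /path_sum /X /Y mulr_sumr -!sumrB; apply: eq_bigr => i _.
    rewrite /D /f; case: eqP => _ /=; last by rewrite mul0r mulr0 !subr0.
    by rewrite mul1r mulr1 /step/=; ring.
  by move/eqP: h; rewrite subr_eq => /eqP ->; ring.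
have tel (p : {ffun 'I_n.+1 -> S}) : `|\sum_(i < n) (B n i == k)%:R * (u (site p i.+1) - u (site p i))| <= 2 * U.
  have [i [j]] := @telescope_interval R (fun i => u (site p i))
    (block_start m n.+1 k) (block_start m n.+1 k.+1) n (block_start_le _ _ _).
  rewrite big_mkord => E.
  rewrite (_ : \sum_(i < n) _ = u (site p i) - u (site p j)).
    apply: le_trans (ler_normB _ _) _.
    by rewrite mulr_natl mulr2n lerD.
  rewrite -E; apply: eq_bigr => t _; rewrite block_ofE; last first.
    exact: leq_trans (ltn_ord t) _.
  by rewrite mulr_natl.
apply: (@le_trans _ _ (\sum_(p : {ffun 'I_n.+1 -> S})
   (2 * (path_prod (fun i => Q (B n i)) p * path_sum (D n) p ^+ 2) +
    path_prod (fun i => Q (B n i)) p * (2 * L' ^+ 2)))).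
  apply: ler_sum => p _; rewrite [2 * (_ * _)]mulrCA -mulrDr ler_wpM2l//.
    by apply: path_prod_ge0 => i e'; exact: kernel_ge0.
  rewrite dev; set X := path_sum _ _; set Y := (X in _ - X).
  have YL : `|Y| <= L'.
    rewrite /Y (le_trans (ler_normB _ _))// lerD ?tel//.
    rewrite normrM -/c mulrC ler_wpM2r//; exact: block_size.
  have : Y ^+ 2 <= L' ^+ 2.
    by rewrite -real_normK ?num_real// ler_sqr ?nnegrE// (le_trans _ YL).
  have : 0 <= (X + Y) ^+ 2 by exact: sqr_ge0.
  rewrite (_ : (X - Y) ^+ 2 = 2 * X ^+ 2 + 2 * Y ^+ 2 - (X + Y) ^+ 2); last by ring.
  lra.
rewrite big_split/= -mulr_sumr -mulr_suml.
rewrite sum_path_prod_eq; last by move=> i s; exact: kernel_row.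
rewrite [leRHS]mulrDl; apply: lerD.
  rewrite (_ : 2 * _ * _ * n.+1%:R = 2 * (#|S|%:R * (L ^+ 2 * n.+1%:R))); last by ring.
  rewrite ler_wpM2l//.
  have := @second_moment R S n (fun i => Q (B n i)) (D n) L _ _ _ (DL n).
  move=> /(_ _ _ _)/le_trans; apply.
  - by move=> i e'; exact: kernel_ge0.
  - by move=> i s; exact: kernel_row.
  - move=> i s; rewrite /D; case: eqP => [->|_]; first exact: hu.
    by apply: big1 => s' _; rewrite mulr0.
  - rewrite (_ : _ * n%:R * _ = #|S|%:R * (L ^+ 2 * n%:R)); last by ring.
    by rewrite ler_wpM2l// ler_wpM2l ?sqr_ge0// ler_nat.
rewrite (_ : #|S|%:R * (2 * L' ^+ 2) = 2 * #|S|%:R * L' ^+ 2); last by ring.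
by rewrite ler_peMr ?ler1n// mulr_ge0 ?sqr_ge0// mulr_ge0.
Qed.

End law_of_large_numbers.

(** * Lower bound for weighted paths *)

Lemma near_natr_ge (R : realType) (a : R) : \forall n \near \oo, a <= n.+1%:R.
Proof.
near=> n; rewrite (le_trans (ltW (truncnS_gt a)))// ler_nat ltnS.
by near: n; exact: nbhs_infty_ge.
Unshelve. all: by end_near. Qed.

Lemma near_expR_le (R : realType) (c e : R) : 0 < c -> 0 < e ->
  \forall n \near \oo, expR (- (n.+1%:R * e)) <= c.
Proof.
move=> c0 e0; near=> n; rewrite -[leRHS]lnK// ler_expR lerNl.
rewrite -ler_pdivrMr//; near: n; exact: near_natr_ge.
Unshelve. all: by end_near. Qed.

Section path_lower_bound.
Context {R : realType} {S : finType} (m : nat) (W : S * S -> R).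
Hypothesis W_ge0 : forall e, 0 <= W e.

Definition tracks (C : 'I_m.+1 -> S * S -> R) (d : R) n (p : {ffun 'I_n.+1 -> S}) :=
  [forall k, forall e, `|block_count (block_of m n.+1) p k e -
      C k e * (n.+1%:R / m.+1%:R)| <= d * n.+1%:R].

(** Tilting to the Markov chain with fluxes [C k]: by Chebyshev's inequality the
chain tracks [C] with probability at least 1/2, and on these paths the density of
the change of measure is controlled by the cost. *)
Lemma full_path_lower_bound (C : 'I_m.+1 -> S * S -> R) :
  (0 < #|S|)%N ->
  (forall k, Mst R S (C k)) -> (forall k s, 0 < first_marginal (C k) s) ->
  (forall k s s', connect (fun s s' => 0 < C k (s, s')) s s') ->
  (forall k, carried W (C k)) ->
  exists2 c : R, 0 <= c & forall d, 0 < d -> \forall n \near \oo,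
    2^-1 * expR (- (n.+1%:R * (m.+1%:R^-1 * \sum_k flux_cost W (C k) + c * d)))
    <= \sum_(p : {ffun 'I_n.+1 -> S} | tracks C d p) path_prod (fun=> W) p.
Proof.
move=> S0 C_st C_marg C_irr C_car.
have [K K0 KP] := block_count_second_moment C_st C_marg C_irr.
pose l k e := ln (C k e / (first_marginal (C k) e.1 * W e)).
exists (\sum_k \sum_e `|l k e|); first by do 2!apply: sumr_ge0 => ? _.
move=> d d0.
pose Q n i := kernel_of (C (block_of m n.+1 i)).
have Q0 n i e : 0 <= Q n i e by exact: kernel_ge0.
pose L := \sum_(k < m.+1) \sum_(e : S * S) K / d ^+ 2.
have L0 : 0 <= L by do 2!apply: sumr_ge0 => ? _; rewrite divr_ge0// sqr_ge0.
near=> n.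
pose N : R := n.+1%:R.
have N0 : 0 < N by rewrite ltr0n.
have bad : \sum_(p : {ffun 'I_n.+1 -> S} | ~~ tracks C d p) path_prod (Q n) p <= L / N.
  apply: (@le_trans _ _ (\sum_(p : {ffun 'I_n.+1 -> S}) \sum_k \sum_e
    path_prod (Q n) p * (block_count (block_of m n.+1) p k e -
      C k e * (n.+1%:R / m.+1%:R)) ^+ 2 / (d * N) ^+ 2)).
    rewrite big_mkcond/=; apply: ler_sum => p _; case: ifPn => [|_]; last first.
      do 2!apply: sumr_ge0 => ? _.
      by rewrite divr_ge0 ?sqr_ge0// mulr_ge0 ?sqr_ge0// path_prod_ge0.
    rewrite negb_forall => /existsP[k]; rewrite negb_forall => /existsP[e].
    rewrite -ltNge => dev.
    rewrite (bigD1 k)//= (bigD1 e)//=.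
    apply: (@le_trans _ _ (path_prod (Q n) p * (block_count (block_of m n.+1) p k e -
      C k e * (n.+1%:R / m.+1%:R)) ^+ 2 / (d * N) ^+ 2)).
      rewrite -mulrA ler_peMr ?path_prod_ge0// ler_pdivlMr ?exprn_gt0 ?mulr_gt0//.
      rewrite mul1r -[leRHS]real_normK ?num_real// ler_sqr ?nnegrE// ltW//.
      by rewrite mulr_gt0.
    rewrite -addrA lerDl addr_ge0//.
      apply: sumr_ge0 => ? _.
      by rewrite divr_ge0 ?sqr_ge0// mulr_ge0 ?sqr_ge0// path_prod_ge0.
    do 2!apply: sumr_ge0 => ? _.
    by rewrite divr_ge0 ?sqr_ge0// mulr_ge0 ?sqr_ge0// path_prod_ge0.
  rewrite exchange_big/= /L mulr_suml; apply: ler_sum => k _.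
  rewrite exchange_big/= mulr_suml; apply: ler_sum => e _.
  rewrite -mulr_suml ler_pdivrMr ?exprn_gt0 ?mulr_gt0//.
  apply: le_trans (KP n k e) _; rewrite -/N le_eqVlt; apply/orP; left; apply/eqP.
  by field; rewrite !gt_eqF.
have good : 2^-1 <= \sum_(p : {ffun 'I_n.+1 -> S} | tracks C d p) path_prod (Q n) p.
  have sumQ : \sum_(p : {ffun 'I_n.+1 -> S}) path_prod (Q n) p = #|S|%:R.
    by apply: sum_path_prod_eq => i s; exact: kernel_row.
  rewrite (bigID (fun p => tracks C d p))/= in sumQ.
  have S1 : 1 <= #|S|%:R :> R by rewrite ler1n.
  have LN : L / N <= 2^-1.
    rewrite ler_pdivrMr// mulrC -ler_pdivrMr ?invr_gt0// /N.
    by near: n; exact: near_natr_ge.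
  move: sumQ bad S1 LN; move: (L / N) (\sum_(i | ~~ _) _) (#|S|%:R : R) => a b c.
  by move=> sumQ bad S1 LN; lra.
apply: (@le_trans _ _ (\sum_(p : {ffun 'I_n.+1 -> S} | tracks C d p) path_prod (Q n) p *
   expR (- (N * (m.+1%:R^-1 * \sum_k flux_cost W (C k) + (\sum_k \sum_e `|l k e|) * d))))).
  by rewrite -mulr_suml ler_wpM2r// expR_ge0.
apply: ler_sum => p /forallP good_p.
have [Qp|Qp] := pselect (forall i, (i < n)%N -> 0 < Q n i (step p i)); last first.
  rewrite [leLHS](_ : _ = 0) ?path_prod_ge0//.
  move/existsNP : Qp => [i /not_implyP[ltin /negP]]; rewrite -leNgt => Qi.
  rewrite /path_prod (bigD1 (Ordinal ltin))//=.
  by have -> : Q n i (step p i) = 0; [apply/eqP; rewrite eq_le Qi Q0|rewrite !mul0r].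
have Wp i : (i < n)%N -> 0 < W (step p i).
  move=> /Qp; rewrite /Q /kernel_of => Qi.
  have [C0 CW] := C_car (block_of m n.+1 i) (step p i); apply: CW.
  rewrite lt_neqAle C0 andbT; apply: contraTneq Qi => <-.
  by rewrite mul0r ltxx.
rewrite (@path_prod_tilt _ _ _ (block_of m n.+1) W _ p C Qp Wp) ler_wpM2l ?path_prod_ge0//.
rewrite ler_expR lerN2.
have -> : N * (m.+1%:R^-1 * (\sum_k flux_cost W (C k)) + (\sum_k \sum_e `|l k e|) * d) =
    \sum_k \sum_e (C k e * (N / m.+1%:R) * l k e + `|l k e| * (d * N)).
  have e1 k : \sum_e (C k e * (N / m.+1%:R) * l k e + `|l k e| * (d * N)) =
      N / m.+1%:R * flux_cost W (C k) + (\sum_e `|l k e|) * (d * N).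
    rewrite big_split/= mulr_suml mulr_sumr; congr (_ + _).
    by apply: eq_bigr => e _; rewrite /l; ring.
  under [RHS]eq_bigr do rewrite e1.
  by rewrite big_split/= -mulr_sumr -mulr_suml; ring.
apply: ler_sum => k _; apply: ler_sum => e _.
have /forallP/(_ e) := good_p k; rewrite -/(l k e) -/N.
rewrite -lerBlDl -mulrBl => h; apply: le_trans (ler_norm _) _.
by rewrite normrM mulrC ler_wpM2l.
Unshelve. all: by end_near. Qed.

(** Mixing in a little of a fully supported flux makes any flux of finite cost
irreducible, at a small cost. *)
Lemma path_lower_bound (C : 'I_m.+1 -> S * S -> R) (d eps : R) :
  (0 < #|S|)%N ->
  (forall s s', connect (fun s s' => 0 < W (s, s')) s s') ->
  (forall s, exists s', 0 < W (s, s')) ->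
  (forall k, Mst R S (C k)) -> (forall k, carried W (C k)) ->
  0 < d -> 0 < eps -> \forall n \near \oo,
    2^-1 * expR (- (n.+1%:R * (m.+1%:R^-1 * \sum_k flux_cost W (C k) + eps)))
    <= \sum_(p : {ffun 'I_n.+1 -> S} | tracks C d p) path_prod (fun=> W) p.
Proof.
move=> S0 W_irr W_row C_st C_car d0 eps0.
have [F [[F0 F1 Fst] Fcar Fpos]] := full_flux W_ge0 W_irr W_row S0.
pose D (t : R) k e := (1 - t) * C k e + t * F e.
have m0 : 0 < (m.+1%:R : R) by rewrite ltr0n.
have t01 : \forall t \near (0 : R)^'+, 0 < t < 1.
  near=> t; apply/andP; split; near: t; [exact: nbhs_right_gt|exact: nbhs_right_lt].
have D_car k : \forall t \near (0 : R)^'+, carried W (D t k).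
  near=> t; have /andP[t0 t1] : 0 < t < 1 by near: t.
  by apply: carriedD; apply: carriedZ => //; lra.
have D_cvg k e : D t k e @[t --> (0 : R)^'+] --> C k e.
  rewrite [X in _ --> X](_ : _ = (1 - 0) * C k e + 0 * F e); last by ring.
  have idc : t @[t --> (0 : R)^'+] --> (0 : R).
    exact: cvg_at_right_filter cvg_id.
  apply: cvgD; apply: cvgM; try exact: cvg_cst.
    by apply: cvgB => //; exact: cvg_cst.
  exact: idc.
have cost_cvg : \sum_k flux_cost W (D t k) @[t --> (0 : R)^'+] --> \sum_k flux_cost W (C k).
  by apply: cvg_sumr => k _; have [] := flux_cost_cvg (D_car k) (D_cvg k).
pose T := \sum_k \sum_e `|C k e - F e|.
have T0 : 0 <= T by do 2!apply: sumr_ge0 => ? _.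
have [t [/andP[t0 t1] tcost tT]] : exists t, [/\ 0 < t < 1,
    m.+1%:R^-1 * \sum_k flux_cost W (D t k) <=
    m.+1%:R^-1 * \sum_k flux_cost W (C k) + eps / 2 & t * T <= d / 2].
  apply: (@filter_ex _ (0 : R)^'+); near=> t; split.
  - by near: t.
  - rewrite -ler_pdivlMl ?invr_gt0// invrK mulrDr mulrA mulfV ?gt_eqF// mul1r -lerBlDl.
    apply: le_trans (ler_norm _) _; rewrite distrC; near: t.
    by move/cvgrPdist_le : cost_cvg; apply; rewrite mulr_gt0// divr_gt0.
  - have tt : t <= d / 2 / (T + 1).
      by near: t; apply: nbhs_right_le; rewrite !divr_gt0//; lra.
    have : 0 < t by near: t; exact: nbhs_right_gt.
    move=> t0; rewrite ler_pdivlMr in tt; last lra.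
    by apply: le_trans tt; rewrite ler_wpM2l ?(ltW t0)//; lra.
have DF k e : t * F e <= D t k e.
  by have [C0 _ _] := C_st k; rewrite /D lerDr mulr_ge0//; lra.
have D_st k : Mst R S (D t k).
  have [C0 C1 Cst] := C_st k; split.
  - by move=> e; rewrite addr_ge0// mulr_ge0//; lra.
  - by rewrite /D big_split/= -!mulr_sumr C1 F1; ring.
  - by move=> s; rewrite /D !big_split/= -!mulr_sumr Cst Fst.
have D_pos k e : 0 < W e -> 0 < D t k e.
  by move=> /Fpos We; apply: lt_le_trans (DF k e); rewrite mulr_gt0.
have [|||c c0 Hc] := @full_path_lower_bound (D t) S0 D_st.
- move=> k s; have [s' Ws] := W_row s.
  rewrite /first_marginal (bigD1 s')//= ltr_wpDr ?D_pos//.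
  by have [D0 _ _] := D_st k; exact: sumr_ge0.
- move=> k s s'; apply: connect_sub (W_irr s s') => u u' Wu.
  by apply: connect1; exact: D_pos.
- by move=> k; apply: carriedD; apply: carriedZ => //; lra.
pose d' := Num.min (d / 2) (eps / 2 / (c + 1)).
have d'0 : 0 < d' by rewrite lt_min !divr_gt0//; lra.
have cd' : c * d' <= eps / 2.
  have : d' <= eps / 2 / (c + 1) by rewrite ge_min lexx orbT.
  rewrite ler_pdivlMr; last lra.
  by apply: le_trans; rewrite mulrC ler_wpM2l ?ltW//; lra.
have d'd : d' <= d / 2 by rewrite ge_min lexx.
near=> n.
have N0 : 0 < (n.+1%:R : R) by rewrite ltr0n.
have : 2^-1 * expR (- (n.+1%:R * (m.+1%:R^-1 * \sum_k flux_cost W (D t k) + c * d')))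
    <= \sum_(p : {ffun 'I_n.+1 -> S} | tracks (D t) d' p) path_prod (fun=> W) p.
  by near: n; exact: Hc.
move=> h; apply: le_trans (le_trans h _).
  rewrite ler_wpM2l// ler_expR lerN2 ler_wpM2l//.
  by apply: le_trans (lerD tcost cd') _; rewrite -addrA lerD2l; lra.
rewrite big_mkcond [leRHS]big_mkcond/=; apply: ler_sum => p _.
case: ifPn => [/forallP tr|_]; last by case: ifP => // _; exact: path_prod_ge0.
case: ifPn => // /negP[]; apply/forallP => k; apply/forallP => e.
have /forallP/(_ e) := tr k; set b := block_count _ _ _ _; set N : R := n.+1%:R.
move=> hb.
have -> : b - C k e * (N / m.+1%:R) = (b - D t k e * (N / m.+1%:R)) -
     t * (C k e - F e) * (N / m.+1%:R) by rewrite /D; ring.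
apply: le_trans (ler_normB _ _) _.
have h2 : `|t * (C k e - F e) * (N / m.+1%:R)| <= d / 2 * N.
  rewrite normrM (ger0_norm (_ : 0 <= N / m.+1%:R)) ?divr_ge0//.
  apply: ler_pM => //; rewrite ?divr_ge0//.
    rewrite normrM gtr0_norm//; apply: le_trans tT; rewrite ler_wpM2l ?(ltW t0)//.
    rewrite /T (bigD1 k)//= (bigD1 e)//= -addrA lerDl addr_ge0 ?sumr_ge0//.
    by move=> k' _; apply: sumr_ge0.
  by rewrite ler_pdivrMr// ler_peMr ?ler1n.
have : d' * N <= d / 2 * N by rewrite ler_wpM2r// ltW.
move: hb h2; rewrite -/N; set z := d' * N; lra.
Unshelve. all: by end_near. Qed.

End path_lower_bound.

Section model.
Context {R : realType} {A B : finType}.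
Variables (M : A -> 'M[R]_#|B|) (x y : B -> R) (lam : R).
Hypotheses (A_gt0 : (0 < #|A|)%N) (B_gt0 : (0 < #|B|)%N)
  (M_ge0 : forall a, nonneg_mx (M a)) (M_irr : forall a, irreducible_mx (M a))
  (M_aper : forall a, aperiodic_mx (M a)) (x_gt0 : forall b, 0 < x b)
  (y_gt0 : forall b, 0 < y b) (lamP : perron_eigenvalue (\sum_a M a) lam).

Notation W := (edge_weight M).

Lemma card_state_gt0 : (0 < #|{: A * B}|)%N.
Proof. by rewrite card_prod muln_gt0 A_gt0. Qed.

Lemma row_pos a b : exists b', 0 < mxent (M a) b b'.
Proof.
have [j Mj] := aperiodic_row_pos (enum_rank b) (M_ge0 a) (M_aper a).
by exists (enum_val j); rewrite /mxent enum_valK.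
Qed.

Lemma edge_row s : exists s', 0 < W (s, s').
Proof. by have [b' Mb] := row_pos s.1 s.2; exists (s.1, b'). Qed.

(** To go from [(a, b)] to [(a', b')], follow a walk of the graph of [M a] with the
letter [a] and change the letter in the last step. *)
Lemma edge_connect s s' : connect (fun s s' => 0 < W (s, s')) s s'.
Proof.
case: s s' => a b [a' b'].
suff h i j : connect (fun k l => 0 < M a k l) i j -> forall b1,
    0 < M a (enum_rank b1) i ->
    connect (fun s s' => 0 < W (s, s')) (a, b1) (a', enum_val j).
  have [c Mc] := row_pos a b.
  have := h (enum_rank c) (enum_rank b') (M_irr a _ _) b Mc.
  by rewrite enum_rankK.
move=> /connectP[q qp ->]; elim: q i qp => [|k q IH] i /=.
  by move=> _ b1 Mi; apply: connect1; rewrite /edge_weight /mxent/= enum_valK.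
move=> /andP[Mik kq] b1 Mi.
apply: (@connect_trans _ _ (a, enum_val i)).
  by apply: connect1; rewrite /edge_weight /mxent/= enum_valK.
by apply: IH => //; rewrite enum_valK.
Qed.

Lemma path_weight_bounds : exists c C : R, [/\ 0 < c, 0 < C &
  forall n (p : {ffun 'I_n.+1 -> A * B}),
    c * path_prod (fun=> W) p <= path_weight M y x p <= C * path_prod (fun=> W) p].
Proof.
pose X s := final_weight M x s.
have X0 s : 0 < X s.
  have [b' Mb] := row_pos s.1 s.2.
  rewrite /X /final_weight (bigD1 b')//= ltr_wpDr ?mulr_gt0//.
  by apply: sumr_ge0 => b _; rewrite mulr_ge0 ?(ltW (x_gt0 _))//; exact: M_ge0.
have cX0 s : 0 <= (X s)^-1 by rewrite invr_ge0 ltW.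
have cy0 b : 0 <= (y b)^-1 by rewrite invr_ge0 ltW.
have /card_gt0P[s0 _] := card_state_gt0.
have pos (I : finType) (i0 : I) (f : I -> R) : (forall i, 0 < f i) -> 0 < \sum_i f i.
  by move=> f0; rewrite (bigD1 i0)//= ltr_wpDr// sumr_ge0// => i _; exact: ltW.
have leS (I : finType) (f : I -> R) i : (forall i, 0 <= f i) -> f i <= \sum_i f i.
  by move=> f0; rewrite (bigD1 i)//= lerDl sumr_ge0.
pose k1 := \sum_s (X s)^-1; pose k2 := \sum_b (y b)^-1.
have k10 : 0 < k1 by apply: (pos _ s0) => s; rewrite invr_gt0.
have k20 : 0 < k2 by apply: (pos _ s0.2) => s; rewrite invr_gt0.
exists (k2^-1 * k1^-1), ((\sum_b y b) * (\sum_s X s)); split.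
- by rewrite mulr_gt0// invr_gt0.
- by rewrite mulr_gt0//; [exact: (pos _ s0.2)|exact: (pos _ s0)].
move=> n p; rewrite /path_weight -/(X _) -[_ * _ * X _]mulrA [path_prod _ _ * X _]mulrC mulrA.
have P0 : 0 <= path_prod (fun=> W) p by apply: path_prod_ge0 => _ e; exact: edge_weight_ge0.
rewrite !ler_wpM2r//.
  apply: ler_pM; [exact: ltW|exact: ltW| |].
    exact: (leS _ y _ (fun i => ltW (y_gt0 i))).
  exact: (leS _ X _ (fun i => ltW (X0 i))).
apply: ler_pM; rewrite ?invr_ge0 ?(ltW k10) ?(ltW k20)//.
  rewrite -[leRHS]invrK lef_pV2 ?posrE ?invr_gt0//.
  exact: (leS _ (fun b => (y b)^-1) _ cy0).
rewrite -[leRHS]invrK lef_pV2 ?posrE ?invr_gt0//.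
exact: (leS _ (fun s => (X s)^-1) _ cX0).
Qed.

(** The constants from the boundary weights and the normalization are absorbed by
half of [eps]. *)
Lemma mpm_lower_bound m (C : 'I_m.+1 -> (A * B) * (A * B) -> R) (d eps : R) :
  (forall k, Mst R (A * B)%type (C k)) -> (forall k, carried W (C k)) ->
  0 < d -> 0 < eps -> \forall n \near \oo,
  forall E : set {ffun 'I_n.+1 -> A},
    (forall p : {ffun 'I_n.+1 -> A * B}, tracks C d p -> E (letters p)) ->
    ((expR (- (n.+1%:R * (m.+1%:R^-1 * \sum_k flux_cost W (C k) + ln lam + eps))))%:E
      <= mpm_prob M x y E)%E.
Proof.
move=> C_st C_car d0 eps0.
have [c [c1 [c0 _ cP]]] := path_weight_bounds.
have lam0 : 0 < lam := lam_gt0 A_gt0 B_gt0 M_ge0 M_irr M_aper lamP.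
have [c2 [C1 [_ C10 CP]]] := partition_function_bounds A_gt0 B_gt0 M_ge0 M_irr x_gt0 y_gt0 lamP.
have eps20 : 0 < eps / 2 by rewrite divr_gt0.
have LB := path_lower_bound (edge_weight_ge0 M_ge0) card_state_gt0 edge_connect
  edge_row C_st C_car d0 eps20.
near=> n => E EP.
rewrite mpm_prob_paths lee_fin.
have Z0 : 0 < partition_function M x y n.+1.
  exact: (partition_function_gt0 A_gt0 B_gt0 M_ge0 M_irr M_aper x_gt0 y_gt0 lamP).
rewrite ler_pdivlMr//.
have /andP[_ ZC] := CP n.+1.
set N : R := n.+1%:R; set a := m.+1%:R^-1 * _.
have small : expR (- (N * (eps / 2))) <= c * 2^-1 / C1.
  by rewrite /N; near: n; apply: near_expR_le => //; rewrite !divr_gt0 ?mulr_gt0.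
apply: (@le_trans _ _ (c * (2^-1 * expR (- (N * (a + eps / 2)))))).
  apply: (@le_trans _ _ (expR (- (N * (a + ln lam + eps))) * (C1 * lam ^+ n.+1))).
    by rewrite ler_wpM2l// expR_ge0.
  have -> : lam ^+ n.+1 = expR (N * ln lam) by rewrite expRM_natl lnK ?posrE.
  have -> : expR (- (N * (a + ln lam + eps))) * (C1 * expR (N * ln lam)) =
     C1 * expR (- (N * (eps / 2))) * expR (- (N * (a + eps / 2))).
    by rewrite mulrCA -mulrA; congr (_ * _); rewrite -!expRD; congr expR; lra.
  rewrite [leRHS]mulrA; apply: ler_wpM2r; first exact: expR_ge0.
  by rewrite mulrC -ler_pdivlMr.
have LBn : 2^-1 * expR (- (N * (a + eps / 2)))
    <= \sum_(p : {ffun 'I_n.+1 -> A * B} | tracks C d p) path_prod (fun=> W) p.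
  by rewrite /N /a; near: n; exact: LB.
apply: le_trans (ler_wpM2l (ltW c0) LBn) _.
rewrite mulr_sumr big_mkcond [leRHS]big_mkcond/=; apply: ler_sum => p _.
case: ifPn => [/EP Ep|_].
  by rewrite ifT; [have /andP[] := cP n p|exact/mem_set].
by case: ifP => // _; exact: path_weight_ge0.
Unshelve. all: by end_near. Qed.

End model.

(** * Upper bound: path types *)

Section types.
Context {R : realType} {S : finType} (W : S * S -> R).
Hypothesis W_ge0 : forall e, 0 <= W e.

Definition steps_before n (p : {ffun 'I_n.+1 -> S}) (j : nat) (e : S * S) : nat :=
  \sum_(k < n) ((k < j) && (step p k == e)).

Lemma steps_before_le n (p : {ffun 'I_n.+1 -> S}) j e :
  (steps_before p j e < n.+1)%N.
Proof.
rewrite ltnS -[leqRHS]card_ord -sum1_card leq_sum// => k _.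
by case: (_ && _).
Qed.

Lemma block_count_before m n (p : {ffun 'I_n.+1 -> S}) (k : 'I_m.+1) e :
  block_count (block_of m n.+1) p k e =
  (steps_before p (block_start m n.+1 k.+1) e)%:R -
  (steps_before p (block_start m n.+1 k) e)%:R :> R.
Proof.
rewrite /block_count /steps_before !natr_sum -sumrB; apply: eq_bigr => i _.
rewrite block_ofE; last exact: leq_trans (ltn_ord i) _.
have := block_start_le m n.+1 k.
set a := block_start _ _ _; set b := block_start _ _ _ => ab.
case: (step p i == e); rewrite ?andbT ?andbF ?subrr//.
have [lia|ia] := leqP a i; rewrite ?subr0//=.
by rewrite (leq_trans ia ab) subrr.
Qed.

(** Dyadic times are nested, so that the type of level [J] determines the block
counts of all coarser levels. *)
Definition path_type n J (p : {ffun 'I_n.+1 -> S}) :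
    {ffun 'I_((2 ^ J).+1) * (S * S) -> 'I_n.+1} :=
  [ffun ke : 'I_((2 ^ J).+1) * (S * S) => inord (steps_before p (block_start (2 ^ J).-1 n.+1 ke.1) ke.2)].

Lemma pow2E j : (2 ^ j).-1.+1 = (2 ^ j)%N.
Proof. by rewrite prednK// expn_gt0. Qed.

Lemma block_start_coarse j J N k : (j <= J)%N ->
  block_start (2 ^ j).-1 N k = block_start (2 ^ J).-1 N (k * 2 ^ (J - j)).
Proof.
move=> jJ; rewrite /block_start !pow2E -{2}(subnK jJ) expnD.
by rewrite mulnAC [(_ * 2 ^ (J - j))%N]mulnC divnMl// expn_gt0.
Qed.

Lemma path_type_coarse n J (p p' : {ffun 'I_n.+1 -> S}) j :
  path_type J p = path_type J p' -> (j <= J)%N ->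
  @block_count R _ _ (block_of (2 ^ j).-1 n.+1) _ p =
  block_count (block_of (2 ^ j).-1 n.+1) p'.
Proof.
move=> pp' jJ; apply/funext => k; apply/funext => e.
have h i : (i <= 2 ^ j)%N -> steps_before p (block_start (2 ^ j).-1 n.+1 i) e =
    steps_before p' (block_start (2 ^ j).-1 n.+1 i) e.
  move=> ij; rewrite (block_start_coarse _ _ jJ).
  have i2 : (i * 2 ^ (J - j) < (2 ^ J).+1)%N.
    by rewrite ltnS -[in leqRHS](subnKC jJ) expnD leq_mul2r ij orbT.
  have := congr1 (fun t : {ffun _ -> _} => val (t (Ordinal i2, e))) pp'.
  by rewrite /= !ffunE/= !inordK// steps_before_le.
have := ltn_ord k; rewrite {2}pow2E => k2.
by rewrite !block_count_before !h// ltnW.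
Qed.

(** Some type carries its share of the mass, and then its paths are cheap at every
level up to [J], as the class of type [J] lies in those of the coarser types. *)
Lemma heavy_type n J (E : {pred {ffun 'I_n.+1 -> S}})
    (w : {ffun 'I_n.+1 -> S} -> R) (c t : R) :
  (forall p, 0 <= w p <= c * path_prod (fun=> W) p) -> 0 <= c ->
  0 < t -> t <= \sum_(p in E) w p ->
  exists p, [/\ p \in E, 0 < w p & forall j, (j <= J)%N ->
    t <= n.+1%:R ^+ ((2 ^ J).+1 * (#|S| * #|S|)) * (c * (#|S|%:R *
      expR (- \sum_k flux_cost W (block_count (block_of (2 ^ j).-1 n.+1) p k))))].
Proof.
move=> wP c0 t0 tE.
pose K := #|{: {ffun 'I_((2 ^ J).+1) * (S * S) -> 'I_n.+1}}|.
have KE : K = (n.+1 ^ ((2 ^ J).+1 * (#|S| * #|S|)))%N.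
  by rewrite /K card_ffun !card_ord !card_prod card_ord.
have K0 : 0 < K%:R :> R by rewrite KE ltr0n expn_gt0.
have [ty tyP] : exists ty, t / K%:R <= \sum_(p in E | path_type J p == ty) w p.
  apply: contrapT => /forallNP h; move: tE; apply/negP; rewrite -ltNge.
  rewrite (partition_big (@path_type n J) xpredT)//=.
  apply: (@lt_le_trans _ _ (\sum_(ty : {ffun 'I_((2 ^ J).+1) * (S * S) -> 'I_n.+1}) t / K%:R)).
    apply: ltr_sum.
      by apply/hasP; exists [ffun=> ord0]; rewrite ?mem_index_enum.
    by move=> ty _; rewrite ltNge; apply/negP; exact: h.
  by rewrite sumr_const -/K -[_ *+ K]mulr_natr divfK// gt_eqF.
have tK0 : 0 < t / K%:R by rewrite divr_gt0.
have [p /andP[/andP[pE /eqP pty] wp]] : exists p, (p \in E) && (path_type J p == ty) && (0 < w p).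
  apply: contrapT => /forallNP h; move: (lt_le_trans tK0 tyP).
  rewrite big1 ?ltxx// => p pp; apply/eqP; rewrite eq_le.
  have /andP[-> _] := wP p; rewrite andbT leNgt.
  by apply/negP => wp; apply: (h p); rewrite pp.
exists p; split => // j jJ.
rewrite -natrX -KE mulrC -ler_pdivrMr//; apply: le_trans tyP _.
apply: (@le_trans _ _ (\sum_(q | path_type J q == ty) c * path_prod (fun=> W) q)).
  rewrite big_mkcond [leRHS]big_mkcond/=; apply: ler_sum => q _.
  have /andP[w0 wc] := wP q.
  case: (path_type J q == ty); rewrite ?andbF// andbT.
  by case: ifP => // _; apply: le_trans w0 wc.
rewrite -mulr_sumr ler_wpM2l//.
apply: type_class_le => // q qT; have /eqP qty : path_type J q == ty := qT.
by apply: path_type_coarse jJ; rewrite qty pty.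
Qed.

End types.

Section heavy_path.
Context {R : realType} {A B : finType}.
Variables (M : A -> 'M[R]_#|B|) (x y : B -> R) (lam : R).
Hypotheses (A_gt0 : (0 < #|A|)%N) (B_gt0 : (0 < #|B|)%N)
  (M_ge0 : forall a, nonneg_mx (M a)) (M_irr : forall a, irreducible_mx (M a))
  (M_aper : forall a, aperiodic_mx (M a)) (x_gt0 : forall b, 0 < x b)
  (y_gt0 : forall b, 0 < y b) (lamP : perron_eigenvalue (\sum_a M a) lam).

Notation W := (edge_weight M).

(** The number of dyadic types of level [J] is [exp (o(N))] as long as
[16 ^ J <= N]. *)
Lemma type_entropy_le N J : (0 < N)%N -> (16 ^ J <= N)%N ->
  (2 ^ J).+1%:R * ln N%:R <= 4 / 2 ^+ J * N%:R :> R.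
Proof.
move=> N0 JN; have N0' : 0 < N%:R :> R by rewrite ltr0n.
have : `|xlnx (N%:R^-1 : R)| <= 2 * Num.sqrt `|N%:R^-1|.
  by apply: xlnx_bound; rewrite ger0_norm ?invr_ge0 ?(ltW N0')// invf_le1// ler1n.
rewrite (@gtr0_norm _ (N%:R^-1)) ?invr_gt0// /xlnx lnV ?posrE// mulrN normrN.
have lnN : 0 <= ln (N%:R : R) by rewrite ln_ge0// ler1n.
rewrite ger0_norm; last by rewrite mulr_ge0// invr_ge0 (ltW N0').
rewrite mulrC ler_pdivrMr// => lnN2.
have sq : Num.sqrt (N%:R^-1 : R) <= (4 ^+ J)^-1.
  rewrite -[leRHS]ger0_norm ?invr_ge0 ?exprn_ge0// -sqrtr_sqr ler_wsqrtr//.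
  rewrite exprVn -exprM mulnC exprM lef_pV2 ?posrE ?exprn_gt0//.
  by rewrite (_ : 4 ^+ 2 = 16%:R) -?natrX ?ler_nat// -natrX.
have pJ : (2 ^ J).+1%:R <= 2 * 2 ^+ J :> R.
  by rewrite -natrX -natrM ler_nat mul2n -addnn -addn1 leq_add2l expn_gt0.
apply: le_trans (_ : (2 * 2 ^+ J) * (2 * (4 ^+ J)^-1 * N%:R) <= _).
  apply: ler_pM => //; apply: le_trans lnN2 _.
  by rewrite ler_wpM2r ?(ltW N0')// ler_wpM2l.
rewrite le_eqVlt; apply/orP; left; apply/eqP.
rewrite (_ : (4 : R) ^+ J = 2 ^+ J * 2 ^+ J); last first.
  by rewrite -exprMn -natrM.
by field; rewrite expf_neq0.
Qed.

(** The level of the types is the largest [J0] with [16 ^ J0 <= N], so that the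
entropy of the types is negligible and the estimate holds for all fixed levels
at once. *)
Lemma heavy_path : exists2 c : R, 0 <= c & forall n (E : set {ffun 'I_n.+1 -> A}) r,
  0 < r -> (r%:E <= mpm_prob M x y E)%E ->
  exists p : {ffun 'I_n.+1 -> A * B}, [/\ E (letters p),
    forall i, (i < n)%N -> 0 < W (step p i) &
    forall j J, (j <= J)%N -> (16 ^ J <= n.+1)%N ->
    \sum_k flux_cost W (fun e => n.+1%:R^-1 *
       block_count (block_of (2 ^ j).-1 n.+1) p k e) + ln lam <=
    - (ln r / n.+1%:R) + c / n.+1%:R + c / 2 ^+ J].
Proof.
have [c1 [c [c10 c0 cP]]] := path_weight_bounds A_gt0 B_gt0 M_ge0 M_aper x_gt0 y_gt0.
have lam0 : 0 < lam := lam_gt0 A_gt0 B_gt0 M_ge0 M_irr M_aper lamP.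
have [z [z1 [z0 _ zP]]] := partition_function_bounds A_gt0 B_gt0 M_ge0 M_irr x_gt0 y_gt0 lamP.
pose S2 : R := (#|{: A * B}| * #|{: A * B}|)%N%:R.
pose c2 := ln (c * #|{: A * B}|%:R / z).
exists (`|c2| + 4 * S2); first by rewrite addr_ge0// mulr_ge0.
move=> n E r r0 rE.
set N : R := n.+1%:R; have N0 : 0 < N by rewrite ltr0n.
have Z0 : 0 < partition_function M x y n.+1.
  exact: (partition_function_gt0 A_gt0 B_gt0 M_ge0 M_irr M_aper x_gt0 y_gt0 lamP).
have /andP[zZ _] := zP n.+1.
have rZ0 : 0 < r * (z * lam ^+ n.+1) by rewrite !mulr_gt0// exprn_gt0.
have rZ : r * (z * lam ^+ n.+1) <=
    \sum_(p : {ffun 'I_n.+1 -> A * B} | letters p \in E) path_weight M y x p.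
  move: rE; rewrite mpm_prob_paths lee_fin ler_pdivlMr//; apply: le_trans.
  by rewrite ler_wpM2l// ltW.
pose J0 := trunc_log 16 n.+1.
have wP (p : {ffun 'I_n.+1 -> A * B}) :
    0 <= path_weight M y x p <= c * path_prod (fun=> W) p.
  by rewrite path_weight_ge0//; have /andP[_ ->] := cP n p.
have E0 : 0 <= c by exact: ltW.
have [p [pE wp pJ]] := @heavy_type R _ W (edge_weight_ge0 M_ge0) n J0
   (fun p => letters p \in E) (path_weight M y x (n := n)) c _ wP E0 rZ0 rZ.
exists p; split; first by have /set_mem := pE.
  move=> i ltin; rewrite lt_neqAle eq_sym edge_weight_ge0// andbT.
  have := wp; rewrite /path_weight; apply: contraTneq => Wi.
  by rewrite /path_prod (bigD1 (Ordinal ltin))//= Wi mul0r mulr0 mul0r ltxx.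
move=> j J jJ JN.
have JJ0 : (J <= J0)%N by exact: trunc_log_max.
have := pJ j (leq_trans jJ JJ0).
set F := \sum_k flux_cost _ _; set K := (_ * (_ * _))%N => h.
have -> : \sum_k flux_cost W (fun e => N^-1 *
       block_count (block_of (2 ^ j).-1 n.+1) p k e) = F / N.
  rewrite /F mulr_suml; apply: eq_bigr => k _.
  by rewrite flux_costZ 1?mulrC// invr_ge0 ltW.
have S0 : 0 < #|{: A * B}|%:R :> R by rewrite ltr0n card_state_gt0.
have h2 : r * expR (N * ln lam) <= N ^+ K * (expR c2 * expR (- F)).
  rewrite /c2 lnK ?posrE ?divr_gt0 ?mulr_gt0// expRM_natl lnK ?posrE//.
  rewrite -(ler_pM2l z0); move: h; rewrite -/N.
  move=> h; apply: le_trans (le_trans h _); first by rewrite le_eqVlt; apply/orP; left; apply/eqP; ring.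
  by rewrite le_eqVlt; apply/orP; left; apply/eqP; field; rewrite gt_eqF.
have h3 : ln r + N * ln lam <= K%:R * ln N + c2 - F.
  have : ln (r * expR (N * ln lam)) <= ln (N ^+ K * (expR c2 * expR (- F))).
    by rewrite ler_ln// posrE !mulr_gt0 ?expR_gt0 ?exprn_gt0.
  rewrite !lnM ?posrE ?mulr_gt0 ?expR_gt0 ?exprn_gt0// !expRK lnXn// mulr_natl.
  by rewrite addrA.
have h4 : K%:R * ln N <= 4 * S2 / 2 ^+ J0 * N.
  rewrite /K natrM -/S2 mulrAC.
  have h4 := @type_entropy_le n.+1 J0 (ltn0Sn _) (@trunc_logP 16 n.+1 erefl erefl).
  rewrite (_ : 4 * S2 / 2 ^+ J0 * N = 4 / 2 ^+ J0 * N * S2); last by ring.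
  by rewrite ler_wpM2r// ler0n.
have h5 : 4 * S2 / 2 ^+ J0 <= (`|c2| + 4 * S2) / 2 ^+ J.
  apply: ler_pM; rewrite ?mulr_ge0 ?invr_ge0 ?exprn_ge0//.
    by rewrite lerDr.
  by rewrite lef_pV2 ?posrE ?exprn_gt0// ler_weXn2l// ler1n.
have h6 : c2 <= `|c2| + 4 * S2.
  by rewrite (le_trans (ler_norm _))// lerDl mulr_ge0.
move: h5 h6; move: (`|c2| + 4 * S2) => d h5 h6.
rewrite -(ler_pM2r N0) !mulrDl mulNr !divfK ?gt_eqF// [_ * N]mulrC.
have h7 := ler_wpM2r (ltW N0) h5; move: h3 h4 h7 h6.
move: (d / 2 ^+ J * N) (4 * S2 / 2 ^+ J0 * N) (K%:R * ln N) (N * ln lam) (ln r).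
by move=> a b c3 d3 e3; lra.
Qed.

End heavy_path.

(** * Cumulative fluxes and their limits *)

Section empirical_flux.
Context {R : realType} {S : finType}.

Definition flux_upto n (p : {ffun 'I_n.+1 -> S}) (t : R) (e : S * S) : R :=
  n.+1%:R^-1 * (steps_before p (Num.truncn (t * n.+1%:R)) e)%:R.

Lemma block_startE m n k :
  block_start m n.+1 k = Num.truncn (k%:R / m.+1%:R * n.+1%:R : R).
Proof.
apply/esym/truncn_def; have m0 : 0 < m.+1%:R :> R by rewrite ltr0n.
rewrite mulrAC ler_pdivlMr// ltr_pdivrMr// -!natrM ler_nat ltr_nat.
by rewrite leq_divM ltn_ceil.
Qed.

Lemma flux_upto_block m n (p : {ffun 'I_n.+1 -> S}) (k : 'I_m.+1) e :
  flux_upto p (k.+1%:R / m.+1%:R) e - flux_upto p (k%:R / m.+1%:R) e =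
  n.+1%:R^-1 * block_count (block_of m n.+1) p k e.
Proof. by rewrite block_count_before /flux_upto -!block_startE mulrBr. Qed.

Lemma flux_upto_mono n (p : {ffun 'I_n.+1 -> S}) t t' e : t <= t' ->
  flux_upto p t e <= flux_upto p t' e.
Proof.
move=> tt'; rewrite ler_wpM2l ?invr_ge0// ler_nat; apply: leq_sum => k _.
case: (step p k == e); rewrite ?andbF// !andbT.
case: (ltnP k) => // kt; suff -> : (k < Num.truncn (t' * n.+1%:R : R))%N by [].
by rewrite (leq_trans kt)// le_truncn// ler_wpM2r.
Qed.

Lemma flux_upto01 n (p : {ffun 'I_n.+1 -> S}) t e : 0 <= flux_upto p t e <= 1.
Proof.
rewrite mulr_ge0 ?invr_ge0//= ler_pdivrMl ?ltr0n// mulr1 ler_nat ltnW//.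
exact: steps_before_le.
Qed.

Lemma flux_upto_le0 n (p : {ffun 'I_n.+1 -> S}) t e : t <= 0 -> flux_upto p t e = 0.
Proof.
move=> t0; rewrite /flux_upto (_ : Num.truncn _ = 0%N).
  by rewrite /steps_before big1 ?mulr0.
apply/eqP; rewrite -leqn0 truncn_le_nat (le_lt_trans _ ltr01)//.
by rewrite mulr_le0_ge0.
Qed.

Lemma flux_upto_ge1 n (p : {ffun 'I_n.+1 -> S}) t e : 1 <= t ->
  flux_upto p t e = flux_upto p 1 e.
Proof.
move=> t1; congr (_ * _%:R); apply: eq_bigr => k _.
have h u : 1 <= u -> (k < Num.truncn (u * n.+1%:R : R))%N.
  move=> u1; rewrite truncn_gt_nat; apply: (@le_trans _ _ n.+1%:R).
    by rewrite ler_nat ltnW// ltnS.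
  by rewrite ler_peMl.
by rewrite !h.
Qed.

Lemma flux_upto_total n (p : {ffun 'I_n.+1 -> S}) t : 0 <= t <= 1 ->
  `|\sum_e flux_upto p t e - t| <= 2 * n.+1%:R^-1.
Proof.
move=> /andP[t0 t1]; set N : R := n.+1%:R.
have N0 : 0 < N by rewrite ltr0n.
set b := Num.truncn (t * N).
have bN : (b <= n.+1)%N.
  by rewrite -(ler_nat R) (le_trans (_ : b%:R <= t * N)) ?truncn_le ?mulr_ge0 ?ler_piMl// ltW.
have sumE : (\sum_e steps_before p b e = minn b n)%N.
  rewrite exchange_big/=.
  have -> : minn b n = (minn b n - 0)%N by rewrite subn0.
  rewrite -(@count_interval 0 (minn b n) n) ?geq_minr// big_mkord.
  apply: eq_bigr => k _; rewrite (bigD1 (step p k))//= eqxx andbT big1 ?addn0.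
    by rewrite leq_min ltn_ord andbT.
  by move=> e; rewrite eq_sym => /negPf ->; rewrite andbF.
rewrite /flux_upto -mulr_sumr -natr_sum sumE.
rewrite -{1}(mulfK (lt0r_neq0 N0) t) [_ / N]mulrC -mulrBr normrM gtr0_norm ?invr_gt0//.
rewrite mulrC ler_wpM2r ?invr_ge0 ?(ltW N0)//.
have /andP[b1 b2] : b%:R <= t * N < b.+1%:R by rewrite truncn_itv// mulr_ge0// ltW.
have bm : (b <= (minn b n).+1)%N by lia.
have mb : (minn b n <= b)%N by rewrite geq_minl.
move: bm mb; rewrite -!(ler_nat R) -[(minn b n).+1%:R]natr1 => bm mb.
rewrite -[b.+1%:R]natr1 in b2.
by rewrite ler_norml; apply/andP; split; lra.
Qed.

Lemma sum_pair_fst (b : bool) (e : S * S) s :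
  (\sum_s' (b && (e == (s, s'))) = b && (e.1 == s))%N.
Proof.
case: e => u v; rewrite (bigD1 v)//= xpair_eqE eqxx andbT big1 ?addn0// => s'.
by rewrite eq_sym xpair_eqE => /negPf ->; rewrite !andbF.
Qed.

Lemma sum_pair_snd (b : bool) (e : S * S) s :
  (\sum_s' (b && (e == (s', s))) = b && (e.2 == s))%N.
Proof.
case: e => u v; rewrite (bigD1 u)//= xpair_eqE eqxx big1 ?addn0// => s'.
by rewrite eq_sym xpair_eqE => /negPf ->; rewrite !andbF.
Qed.

(** Departures from and arrivals at [s] alternate along a path. *)
Lemma flux_upto_stationary n (p : {ffun 'I_n.+1 -> S}) t s :
  `|\sum_s' flux_upto p t (s, s') - \sum_s' flux_upto p t (s', s)| <= n.+1%:R^-1.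
Proof.
rewrite /flux_upto -!mulr_sumr -mulrBr normrM gtr0_norm ?invr_gt0 ?ltr0n//.
rewrite -[leRHS]mulr1 ler_wpM2l ?invr_ge0//.
set b := Num.truncn _.
have [i [j]] := @telescope_interval R (fun i => (site p i == s)%:R) 0 b n isT.
rewrite big_mkord => E.
rewrite (_ : _ - _ = - ((site p i == s)%:R - (site p j == s)%:R)); last first.
  have -> : \sum_s' (steps_before p b (s, s'))%:R =
      (\sum_(k < n) ((k < b) && (site p k == s)))%N%:R :> R.
    rewrite -natr_sum; congr _%:R; rewrite exchange_big/=.
    by apply: eq_bigr => k _; rewrite sum_pair_fst.
  have -> : \sum_s' (steps_before p b (s', s))%:R =
      (\sum_(k < n) ((k < b) && (site p k.+1 == s)))%N%:R :> R.
    rewrite -natr_sum; congr _%:R; rewrite exchange_big/=.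
    by apply: eq_bigr => k _; rewrite sum_pair_snd.
  rewrite -E -sumrN !natr_sum -sumrB; apply: eq_bigr => k _ /=.
  by case: (k < b)%N; rewrite ?mulr1n ?mulr0n /= ?opprB ?subrr ?oppr0.
rewrite normrN; do 2!case: (_ == _); rewrite ?subrr ?subr0 ?sub0r ?normrN ?normr0 ?normr1//.
Qed.

End empirical_flux.

Section letter_pairs.
Context {R : realType} {A B : finType}.

Definition pairs_before n (eta : {ffun 'I_n.+1 -> A}) (j : nat) (xi : A * A) : nat :=
  \sum_(i < n.+1) ((i < j) && ((eta i, eta (ordS i)) == xi)).

Definition pairs_upto n (eta : {ffun 'I_n.+1 -> A}) (t : R) (xi : A * A) : R :=
  n.+1%:R^-1 * (pairs_before eta (Num.truncn (t * n.+1%:R)) xi)%:R.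

Definition letter_pair (e : (A * B) * (A * B)) : A * A := (e.1.1, e.2.1).

Lemma letters_step n (p : {ffun 'I_n.+1 -> A * B}) (i : 'I_n) :
  (letters p (widen_ord (leqnSn n) i),
   letters p (ordS (widen_ord (leqnSn n) i))) = letter_pair (step p i).
Proof.
rewrite !ffunE /letter_pair /step /site/=; congr ((p _).1, (p _).1).
  by apply/val_inj; rewrite /= inordK// ltnS ltnW.
by apply/val_inj; rewrite /= modn_small ?inordK// ltnS.
Qed.

(** The only pair that the path does not see is the cyclic one. *)
Lemma pairs_before_letters n (p : {ffun 'I_n.+1 -> A * B}) j xi : exists b : bool,
  pairs_before (letters p) j xi =
  (\sum_(e | letter_pair e == xi) steps_before p j e + b)%N.
Proof.
rewrite /pairs_before big_ord_recr/=.
exists ((n < j)%N && ((letters p ord_max, letters p (ordS ord_max)) == xi)).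
congr (_ + _)%N; rewrite /steps_before exchange_big/=; apply: eq_bigr => i _.
rewrite letters_step.
have [e|ne] := boolP (letter_pair (step p i) == xi); last first.
  rewrite andbF big1// => e' /eqP e'xi; case: eqP => [se|]; rewrite ?andbF//.
  by move: ne; rewrite se e'xi eqxx.
rewrite (bigD1 (step p i))//= eqxx big1 ?addn0// => e' /andP[_].
by rewrite eq_sym => /negPf ->; rewrite andbF.
Qed.

Lemma pairs_upto_flux n (p : {ffun 'I_n.+1 -> A * B}) t xi :
  `|pairs_upto (letters p) t xi - \sum_(e | letter_pair e == xi) flux_upto p t e|
  <= n.+1%:R^-1.
Proof.
rewrite /pairs_upto /flux_upto -mulr_sumr -mulrBr normrM gtr0_norm ?invr_gt0 ?ltr0n//.
rewrite -[leRHS]mulr1 ler_wpM2l ?invr_ge0//.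
have [b ->] := pairs_before_letters p (Num.truncn (t * n.+1%:R)) xi.
by rewrite natrD natr_sum addrAC subrr add0r; case: b; rewrite ?normr1 ?normr0.
Qed.

End letter_pairs.

Section flux_path.
Context {R : realType} {S : finType} (W : S * S -> R) (lam : R).

(** Cumulative fluxes of a measurable family of stationary probability fluxes on
[0, 1], extended by constants. *)
Record flux_path (G : R -> S * S -> R) : Prop := FluxPath {
  flux_path_le0 : forall t e, t <= 0 -> G t e = 0;
  flux_path_ge1 : forall t e, 1 <= t -> G t e = G 1 e;
  flux_path_mono : forall t t' e, t <= t' -> G t e <= G t' e;
  flux_path_total : forall t, 0 <= t <= 1 -> \sum_e G t e = t;
  flux_path_st : forall t s, \sum_s' G t (s, s') = \sum_s' G t (s', s) }.

Definition increment (G : R -> S * S -> R) (m k : nat) (e : S * S) : R :=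
  G (k.+1%:R / m.+1%:R) e - G (k%:R / m.+1%:R) e.

(** By homogeneity the cost of an increment is the length of the interval times the
cost of the mean flux on it: these are Riemann sums of the rate. *)
Definition dyadic_cost_le (G : R -> S * S -> R) (l : R) := forall j,
  (forall k : 'I_(2 ^ j).-1.+1, carried W (increment G (2 ^ j).-1 k)) /\
  \sum_(k < (2 ^ j).-1.+1) flux_cost W (increment G (2 ^ j).-1 k) + ln lam <= l.

End flux_path.

Section cluster_paths.
Context {R : realType} {A B : finType}.
Variables (M : A -> 'M[R]_#|B|) (x y : B -> R) (lam : R).
Hypotheses (A_gt0 : (0 < #|A|)%N) (B_gt0 : (0 < #|B|)%N)
  (M_ge0 : forall a, nonneg_mx (M a)) (M_irr : forall a, irreducible_mx (M a))
  (M_aper : forall a, aperiodic_mx (M a)) (x_gt0 : forall b, 0 < x b)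
  (y_gt0 : forall b, 0 < y b) (lamP : perron_eigenvalue (\sum_a M a) lam).
Notation W := (edge_weight M).
Variables (I : Type) (U : set_system I) (UU : UltraFilter U) (nn : I -> nat).
Hypothesis nnoo : forall K, \forall i \near U, (K <= nn i)%N.

Let UP : ProperFilter U := @ultra_proper _ _ UU.

Lemma cvg_inv_size : (nn i).+1%:R^-1 @[i --> U] --> (0 : R).
Proof.
apply/cvgrPdist_le => e e0; near=> i.
rewrite sub0r normrN gtr0_norm ?invr_gt0// -[leRHS]invrK.
rewrite lef_pV2 ?posrE ?invr_gt0//.
have ge : e^-1 <= (Num.truncn e^-1).+1%:R by rewrite ltW// truncnS_gt.
apply: le_trans ge _; rewrite ler_nat ltnS.
by near: i; exact: nnoo.
Unshelve. all: by end_near. Qed.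

Lemma cvg_near_size (f : I -> R) (a c : R) :
  (\forall i \near U, `|f i - a| <= c * (nn i).+1%:R^-1) -> f i @[i --> U] --> a.
Proof.
move=> h; apply/cvgrPdist_le => e e0.
have cv : c * (nn i).+1%:R^-1 @[i --> U] --> c * 0.
  by apply: cvgM; [exact: cvg_cst|exact: cvg_inv_size].
rewrite mulr0 in cv.
near=> i; rewrite distrC; apply: (@le_trans _ _ (c * (nn i).+1%:R^-1)).
  by near: i.
apply: le_trans (ler_norm _) _.
by near: i; exact: cvgr0_norm_le cv _ e0.
Unshelve. all: by end_near. Qed.

(** Every bounded quantity converges along an ultrafilter, and the limits inherit
the relations that hold up to [O(1/N)]. *)
Lemma cluster_flux_path (p : forall i, {ffun 'I_(nn i).+1 -> A * B}) :
  exists G : R -> (A * B) * (A * B) -> R, [/\ flux_path G,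
    forall t e, flux_upto (p i) t e @[i --> U] --> G t e &
    forall t xi, pairs_upto (letters (p i)) t xi @[i --> U] -->
      \sum_(e | letter_pair e == xi) G t e].
Proof.
have /choice[G' GP] : forall te : R * ((A * B) * (A * B)), exists g : R,
    flux_upto (p i) te.1 te.2 @[i --> U] --> g.
  move=> te; apply: (@ultra_cvg_itv _ _ _ UU _ 0 1); near=> i.
  exact: flux_upto01.
pose G t e := G' (t, e).
have Gc t e : flux_upto (p i) t e @[i --> U] --> G t e := GP (t, e).
have lim_eq (f g : I -> R) (a b c : R) : f @ U --> a -> g @ U --> b ->
    (forall i, `|f i - g i| <= c * (nn i).+1%:R^-1) -> a = b.
  move=> fa gb h; have fg : f i - g i @[i --> U] --> (0 : R).
    by apply: (@cvg_near_size _ _ c); near=> i; rewrite subr0.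
  have : (0 : R) = a - b := cvg_unique (@norm_hausdorff _ R^o) fg (cvgB fa gb).
  by move=> h0; apply/eqP; rewrite -subr_eq0 -h0.
exists G; split => //.
- split.
  + move=> t e t0; apply: (lim_eq _ _ _ _ 0 (Gc t e) (cvg_cst 0)) => i.
    by rewrite flux_upto_le0// subrr normr0 mul0r.
  + move=> t e t1; apply: (lim_eq _ _ _ _ 0 (Gc t e) (Gc 1 e)) => i.
    by rewrite flux_upto_ge1// subrr normr0 mul0r.
  + move=> t t' e tt'; rewrite -subr_ge0.
    apply: (cvgr_to_ge (cvgB (Gc t' e) (Gc t e))); near=> i.
    by rewrite subr_ge0 flux_upto_mono.
  + move=> t t01.
    have h1 : \sum_e flux_upto (p i) t e @[i --> U] --> \sum_e G t e.
      by apply: cvg_sumr => e _; exact: Gc.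
    apply: (lim_eq _ _ _ _ 2 h1 (cvg_cst t)) => i.
    exact: flux_upto_total.
  + move=> t s.
    have h1 : \sum_s' flux_upto (p i) t (s, s') @[i --> U] --> \sum_s' G t (s, s').
      by apply: cvg_sumr => s' _; exact: Gc.
    have h2 : \sum_s' flux_upto (p i) t (s', s) @[i --> U] --> \sum_s' G t (s', s).
      by apply: cvg_sumr => s' _; exact: Gc.
    apply: (lim_eq _ _ _ _ 1 h1 h2) => i; rewrite mul1r.
    exact: flux_upto_stationary.
- move=> t xi.
  have h1 : \sum_(e | letter_pair e == xi) flux_upto (p i) t e @[i --> U] -->
      \sum_(e | letter_pair e == xi) G t e.
    by apply: cvg_sumr => e _; exact: Gc.
  have h2 : pairs_upto (letters (p i)) t xi -
      \sum_(e | letter_pair e == xi) flux_upto (p i) t e @[i --> U] --> (0 : R).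
    apply: (@cvg_near_size _ _ 1); near=> i; rewrite subr0 mul1r.
    exact: pairs_upto_flux.
  rewrite -[X in _ --> X]add0r.
  rewrite (_ : (fun i => pairs_upto (letters (p i)) t xi) =
    fun i => (pairs_upto (letters (p i)) t xi -
      \sum_(e | letter_pair e == xi) flux_upto (p i) t e) +
      \sum_(e | letter_pair e == xi) flux_upto (p i) t e); first exact: cvgD.
  by apply/funext => i; rewrite subrK.
Unshelve. all: by end_near. Qed.

Variables (E : forall i, set {ffun 'I_(nn i).+1 -> A}) (l : R).
Hypothesis E_mass : forall eps, 0 < eps -> \forall i \near U,
  ((expR (- ((nn i).+1%:R * (l + eps))))%:E <= mpm_prob M x y (@E i))%E.

(** Heavy paths, one from each set, have cumulative fluxes that converge along the
ultrafilter; the bounds of their costs at the dyadic levels pass to the limit,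
since the cost is continuous. *)
Lemma cluster_of_mass : exists (eta : forall i, {ffun 'I_(nn i).+1 -> A})
    (G : R -> (A * B) * (A * B) -> R),
  [/\ flux_path G, dyadic_cost_le W lam G l,
      \forall i \near U, @E i (eta i) &
      forall t xi, pairs_upto (eta i) t xi @[i --> U] -->
        \sum_(e | letter_pair e == xi) G t e].
Proof.
have [c c0 heavy] := heavy_path A_gt0 B_gt0 M_ge0 M_irr M_aper x_gt0 y_gt0 lamP.
pose r i : R := fine (mpm_prob M x y (@E i)).
have /card_gt0P[s0 _] := card_state_gt0 A_gt0 B_gt0.
have pS i : {p : {ffun 'I_(nn i).+1 -> A * B} |
    0 < r i -> [/\ @E i (letters p),
    forall k, (k < nn i)%N -> 0 < W (step p k) &
    forall j J, (j <= J)%N -> (16 ^ J <= (nn i).+1)%N ->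
    \sum_k flux_cost W (fun e => (nn i).+1%:R^-1 *
       block_count (block_of (2 ^ j).-1 (nn i).+1) p k e) + ln lam <=
    - (ln (r i) / (nn i).+1%:R) + c / (nn i).+1%:R + c / 2 ^+ J]}.
  apply: cid; have [ri|ri] := ltP 0 (r i); last by exists [ffun=> s0].
  have [|p pP] := heavy (nn i) (@E i) (r i) ri; first by rewrite /r.
  by exists p.
pose p i := sval (pS i); have pP i := svalP (pS i); rewrite -/(p _) in pP.
have [G [Gpath Gcvg pcvg]] := cluster_flux_path p.
have r_near eps : 0 < eps -> \forall i \near U, expR (- ((nn i).+1%:R * (l + eps))) <= r i.
  by move=> /E_mass; apply: filterS => i; rewrite /r /mpm_prob lee_fin.
have r_pos : \forall i \near U, 0 < r i.
  by apply: filterS (r_near 1 ltr01) => i; apply: lt_le_trans; rewrite expR_gt0.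
exists (fun i => letters (p i)), G; split => //; last first.
  by apply: filterS r_pos => i /pP[].
move=> j; pose m := (2 ^ j).-1.
have icvg (k : 'I_m.+1) e : (nn i).+1%:R^-1 *
    block_count (block_of m (nn i).+1) (p i) k e @[i --> U] --> increment G m k e.
  under eq_fun do rewrite -flux_upto_block.
  by apply: cvgB; exact: Gcvg.
have icar (k : 'I_m.+1) : \forall i \near U, carried W (fun e => (nn i).+1%:R^-1 *
    block_count (block_of m (nn i).+1) (p i) k e).
  apply: filterS r_pos => i /pP[_ Wp _]; apply: carriedZ; first by rewrite invr_ge0.
  move=> e; rewrite /block_count; split; first exact: sumr_ge0.
  apply: contraTT; rewrite -leNgt => We; rewrite big1 ?ltxx// => t _.
  case: (step (p i) t =P e) => [se|_]; last by rewrite andbF.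
  by have := Wp t (ltn_ord t); rewrite se ltNge We.
have ccvg (k : 'I_m.+1) := flux_cost_cvg (FF := UP) (icar k) (icvg k).
split; first by move=> k; have [] := ccvg k.
have cost : \sum_k flux_cost W (fun e => (nn i).+1%:R^-1 *
      block_count (block_of m (nn i).+1) (p i) k e) @[i --> U] -->
    \sum_(k < m.+1) flux_cost W (increment G m k).
  by apply: cvg_sumr => k _; have [] := ccvg k.
rewrite -lerBrDr; apply/ler_addgt0Pr => eps eps0.
have eps30 : 0 < eps / 3 by rewrite divr_gt0.
apply: (cvgr_to_le cost).
(* The type level is sent to infinity after the number of sites. *)
have [J [jJ cJ]] : exists J, (j <= J)%N /\ c / 2 ^+ J <= eps / 3.
  pose J := maxn j (Num.truncn (c / (eps / 3))).+1.
  exists J; split; first by rewrite leq_maxl.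
  rewrite ler_pdivrMr ?exprn_gt0// mulrC -ler_pdivrMr//.
  apply: le_trans (ltW (truncnS_gt _)) _; rewrite -natrX ler_nat.
  by apply: leq_trans (leq_maxr j _) _; rewrite ltnW// ltn_expl.
have cN : \forall i \near U, c / (nn i).+1%:R <= eps / 3.
  have cv : c * (nn i).+1%:R^-1 @[i --> U] --> c * 0.
    by apply: cvgM; [exact: cvg_cst|exact: cvg_inv_size].
  rewrite mulr0 in cv; near=> i; apply: le_trans (ler_norm _) _.
  by near: i; exact: cvgr0_norm_le cv _ eps30.
near=> i.
have ri : 0 < r i by near: i.
have [_ _ /(_ j J jJ) h] := pP i ri.
have N0 : 0 < (nn i).+1%:R :> R by rewrite ltr0n.
have NJ : (16 ^ J <= (nn i).+1)%N.
  by apply: leqW; near: i; exact: nnoo.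
have cNi : c / (nn i).+1%:R <= eps / 3.
  by near: i; exact: cN.
have rl : - (ln (r i) / (nn i).+1%:R) <= l + eps / 3.
  rewrite -mulNr ler_pdivrMr// lerNl mulrC -[leLHS]expRK ler_ln ?posrE ?expR_gt0//.
  by near: i; exact: r_near.
rewrite -(lerD2r (ln lam)); apply: le_trans (h NJ) _.
by apply: le_trans (lerD (lerD rl cNi) cJ) _; lra.
Unshelve. all: by end_near. Qed.

End cluster_paths.

(** * From mass estimates to large deviations *)

Lemma ereal_between (R : realType) (a b : \bar R) : (a < b)%E ->
  exists r : R, (a < r%:E)%E /\ (r%:E < b)%E.
Proof.
case: a b => [a| |] [b| |]//= ab.
- by exists ((a + b) / 2); rewrite !lte_fin in ab *; split; lra.
- by exists (a + 1); rewrite lte_fin ltry; split => //; lra.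
- by exists (b - 1); rewrite lte_fin ltNyr; split => //; lra.
- by exists 0; rewrite ltNyr ltry.
Qed.

Lemma ereal_leP (R : realType) (a b : \bar R) :
  (forall r : R, (b < r%:E)%E -> (a <= r%:E)%E) -> (a <= b)%E.
Proof.
move=> h; rewrite leNgt; apply/negP => /ereal_between[r [br ra]].
by have := h r br; rewrite leNgt ra.
Qed.

Lemma ler_lne_scaled (R : realType) (n : nat) (p l : R) :
  ((- l)%:E <= (n.+1%:R^-1)%:E * lne p%:E)%E <-> expR (- (n.+1%:R * l)) <= p.
Proof.
have N0 : 0 < n.+1%:R^-1 :> R by rewrite invr_gt0 ltr0n.
have [p0|p0] := leP p 0.
  split; last by rewrite leNgt (le_lt_trans p0) ?expR_gt0.
  by rewrite le0_lneNy ?lee_fin// mulrNy gtr0_sg// mul1e leeNy_eq.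
rewrite lne_EFin// -EFinM lee_fin mulrC ler_pdivlMr ?ltr0n//.
by rewrite -[in X in _ <-> X](lnK p0) ler_expR mulNr mulrC.
Qed.

Section ldp_criterion.
Context {R : realType} {A B : finType}.
Variables (M : A -> 'M[R]_#|B|) (x y : B -> R) (lam : R).
Hypotheses (A_gt0 : (0 < #|A|)%N) (B_gt0 : (0 < #|B|)%N)
  (M_ge0 : forall a, nonneg_mx (M a)) (M_irr : forall a, irreducible_mx (M a))
  (M_aper : forall a, aperiodic_mx (M a)) (x_gt0 : forall b, 0 < x b)
  (y_gt0 : forall b, 0 < y b) (lamP : perron_eigenvalue (\sum_a M a) lam).
Notation W := (edge_weight M).

Definition mass n (E : set {ffun 'I_n.+1 -> A}) : R :=
  \sum_(eta | eta \in E) mpm M x y eta.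

Lemma mass_le1 n (E : set {ffun 'I_n.+1 -> A}) : mass E <= 1.
Proof.
rewrite -lee_fin; apply: mpm_prob_le1 => //.
exact: (partition_function_gt0 A_gt0 B_gt0 M_ge0 M_irr M_aper x_gt0 y_gt0 lamP).
Qed.

Variables (T : topologicalType) (emp : forall n, {ffun 'I_n.+1 -> A} -> T)
  (rate : T -> \bar R).

Hypothesis lower : forall (G : set T) t (l : R), open G -> G t -> (rate t < l%:E)%E ->
  \forall n \near \oo, expR (- (n.+1%:R * l)) <= mass [set eta | G (@emp n eta)].

Hypothesis upper : forall (I : Type) (U : set_system I) (nn : I -> nat)
    (eta : forall i, {ffun 'I_(nn i).+1 -> A}) (G : R -> (A * B) * (A * B) -> R) (l : R),
  UltraFilter U -> (forall K, \forall i \near U, (K <= nn i)%N) ->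
  flux_path G -> dyadic_cost_le W lam G l ->
  (forall t xi, pairs_upto (eta i) t xi @[i --> U] -->
     \sum_(e | letter_pair e == xi) G t e) ->
  (exists t : T, emp (eta i) @[i --> U] --> t) /\
  (forall t : T, emp (eta i) @[i --> U] --> t -> (rate t <= l%:E)%E).

(** A negative rate would give sets of probability more than 1. *)
Lemma rate_ge0 t : (0 <= rate t)%E.
Proof.
rewrite leNgt; apply/negP => /ereal_between[l [tl]]; rewrite lte_fin => l0.
have h := lower openT I tl.
have [n0 _ hn0] := h.
have := le_trans (hn0 n0 (leqnn n0)) (mass_le1 _).
by rewrite leNgt -[ltLHS]expR0 ltr_expR oppr_gt0 pmulr_rlt0 ?ltr0n// l0.
Qed.

(** If nearby points had a smaller rate, ever smaller neighbourhoods of [t] would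
be charged at that rate, and the letter sequences found in them accumulate only
at [t]. *)
Lemma rate_lsc : lower_semicontinuous rate.
Proof.
move=> t a at_; apply: contrapT => h.
have {}h V : nbhs t V -> exists2 u, V u & (rate u <= a%:E)%E.
  move=> tV; apply: contrapT => h2; apply: h; exists V => // u Vu.
  by rewrite ltNge; apply/negP => ua; apply: h2; exists u.
have /choice[nn nnP] : forall Vk : set T * nat, exists n, nbhs t Vk.1 ->
    (Vk.2 <= n)%N /\ expR (- (n.+1%:R * (a + Vk.2.+1%:R^-1))) <=
      mass [set eta | Vk.1 (@emp n eta)].
  move=> [V k]/=; have [tV|] := pselect (nbhs t V); last by exists 0%N.
  have [u Vu ua] := h _ (nbhs_interior tV).
  have ul : (rate u < (a + k.+1%:R^-1)%:E)%E.
    by apply: le_lt_trans ua _; rewrite lte_fin ltrDl invr_gt0.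
  have [n0 _ hn0] := lower (open_interior V) Vu ul.
  exists (maxn k n0) => _; rewrite leq_maxl; split => //.
  apply: le_trans (hn0 _ (leq_maxr k n0)) _.
  rewrite /mass big_mkcond [leRHS]big_mkcond/=; apply: ler_sum => eta _.
  case: ifPn => [/set_mem etaV|_]; first by rewrite ifT//; apply/mem_set; exact: interior_subset etaV.
  case: ifP => // _; rewrite mpm_ge0// ltW//.
  exact: (partition_function_gt0 A_gt0 B_gt0 M_ge0 M_irr M_aper x_gt0 y_gt0 lamP).
(* Pairs of a neighbourhood and a precision, along shrinking neighbourhoods and
   growing precision. *)
pose F : set_system (set T * nat) := [set P | exists V0 k0, nbhs t V0 /\
  forall V k, nbhs t V -> V `<=` V0 -> (k0 <= k)%N -> P (V, k)].
have FF : ProperFilter F.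
  apply: Build_ProperFilter_ex.
    move=> P [V0 [k0 [tV0 h0]]]; exists (V0, k0); exact: h0.
  split.
  - by exists setT, 0%N; split => //; exact: filterT.
  - move=> P Q [V0 [k0 [tV0 h0]]] [V1 [k1 [tV1 h1]]].
    exists (V0 `&` V1), (maxn k0 k1); split; first exact: filterI.
    move=> V k tV VV; rewrite geq_max => /andP[k0k k1k]; split.
      by apply: h0 => // u /VV[].
    by apply: h1 => // u /VV[].
  - by move=> P Q PQ [V0 [k0 [tV0 h0]]]; exists V0, k0; split => // *; apply/PQ/h0.
have [U [UU FU]] := ultraFilterLemma FF.
have UP : ProperFilter U := @ultra_proper _ _ UU.
pose E Vk : set {ffun 'I_(nn Vk).+1 -> A} := [set eta | Vk.1 (emp eta)].
have [|eps eps0|eta [G [Gp Gc Eeta etaG]]] :=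
    @cluster_of_mass R A B M x y lam A_gt0 B_gt0 M_ge0 M_irr M_aper x_gt0 y_gt0 lamP
    _ U UU nn _ E a.
- move=> K; apply: FU; exists setT, K; split; first exact: filterT.
  by move=> V k tV _ Kk; have [h1 _] := nnP (V, k) tV; exact: leq_trans h1.
- apply: FU; exists setT, (Num.truncn eps^-1); split; first exact: filterT.
  move=> V k tV _ Kk; have [_ h1] := nnP (V, k) tV.
  rewrite lee_fin; apply: le_trans h1.
  rewrite ler_expR lerN2 ler_wpM2l// lerD2l -[leRHS]invrK lef_pV2 ?posrE ?invr_gt0//.
  by rewrite ltW// (lt_le_trans (truncnS_gt _))// ler_nat ltnS.
have nnoo K : \forall i \near U, (K <= nn i)%N.
  apply: FU; exists setT, K; split; first exact: filterT.
  by move=> V k tV _ Kk; have [h1 _] := nnP (V, k) tV; exact: leq_trans h1.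
have [_ /(_ t) h3] := upper UU nnoo Gp Gc etaG.
suff : emp (eta i) @[i --> U] --> t by move=> /h3; rewrite leNgt at_.
move=> V tV; have FV : U [set i | i.1 `<=` V].
  by apply: FU; exists V, 0%N; split.
by apply: filterS2 FV Eeta => i /= iV; rewrite /E/=; exact: iV.
Qed.

(** If the upper bound failed for a closed set, the set would be charged at a
smaller rate for infinitely many [n], and the empirical measures found in it would
accumulate at a point of the set that has such a rate. *)
Lemma ldp_criterion : LDP (T := T) (fun n => n.+1%:R)
  (fun n E => mpm_prob M x y [set eta : {ffun 'I_n.+1 -> A} | E (emp eta)]) rate.
Proof.
split; [exact: rate_ge0|exact: rate_lsc| |].
- move=> F clF; rewrite leNgt; apply/negP => /ereal_between[l' [infl lsup]].
  pose l := - l'; have l'E : l' = - l by rewrite /l opprK.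
  rewrite {}l'E in infl lsup.
  rewrite EFinN lteN2 in infl.
  set u := (u in limn_esup u) in lsup.
  have often n0 : exists2 n, (n0 <= n)%N & ((- l)%:E < u n)%E.
    apply: contrapT => h; move: lsup; apply/negP; rewrite -leNgt.
    apply: ge_ereal_inf; exists (ereal_sup (u @` [set n | (n0 <= n)%N])).
      by exists [set n | (n0 <= n)%N] => //; exists n0.
    apply: ge_ereal_sup => _ [n /= n0n <-]; rewrite leNgt; apply/negP => un.
    by apply: h; exists n.
  (* The filter of large integers at which the upper bound fails. *)
  pose Fil : set_system nat := [set P | exists n0, forall n, (n0 <= n)%N ->
    ((- l)%:E < u n)%E -> P n].
  have FF : ProperFilter Fil.
    apply: Build_ProperFilter_ex.
      by move=> P [n0 hP]; have [n n0n un] := often n0; exists n; exact: hP.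
    split.
    + by exists 0%N.
    + move=> P Q [n0 h0] [n1 h1]; exists (maxn n0 n1) => n.
      by rewrite geq_max => /andP[? ?] un; split; [exact: h0|exact: h1].
    + by move=> P Q PQ [n0 h0]; exists n0 => n ? ?; apply/PQ/h0.
  have [U [UU FU]] := ultraFilterLemma FF.
  have UP : ProperFilter U := @ultra_proper _ _ UU.
  have nnoo K : \forall i \near U, (K <= id i)%N by apply: FU; exists K.
  pose E n : set {ffun 'I_n.+1 -> A} := [set eta | F (emp eta)].
  have [eps eps0|eta [G [Gp Gc Eeta etaG]]] :=
    @cluster_of_mass R A B M x y lam A_gt0 B_gt0 M_ge0 M_irr M_aper x_gt0 y_gt0 lamP
    _ U UU id nnoo E l.
    apply: FU; exists 0%N => n _ un; rewrite lee_fin.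
    apply/ler_lne_scaled; apply: le_trans (ltW un).
    by rewrite lee_fin lerN2 lerDl ltW.
  have [[t etat] h3] := upper UU nnoo Gp Gc etaG.
  have Ft : F t by apply: (closed_cvg _ clF _ _ etat).
  have := h3 t etat; apply/negP; rewrite -ltNge; apply: lt_le_trans infl _.
  by apply: ereal_inf_lbound; exists t.
- move=> G oG; rewrite /limn_einf leeN2.
  apply: le_ereal_inf_tmp => _ [t Gt <-]; apply: ereal_leP => r rt.
  have [n0 _ hn0] := lower oG Gt rt.
  set u := (u in (\- u)%E).
  apply: ge_ereal_inf; exists (ereal_sup ((\- u)%E @` [set n | (n0 <= n)%N])).
    by exists [set n | (n0 <= n)%N] => //; exists n0.
  apply: ge_ereal_sup => _ [n /= n0n <-]; rewrite leeNl -EFinN.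
  by apply/ler_lne_scaled; exact: hn0.
Qed.

End ldp_criterion.

(** * Empirical measure of order two *)

Lemma cvg_initial (S : choiceType) (T : topologicalType) (f : S -> T)
    (I : Type) (F : set_system I) {FF : Filter F} (g : I -> S) (s : S) :
  (g i @[i --> F] --> (s : initial_topology f)) <-> f (g i) @[i --> F] --> f s.
Proof.
split=> [gs|fgs].
  apply: (cvg_comp (g : I -> initial_topology f) (f : initial_topology f -> T) gs).
  exact: initial_continuous.
move=> V; rewrite nbhsE => -[B [[C oC CB] Bs] BV].
have : nbhs (f s) C by apply: open_nbhs_nbhs; split => //; move: Bs; rewrite -CB.
move=> /fgs h; apply: (@filterS _ F _ ((fun i => f (g i)) @^-1` C)) => //.
by move=> i Ci; apply: BV; rewrite -CB.
Qed.

Lemma cvg_ptws (K : Type) (T : topologicalType) (I : Type) (F : set_system I)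
    {FF : Filter F} (g : I -> {ptws K -> T}) (f : {ptws K -> T}) :
  (g i @[i --> F] --> f) <-> forall k, g i k @[i --> F] --> f k.
Proof.
split=> [gf k|gf].
  have /cvg_sup/(_ k) := gf.
  exact: (@cvg_initial _ _ (fun h : {ptws K -> T} => h k) _ _ FF g f).1.
apply/cvg_sup => k.
exact: (@cvg_initial _ _ (fun h : {ptws K -> T} => h k) _ _ FF g f).2.
Qed.

Lemma nbhs_ptws (R : realType) (K : choiceType) (f : {ptws K -> R}) V :
  nbhs f V -> exists (s : seq K) (d : R), 0 < d /\
    forall g : {ptws K -> R}, (forall k, k \in s -> `|g k - f k| < d) -> V g.
Proof.
pose F : set_system {ptws K -> R} := [set V | exists (s : seq K) (d : R), 0 < d /\
    forall g : {ptws K -> R}, (forall k, k \in s -> `|g k - f k| < d) -> V g].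
have FF : Filter F.
  split.
  - by exists [::], 1.
  - move=> P Q [s [d [d0 hP]]] [s' [d' [d'0 hQ]]].
    exists (s ++ s'), (Num.min d d'); split; first by rewrite lt_min d0.
    move=> g hg; split; [apply: hP|apply: hQ] => k ks.
      by have := hg k; rewrite mem_cat ks lt_min => /(_ isT)/andP[].
    by have := hg k; rewrite mem_cat ks orbT lt_min => /(_ isT)/andP[].
  - by move=> P Q PQ [s [d [d0 hP]]]; exists s, d; split => // g /hP; exact: PQ.
suff h : F --> f by move=> /h.
apply: (@cvg_ptws K R _ F FF id f).2 => k.
apply/cvgrPdist_lt => e e0; exists [:: k], e; split => // g /(_ k).
by rewrite mem_head distrC; exact.
Qed.

Section pair_rate.
Context {R : realType} {A B : finType}.
Variables (M : A -> 'M[R]_#|B|) (lam : R).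
Hypothesis M_ge0 : forall a, nonneg_mx (M a).
Notation W := (edge_weight M).

Definition pair_marginal (C : (A * B) * (A * B) -> R) (xi : A * A) : R :=
  \sum_(e | letter_pair e == xi) C e.

Lemma pair_marginalE C a a' :
  \sum_b \sum_b' C ((a, b), (a', b')) = pair_marginal C (a, a').
Proof.
rewrite pair_bigA/= /pair_marginal.
rewrite (reindex (fun bb : B * B => ((a, bb.1), (a', bb.2))))/=.
  by apply: eq_bigl => bb; rewrite /letter_pair/= eqxx.
exists (fun e => (e.1.2, e.2.2)) => [[]//|[[u b] [u' b']]]/=.
by rewrite unfold_in/letter_pair/= xpair_eqE => /andP[/eqP -> /eqP ->].
Qed.

Lemma pair_cost_carried C : carried W C ->
  pair_cost M lam C = (flux_cost W C + ln lam)%:E.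
Proof.
move=> Ccar; rewrite /pair_cost EFinD; congr (_ + _)%E.
rewrite pair_bigA/= /flux_cost -sumEFin; apply: eq_bigr => -[p p'] _ /=.
rewrite /clog; case: eqP => [->|/eqP C0]; first by rewrite mul0r.
have [Cge CW] := Ccar (p, p').
have Cpos : 0 < C (p, p') by rewrite lt_neqAle eq_sym C0.
rewrite ifF//; apply/negbTE; rewrite mulf_neq0 ?gt_eqF//; last exact: CW.
exact: lt_le_trans Cpos (first_marginal_ge (p, p') Ccar).
Qed.

(** An edge without weight that is used makes the cost infinite. *)
Lemma pair_cost_lty C : (forall e, 0 <= C e) -> (pair_cost M lam C < +oo)%E ->
  carried W C.
Proof.
move=> C0 h e; split => // Ce; rewrite lt_neqAle edge_weight_ge0// andbT eq_sym.
apply: contraTneq h => We; rewrite -leNgt /pair_cost pair_bigA/=.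
rewrite (bigD1 e)//= {1}/clog gt_eqF; last by rewrite -surjective_pairing.
have -> : mxent (M e.1.1) e.1.2 e.2.2 = 0 := We.
rewrite mulr0 eqxx addye; first by rewrite addye.
elim/big_ind : _ => //[[a| |] [b| |]//|e' _].
by rewrite /clog; case: ifP => // _; case: ifP.
Qed.

Lemma I2_le (C : (A * B) * (A * B) -> R) (nu : A * A -> R) (l : R) :
  Mst R (A * B)%type C -> carried W C -> flux_cost W C + ln lam <= l ->
  (forall xi, pair_marginal C xi = nu xi) -> (I2 M lam nu <= l%:E)%E.
Proof.
move=> Cst Ccar Cl Cnu; apply: (@le_trans _ _ (pair_cost M lam C)); last first.
  by rewrite pair_cost_carried// lee_fin.
apply: ereal_inf_lbound; exists C => //; split => // a a'.
by rewrite pair_marginalE.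
Qed.

Lemma I2_lt (nu : A * A -> R) (l : R) : (I2 M lam nu < l%:E)%E ->
  exists C, [/\ Mst R (A * B)%type C, carried W C, flux_cost W C + ln lam < l &
    forall xi, pair_marginal C xi = nu xi].
Proof.
move=> /ereal_inf_lt[_ [C [Cst Cnu] <-] Cl]; exists C.
have Ccar : carried W C.
  by have [C0 _ _] := Cst; apply: pair_cost_lty => //; exact: lt_trans Cl (ltry _).
split => //; first by rewrite -lte_fin -pair_cost_carried.
by move=> [a a']; rewrite -Cnu pair_marginalE.
Qed.

End pair_rate.

Section tracking_letters.
Context {R : realType} {A B : finType}.

Lemma pairs_upto1 n (eta : {ffun 'I_n.+1 -> A}) xi :
  pairs_upto eta 1 xi = emp_pair R eta xi.
Proof.
rewrite /pairs_upto /emp_pair mul1r natrK /pairs_before natr_sum.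
by congr (_ * _); apply: eq_bigr => i _; rewrite ltn_ord.
Qed.

(** A letter pair collects finitely many edges, and the counts of letter pairs see
at most one pair more than the path, the cyclic one. *)
Lemma tracks_pairs m (C : 'I_m.+1 -> (A * B) * (A * B) -> R) (d : R) n
    (p : {ffun 'I_n.+1 -> A * B}) (k : 'I_m.+1) xi : tracks C d p ->
  `|pairs_upto (letters p) (k.+1%:R / m.+1%:R) xi -
    pairs_upto (letters p) (k%:R / m.+1%:R) xi - m.+1%:R^-1 * pair_marginal (C k) xi|
  <= 2 * n.+1%:R^-1 + d *+ #|{: (A * B) * (A * B)}|.
Proof.
move=> /forallP/(_ k)/forallP tr.
set t := k%:R / _; set t' := k.+1%:R / _.
pose F s : R := \sum_(e | letter_pair e == xi) flux_upto p s e.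
have b (e : (A * B) * (A * B)) : `|flux_upto p t' e - flux_upto p t e - m.+1%:R^-1 * C k e| <= d.
  have N0 : 0 < n.+1%:R :> R by rewrite ltr0n.
  rewrite flux_upto_block -(ler_pM2r N0) -[X in _ * X <= _](gtr0_norm N0) -normrM.
  have E (N u v q : R) : N != 0 -> q != 0 ->
      (N^-1 * u - q^-1 * v) * N = u - v * (N / q).
    by move=> Nn qn; field; rewrite Nn qn.
  by rewrite E ?pnatr_eq0//; exact: tr.
have h : `|F t' - F t - m.+1%:R^-1 * pair_marginal (C k) xi| <= d *+ #|{: (A * B) * (A * B)}|.
  rewrite /F /pair_marginal mulr_sumr -!sumrB; apply: le_trans (ler_norm_sum _ _ _) _.
  rewrite -sumr_const big_mkcond; apply: ler_sum => e _.
  by case: ifP => _; [exact: b|exact: le_trans (b e)].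
have h1 := pairs_upto_flux p t xi; have h2 := pairs_upto_flux p t' xi.
rewrite -/(F t) in h1; rewrite -/(F t') in h2.
set P := pairs_upto _ t xi in h1 *; set P' := pairs_upto _ t' xi in h2 *.
rewrite (_ : P' - P - _ = (P' - F t') - (P - F t) +
   (F t' - F t - m.+1%:R^-1 * pair_marginal (C k) xi)); last by ring.
apply: le_trans (ler_normD _ _) _; apply: lerD => //.
by apply: le_trans (ler_normB _ _) _; rewrite mulr_natl mulr2n lerD.
Qed.

Lemma pairs_upto0 n (eta : {ffun 'I_n.+1 -> A}) xi : pairs_upto eta (0 : R) xi = 0.
Proof.
by rewrite /pairs_upto mul0r truncn0 /pairs_before big1 ?mulr0.
Qed.

End tracking_letters.

Section ldp_pair_measure.
Context {R : realType} {A B : finType}.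
Variables (M : A -> 'M[R]_#|B|) (x y : B -> R) (lam : R).
Hypotheses (A_gt0 : (0 < #|A|)%N) (B_gt0 : (0 < #|B|)%N)
  (M_ge0 : forall a, nonneg_mx (M a)) (M_irr : forall a, irreducible_mx (M a))
  (M_aper : forall a, aperiodic_mx (M a)) (x_gt0 : forall b, 0 < x b)
  (y_gt0 : forall b, 0 < y b) (lamP : perron_eigenvalue (\sum_a M a) lam).
Notation W := (edge_weight M).

Lemma flux_path_Mst (S : finType) (G : R -> S * S -> R) : flux_path G -> Mst R S (G 1).
Proof.
move=> Gp; split; last exact: flux_path_st.
  by move=> e; rewrite -(flux_path_le0 Gp e (lexx 0)) (flux_path_mono Gp)// ler01.
by rewrite (flux_path_total Gp)// ler01 lexx.
Qed.

Lemma pair_marginal_Mst (C : (A * B) * (A * B) -> R) :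
  Mst R (A * B)%type C -> Mst R A (pair_marginal C).
Proof.
move=> [C0 C1 Cst]; split.
- by move=> xi; apply: sumr_ge0.
- by rewrite -C1 [RHS](partition_big (@letter_pair A B) xpredT).
- move=> a; under eq_bigr do rewrite -pair_marginalE.
  under [RHS]eq_bigr do rewrite -pair_marginalE.
  transitivity (\sum_b \sum_s C ((a, b), s)).
    rewrite exchange_big/=; apply: eq_bigr => b _.
    by rewrite [RHS](eq_bigr (fun s => C ((a, b), (s.1, s.2)))) ?pair_bigA//; case.
  rewrite (eq_bigr (fun b => \sum_s C (s, (a, b)))); last by move=> b _; exact: Cst.
  rewrite exchange_big/= (eq_bigr (fun s => \sum_b C ((s.1, s.2), (a, b)))); last by case.
  by rewrite -(pair_bigA _ (fun a' b' => \sum_b C ((a', b'), (a, b)))).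
Qed.

(** One block is enough: the measure of order two does not see positions. *)
Lemma pair_lower (G : set (Mst R A)) (t : Mst R A) (l : R) : open G -> G t ->
  (I2 M lam (set_val t) < l%:E)%E ->
  \forall n \near \oo, expR (- (n.+1%:R * l)) <=
    mass M x y [set eta : {ffun 'I_n.+1 -> A} | G (nu2_hat R eta)].
Proof.
move=> [D oD DG] Gt /(I2_lt M_ge0)[C [Cst Ccar Cl Ct]].
have : nbhs (set_val t : {ptws (A * A)%type -> R}) D.
  by apply: open_nbhs_nbhs; split => //; rewrite -DG in Gt.
move=> /nbhs_ptws[s [d [d0 sD]]].
pose K := #|{: (A * B) * (A * B)}|.
pose d' := d / 3 / K.+1%:R.
have d'0 : 0 < d' by rewrite !divr_gt0.
have e0 : 0 < l - (flux_cost W C + ln lam) by rewrite subr_gt0.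
have LB := @mpm_lower_bound R A B M x y lam A_gt0 B_gt0 M_ge0 M_irr M_aper x_gt0
  y_gt0 lamP 0 (fun=> C) d' _ (fun=> Cst) (fun=> Ccar) d'0 e0.
rewrite big_ord1 invr1 mul1r subrKC in LB.
near=> n; rewrite -lee_fin; apply: (near LB n _) => //.
move=> p /tracks_pairs tr; rewrite /= -DG; apply: sD => xi _.
have := tr ord0 xi; rewrite mul0r pairs_upto0 invr1 !mul1r subr0.
rewrite pairs_upto1 Ct => h; apply: le_lt_trans h _.
have h1 : d' *+ K <= d / 3.
  rewrite /d' -mulr_natr -mulrA ler_piMr ?divr_ge0 ?(ltW d0)// mulrC ler_pdivrMr//.
  by rewrite mul1r ler_nat.
have h2 : n.+1%:R^-1 <= d / 6.
  rewrite -[leRHS]invrK lef_pV2 ?posrE ?invr_gt0 ?divr_gt0//.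
  by near: n; exact: near_natr_ge.
have h3 : 2 * n.+1%:R^-1 <= d / 3.
  by move: h2; move: (n.+1%:R^-1 : R) => u; lra.
by apply: le_lt_trans (lerD h3 h1) _; lra.
Unshelve. all: by end_near. Qed.

(** The level 0 of the dyadic bound is the bound of the cost of [G 1]. *)
Lemma ldp_pair_measure : LDP (T := Mst R A) (fun n => n.+1%:R)
  (fun n E => mpm_prob M x y [set eta : {ffun 'I_n.+1 -> A} | E (nu2_hat R eta)])
  (fun nu => I2 M lam (set_val nu)).
Proof.
apply: (ldp_criterion A_gt0 B_gt0 M_ge0 M_irr M_aper x_gt0 y_gt0 lamP
  (emp := @nu2_hat R A)); first exact: pair_lower.
move=> I U nn eta G l UU nnoo Gp Gc etaG.
have UP : ProperFilter U := @ultra_proper _ _ UU.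
have ecvg xi : emp_pair R (eta i) xi @[i --> U] --> pair_marginal (G 1) xi.
  by under eq_fun do rewrite -pairs_upto1; exact: etaG.
split.
  exists (exist _ (pair_marginal (G 1)) (mem_set (pair_marginal_Mst (flux_path_Mst Gp)))).
  apply/cvg_initial; apply/cvg_ptws => xi; exact: ecvg.
move=> t /cvg_initial/cvg_ptws tcvg.
have [+ +] := Gc 0%N; rewrite expn0/= => /(_ ord0) Gcar; rewrite big_ord1 => Gl.
have iE : increment G 0 0 = G 1.
  by apply/funext => e; rewrite /increment mul0r divr1 (flux_path_le0 Gp e (lexx 0)) subr0.
rewrite /= iE in Gcar Gl.
apply: (I2_le (flux_path_Mst Gp) Gcar Gl) => xi.
exact: (cvg_unique (@norm_hausdorff _ R^o) (ecvg xi) (tcvg xi)).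
Qed.

End ldp_pair_measure.

(** * Measures on the unit interval and their distribution functions *)

Section riemann_sums.
Context {R : realType}.

Lemma unif_continuous_itv (f : test_function R) (e : R) : 0 < e ->
  exists2 d : R, 0 < d & forall x y, 0 <= x <= 1 -> 0 <= y <= 1 -> `|x - y| <= d ->
    `|sval f x - sval f y| <= e.
Proof.
move=> e0; apply: contrapT => h.
have /choice[g gP] : forall n : nat, exists xy : R * R,
    [/\ 0 <= xy.1 <= 1, 0 <= xy.2 <= 1, `|xy.1 - xy.2| <= n.+1%:R^-1 &
        e < `|sval f xy.1 - sval f xy.2|].
  move=> n; apply: contrapT => h2; apply: h; exists n.+1%:R^-1; first by rewrite invr_gt0.
  move=> x y x01 y01 xy; rewrite leNgt; apply/negP => exy.
  by apply: h2; exists (x, y).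
have [U [UU Uoo]] := ultraFilterLemma (@eventually_filter).
have UP := @ultra_proper _ _ UU.
have [l l1] : exists l : R, (g n).1 @[n --> U] --> l.
  by apply: (@ultra_cvg_itv _ _ _ UU _ 0 1); near=> n; have [] := gP n.
have inv0 : n.+1%:R^-1 @[n --> U] --> (0 : R).
  by apply: cvg_trans (@cvg_harmonic R); exact: cvg_app.
have l2 : (g n).2 @[n --> U] --> l.
  have d0 : (g n).1 - (g n).2 @[n --> U] --> (0 : R).
    apply/cvgrPdist_le => d d0; near=> n.
    rewrite sub0r normrN; have [_ _ h1 _] := gP n; apply: le_trans h1 _.
    apply: le_trans (ler_norm _) _.
    by near: n; exact: cvgr0_norm_le inv0 _ d0.
  rewrite (_ : (fun n => (g n).2) = fun n => (g n).1 - ((g n).1 - (g n).2)).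
    by rewrite -[X in _ --> X]subr0; exact: cvgB.
  by apply/funext => n; rewrite opprB addrC subrK.
have l01 : `[0, 1]%classic l.
  rewrite /= in_itv/=; apply/andP; split.
    by apply: (cvgr_to_ge l1); near=> n; have [/andP[]] := gP n.
  by apply: (cvgr_to_le l1); near=> n; have [/andP[]] := gP n.
have /subspace_continuousP/(_ l l01) cf := svalP f.
have f1 : sval f (g n).1 @[n --> U] --> sval f l.
  apply: cvg_trans cf; move=> V VW.
  have h1 : \forall n \near U, (`[0, 1]%classic (g n).1 -> V (sval f (g n).1)) by exact: l1 VW.
  apply: (@filterS _ U _ _ _ _ h1) => n h2; apply: h2.
  by rewrite /= in_itv/=; have [] := gP n.
have f2 : sval f (g n).2 @[n --> U] --> sval f l.
  apply: cvg_trans cf; move=> V VW.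
  have h1 : \forall n \near U, (`[0, 1]%classic (g n).2 -> V (sval f (g n).2)) by exact: l2 VW.
  apply: (@filterS _ U _ _ _ _ h1) => n h2; apply: h2.
  by rewrite /= in_itv/=; have [] := gP n.
have f12 : sval f (g n).1 - sval f (g n).2 @[n --> U] --> (0 : R).
  by rewrite -[X in _ --> X](subrr (sval f l)); exact: cvgB.
have : e < e.
  have [n hn] : exists n, `|sval f (g n).1 - sval f (g n).2| <= e.
    by apply: (@filter_ex _ U); near=> n; near: n; exact: cvgr0_norm_le f12 _ e0.
  by have [_ _ _] := gP n; rewrite ltNge hn.
by rewrite ltxx.
Unshelve. all: by end_near. Qed.

Variable mu : {finite_measure set (measurableTypeR R) -> \bar R}.
Hypothesis mu01 : mu (~` `[0, 1]%classic) = 0%E.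

Definition cdf (x : R) : R := fine (mu `]-oo, x]%classic).

Lemma mu_fin (A : set (measurableTypeR R)) : measurable A -> mu A \is a fin_num.
Proof. exact: fin_num_measure. Qed.

Lemma mu_itv (x y : R) : x <= y -> mu `]x, y]%classic = (cdf y - cdf x)%:E.
Proof.
move=> xy; rewrite /cdf EFinB !fineK ?mu_fin//.
rewrite (_ : `]x, y]%classic = `]-oo, y] `\` `]-oo, x]%classic); last first.
  by apply/seteqP; split => t /=; rewrite !in_itv/=;
    [move=> /andP[xt ->]; split => //; apply/negP; rewrite -ltNge|
     move=> [-> /negP]; rewrite -ltNge => ->].
rewrite measureD//=; last by rewrite -ge0_fin_numE// mu_fin.
congr (_ - mu _)%E; apply/seteqP; split => t /=; rewrite !in_itv/=; first by case.
by move=> tx; split => //; exact: le_trans tx xy.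
Qed.

Lemma cdf_mono x y : x <= y -> cdf x <= cdf y.
Proof. by move=> xy; rewrite -subr_ge0 -lee_fin -mu_itv. Qed.

Lemma cdf_ge0 x : 0 <= cdf x. Proof. exact: fine_ge0. Qed.

Lemma mu_null (A : set (measurableTypeR R)) : measurable A -> A `<=` ~` `[0, 1]%classic ->
  mu A = 0%E.
Proof.
move=> mA A01; apply/eqP; rewrite eq_le measure_ge0 andbT -mu01.
by apply: le_measure; rewrite ?inE//; exact: measurableC.
Qed.

Lemma cdf0E : cdf 0 = fine (mu [set 0]).
Proof.
rewrite /cdf; congr fine.
have -> : `]-oo, 0]%classic = `]-oo, 0[%classic `|` [set (0 : R)].
  apply/seteqP; split => s /=; rewrite !in_itv/=.
    by rewrite le_eqVlt => /predU1P[s0|s0]; [right|left].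
  by move=> [s0|s0]; [exact: ltW|rewrite s0].
rewrite measureU//=; last first.
  by apply/seteqP; split => s //= [+ s1]; rewrite s1 in_itv/= ltxx.
rewrite (_ : mu `]-oo, 0[%classic = 0%E) ?add0e//; apply: mu_null => // s /=.
by rewrite !in_itv/= => s0 /andP[]; rewrite leNgt s0.
Qed.

Lemma test_integrable (f : test_function R) : mu.-integrable `[0, 1]%classic (EFin \o sval f).
Proof.
apply: measurable_bounded_integrable => //.
- by rewrite -ge0_fin_numE// mu_fin.
- apply: subspace_continuous_measurable_fun => //; exact: (svalP f).
- have /compact_bounded : compact (sval f @` `[0, 1]%classic : set R^o).
    by apply: continuous_compact; [exact: (svalP f)|exact: segment_compact].
  by move=> [L [Lr hL]]; exists L; split => // z Lz x x01; apply: hL => //; exists x.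
Qed.

(** Riemann-Stieltjes sums. The precision depends on the measure through its total
mass only, so that limits of measures can be taken in the sums. *)
Lemma riemann_sum (f : test_function R) (e d : R) m :
  (forall x y, 0 <= x <= 1 -> 0 <= y <= 1 -> `|x - y| <= d ->
    `|sval f x - sval f y| <= e) -> 0 <= e -> m.+1%:R^-1 <= d ->
  `|\int[mu]_(t in `[0, 1]%classic) sval f t - (sval f 0 * cdf 0 +
     \sum_(k < m.+1) sval f (k.+1%:R / m.+1%:R) *
        (cdf (k.+1%:R / m.+1%:R) - cdf (k%:R / m.+1%:R)))| <= e * cdf 1.
Proof.
move=> fe e0 md.
pose t k : R := k%:R / m.+1%:R.
have m0 : 0 < m.+1%:R :> R by rewrite ltr0n.
have t_mono k : t k <= t k.+1 by rewrite ler_pM2r ?invr_gt0// ler_nat.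
have t_ge0 k : 0 <= t k by rewrite divr_ge0.
have t_le1 k : (k <= m.+1)%N -> t k <= 1 by move=> km; rewrite ler_pdivrMr// mul1r ler_nat.
have fint := test_integrable f.
have sub k : (k <= m.+1)%N -> `[0, t k]%classic `<=` `[0, 1]%classic.
  by move=> km s /=; rewrite !in_itv/= => /andP[-> st]/=; exact: le_trans st (t_le1 k km).
have sub2 k : (k <= m)%N -> `]t k, t k.+1]%classic `<=` `[0, 1]%classic.
  move=> km s /=; rewrite !in_itv/= => /andP[ks sk]; apply/andP; split.
    by apply: le_trans (t_ge0 k) (ltW ks).
  exact: le_trans sk (t_le1 _ _).
suff h k : (k <= m.+1)%N -> `|\int[mu]_(s in `[0, t k]%classic) sval f s - (sval f 0 * cdf 0 +
     \sum_(i < k) sval f (t i.+1) * (cdf (t i.+1) - cdf (t i)))| <= e * (cdf (t k) - cdf 0).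
  have := h m.+1 (leqnn _); rewrite /t divff ?gt_eqF// => /le_trans; apply.
  by rewrite ler_wpM2l// gerBl cdf_ge0.
elim: k => [|k IH] km.
  rewrite big_ord0 addr0 /t mul0r set_itv1 subrr mulr0.
  have -> : \int[mu]_(s in [set 0]) sval f s = \int[mu]_(s in [set 0]) (sval f 0).
    by apply: eq_Rintegral => s; rewrite inE/= => ->.
  rewrite Rintegral_cst//; set c := fine _.
  by rewrite -[c]cdf0E subrr normr0.
have split_itv : `[0, t k.+1]%classic = `[0, t k]%classic `|` `]t k, t k.+1]%classic.
  apply/seteqP; split => s /=; rewrite !in_itv/=.
    move=> /andP[-> sk]; have [sk'|sk'] := leP s (t k); [by left|by right].
  move=> [/andP[-> sk]|/andP[ks ->]]; first by rewrite (le_trans sk).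
  by rewrite (le_trans (t_ge0 k) (ltW ks)).
rewrite split_itv Rintegral_setU//; last 2 first.
- by rewrite -split_itv; apply: integrableS fint => //; exact: sub.
- rewrite disj_set2E; apply/eqP/seteqP; split => s //= [] /=.
  by rewrite !in_itv/= => /andP[_ sk] /andP[ks _]; have := le_lt_trans sk ks; rewrite ltxx.
rewrite big_ord_recr/=.
set I1 := \int[mu]_(s in `[0, t k]%classic) _; set I2 := Rintegral _ _ _.
set S := \sum_(i < k) _; set T := _ * (_ - _).
rewrite (_ : I1 + I2 - _ = (I1 - (sval f 0 * cdf 0 + S)) + (I2 - T)); last by ring.
rewrite (_ : cdf (t k.+1) - cdf 0 = (cdf (t k) - cdf 0) + (cdf (t k.+1) - cdf (t k))); last by ring.
rewrite mulrDr; apply: le_trans (ler_normD _ _) _; apply: lerD.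
  by apply: IH; exact: ltnW.
have E (c : R) : \int[mu]_(s in `]t k, t k.+1]%classic) c = c * (cdf (t k.+1) - cdf (t k)).
  by rewrite Rintegral_cst//; congr (_ * _); exact: (congr1 fine (mu_itv (t_mono k))).
have cint (c : R) : mu.-integrable `]t k, t k.+1]%classic (EFin \o cst c).
  by apply: finite_measure_integrable_cst.
have mI : measurable (`]t k, t k.+1]%classic : set (measurableTypeR R)) by [].
have fint2 : mu.-integrable `]t k, t k.+1]%classic (EFin \o sval f).
  by apply: integrableS fint => //; exact: sub2.
rewrite /I2 /T -(E (sval f (t k.+1))) -RintegralB//; last exact: cint.
apply: le_trans (le_normr_Rintegral _ _) _ => //.
  exact: (integrableB mI fint2 (cint _)).
rewrite -E; apply: le_Rintegral => //.
- exact: (integrable_norm (integrableB mI fint2 (cint (sval f (t k.+1))))).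
- exact: cint.
move=> s ks; have s01 := sub2 k km s ks; move: ks s01; rewrite /= !in_itv/= => /andP[ks sk] s01.
apply: fe => //; first by rewrite t_ge0 t_le1.
rewrite ler0_norm ?subr_le0// opprB; apply: le_trans md.
have -> : m.+1%:R^-1 = t k.+1 - t k.
  by rewrite /t -mulrBl -[k.+1%:R]natr1 [k%:R + 1]addrC addrK mul1r.
by rewrite lerD2l lerN2 ltW.
Qed.

End riemann_sums.

Section ramp.
Context {R : realType}.

(** Continuous approximations of the indicators of half-lines. *)
Definition ramp (a b t : R) : R := Num.max 0 (Num.min 1 ((b - t) / (b - a))).

Lemma ramp01 a b t : 0 <= ramp a b t <= 1.
Proof. by rewrite /ramp le_max lexx/= ge_max ler01/= ge_min lexx. Qed.

Lemma ramp_le a b t : a < b -> t <= a -> ramp a b t = 1.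
Proof.
move=> ab ta; rewrite /ramp min_l; first by rewrite max_r.
by rewrite ler_pdivlMr ?subr_gt0// mul1r lerD2l lerN2.
Qed.

Lemma ramp_gt a b t : a < b -> b < t -> ramp a b t = 0.
Proof.
move=> ab bt; rewrite /ramp max_l// ge_min; apply/orP; right.
by rewrite pmulr_lle0 ?invr_gt0 ?subr_gt0// subr_le0 ltW.
Qed.

Lemma ramp_continuous a b : continuous (ramp a b).
Proof.
move=> t; rewrite /ramp.
apply: (@continuous_max _ _ (fun=> 0) (fun t => Num.min 1 ((b - t) / (b - a)))).
  exact: cst_continuous.
apply: (@continuous_min _ _ (fun=> 1) (fun t => (b - t) / (b - a))).
  exact: cst_continuous.
apply: cvgM; last exact: cvg_cst.
by apply: cvgB; [exact: cvg_cst|exact: cvg_id].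
Qed.

Definition ramp_test a b : test_function R :=
  exist _ (ramp a b) (continuous_subspaceT (@ramp_continuous a b)).

Variable mu : {finite_measure set (measurableTypeR R) -> \bar R}.
Hypothesis mu01 : mu (~` `[0, 1]%classic) = 0%E.

Lemma cdf_indic x : cdf mu x = \int[mu]_(t in `[0, 1]%classic) \1_(`]-oo, x]%classic) t.
Proof.
rewrite /Rintegral integral_indic//; congr fine.
rewrite (measureDI mu (B := `[0, 1]%classic))//.
rewrite [X in (X + _)%E](_ : _ = 0%E) ?add0e//; apply: mu_null => //.
exact: measurableD.
Qed.

Lemma indic_integrable (E : set R) : measurable (E : set (measurableTypeR R)) ->
  mu.-integrable `[0, 1]%classic (EFin \o \1_E).
Proof.
move=> mE; apply: measurable_bounded_integrable => //.
- by rewrite -ge0_fin_numE// mu_fin.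
- exists 1; split => // z z1 t _; rewrite /= ger0_norm// (le_trans _ (ltW z1))//.
Qed.

Lemma ramp_integral a b : a < b ->
  cdf mu a <= \int[mu]_(t in `[0, 1]%classic) ramp a b t <= cdf mu b.
Proof.
move=> ab; rewrite !cdf_indic; apply/andP; split; apply: le_Rintegral => //.
- exact: indic_integrable.
- exact: (test_integrable mu (ramp_test a b)).
- move=> t _; rewrite indicE; case: (boolP (t \in _)) => [|_]; last by have /andP[] := ramp01 a b t.
  by rewrite inE/= in_itv/= => ta; rewrite ramp_le.
- exact: (test_integrable mu (ramp_test a b)).
- exact: indic_integrable.
- move=> t _; rewrite indicE; case: (boolP (t \in _)) => [_|]; first by have /andP[] := ramp01 a b t.
  by rewrite notin_setE/= in_itv/= => /negP; rewrite -ltNge => bt; rewrite ramp_gt.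
Qed.

End ramp.

Section path_measure_convergence.
Context {R : realType} {K : finType} (I : Type) (U : set_system I).
Context {UP : ProperFilter U}.
Variables (Pis : I -> path_measure R K).

Lemma cvg_path_measureP (Pi : path_measure R K) :
  (Pis i @[i --> U] --> Pi) <-> forall xi (f : test_function R),
    \int[Pis i xi]_(t in `[0, 1]%classic) sval f t @[i --> U] -->
    \int[Pi xi]_(t in `[0, 1]%classic) sval f t.
Proof.
have FU : Filter U by typeclasses eauto.
split=> [h xi f|h].
  have h1 := (@cvg_initial _ _ (@path_eval R K) I U FU Pis Pi).1 h.
  have h2 := (@cvg_ptws _ _ I U FU _ _).1 h1.
  exact: (h2 (xi, f)).
apply: (@cvg_initial _ _ (@path_eval R K) I U FU Pis Pi).2.
apply: (@cvg_ptws _ _ I U FU _ _).2 => -[xi f]; exact: h.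
Qed.

Lemma cvg_path_measure_cdf (Pi : path_measure R K) :
  (forall xi x, cdf (Pis i xi) x @[i --> U] --> cdf (Pi xi) x) ->
  Pis i @[i --> U] --> Pi.
Proof.
move=> h; apply/cvg_path_measureP => xi f; apply/cvgrPdist_le => e e0.
pose c := cdf (Pi xi) 1.
have c0 : 0 <= c by exact: cdf_ge0.
pose e' := e / 4 / (c + 1).
have e'0 : 0 < e' by rewrite !divr_gt0//; lra.
have e'c : e' * (c + 1) = e / 4 by rewrite /e' divfK// gt_eqF//; lra.
have [d d0 fd] := unif_continuous_itv f e'0.
pose m := Num.truncn d^-1.
have md : m.+1%:R^-1 <= d.
  rewrite -[leRHS]invrK lef_pV2 ?posrE ?invr_gt0//.
  by rewrite ltW// truncnS_gt.
pose riem (mu : {finite_measure set (measurableTypeR R) -> \bar R}) :=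
  sval f 0 * cdf mu 0 + \sum_(k < m.+1) sval f (k.+1%:R / m.+1%:R) *
        (cdf mu (k.+1%:R / m.+1%:R) - cdf mu (k%:R / m.+1%:R)).
have riem_cvg : riem (Pis i xi) @[i --> U] --> riem (Pi xi).
  apply: cvgD; first by apply: cvgM; [exact: cvg_cst|exact: h].
  apply: cvg_sumr => k _; apply: cvgM; first exact: cvg_cst.
  by apply: cvgB; exact: h.
have e40 : 0 < e / 4 by rewrite divr_gt0.
near=> i.
have r1 := riemann_sum (path_carried (Pis i) xi) fd (ltW e'0) md.
have r2 := riemann_sum (path_carried Pi xi) fd (ltW e'0) md.
rewrite -/(riem (Pis i xi)) in r1; rewrite -/(riem (Pi xi)) in r2.
have r3 : `|riem (Pi xi) - riem (Pis i xi)| <= e / 4.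
  by near: i; move/cvgrPdist_le : riem_cvg; exact.
have r4 : cdf (Pis i xi) 1 <= c + 1.
  have : `|cdf (Pi xi) 1 - cdf (Pis i xi) 1| <= 1.
    by near: i; move/cvgrPdist_le : (h xi 1); exact.
  by rewrite ler_distlC => /andP[].
have r5 : e' * cdf (Pis i xi) 1 <= e / 4 by rewrite -e'c ler_wpM2l// ltW.
have r6 : e' * c <= e / 4 by rewrite -e'c ler_wpM2l ?(ltW e'0)// lerDl.
set A := \int[_]_(_ in _) _; set B := \int[_]_(_ in _) _.
rewrite (_ : A - B = (A - riem (Pi xi)) + (riem (Pi xi) - riem (Pis i xi)) -
  (B - riem (Pis i xi))); last by ring.
apply: le_trans (ler_normB _ _) _.
have := ler_normD (A - riem (Pi xi)) (riem (Pi xi) - riem (Pis i xi)).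
move: r1 r2; rewrite -/A -/B -/c => r1 r2.
have := le_trans r1 r5; have := le_trans r2 r6; lra.
Unshelve. all: by end_near. Qed.

(** Ramps squeeze the distribution function of the limit between values of [F] at
nearby points; as [F] is continuous, the limit has no atoms. *)
Lemma path_measure_cdf_lim (Pi : path_measure R K) (F : R -> K -> R) :
  (forall xi x, cdf (Pis i xi) x @[i --> U] --> F x xi) ->
  (forall xi x y, x <= y -> F y xi - F x xi <= y - x) ->
  Pis i @[i --> U] --> Pi -> forall xi x, cdf (Pi xi) x = F x xi.
Proof.
move=> hF lipF /cvg_path_measureP h xi x.
apply/eqP; rewrite eq_le; apply/andP; split; apply/ler_addgt0Pr => e e0.
- have xe : x < x + e by rewrite ltrDl.
  have /andP[h1 _] := ramp_integral (path_carried Pi xi) xe.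
  apply: le_trans h1 _; rewrite -lerBlDl.
  have h2 := lipF xi _ _ (ltW xe).
  suff : \int[Pi xi]_(t in `[0, 1]%classic) ramp x (x + e) t <= F (x + e) xi by lra.
  rewrite -subr_ge0; apply: (@cvgr_to_ge _ U _ _ (fun i => cdf (Pis i xi) (x + e) -
      \int[Pis i xi]_(t in `[0, 1]%classic) ramp x (x + e) t)).
    by apply: cvgB; [exact: hF|exact: (h xi (ramp_test x (x + e)))].
  near=> i; rewrite subr_ge0.
  by have /andP[] := ramp_integral (path_carried (Pis i) xi) xe.
- have xe : x - e < x by rewrite gtrBl.
  have /andP[_ h1] := ramp_integral (path_carried Pi xi) xe.
  have h2 := lipF xi _ _ (ltW xe).
  suff : F (x - e) xi <= \int[Pi xi]_(t in `[0, 1]%classic) ramp (x - e) x t by lra.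
  rewrite -subr_ge0; apply: (@cvgr_to_ge _ U _ _ (fun i =>
      \int[Pis i xi]_(t in `[0, 1]%classic) ramp (x - e) x t - cdf (Pis i xi) (x - e))).
    by apply: cvgB; [exact: (h xi (ramp_test (x - e) x))|exact: hF].
  near=> i; rewrite subr_ge0.
  by have /andP[] := ramp_integral (path_carried (Pis i) xi) xe.
Unshelve. all: by end_near. Qed.

End path_measure_convergence.

Lemma cdf_Pi2_hat (R : realType) (A : finType) n (eta : {ffun 'I_n.+1 -> A}) xi (x : R) :
  cdf (Pi2_hat R eta xi) x = pairs_upto eta x xi.
Proof.
rewrite /cdf /= /emp_spatial /pairs_upto /pairs_before.
have -> : (\sum_(i < n.+1 | (eta i, eta (ordS i)) == xi)
    \d_((i.+1%:R / n.+1%:R)%R : measurableTypeR R) `]-oo, x]%classic)%E =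
  ((\sum_(i < n.+1) ((i < Num.truncn (x * n.+1%:R)) &&
     ((eta i, eta (ordS i)) == xi)))%N%:R : R)%:E.
  rewrite natr_sum -sumEFin big_mkcond/=; apply: eq_bigr => i _.
  case: ifP => _; rewrite ?andbT ?andbF//.
  rewrite diracE; congr (_%:R%:E); rewrite truncn_gt_nat.
  rewrite -ler_pdivrMr ?ltr0n//.
  congr (nat_of_bool _); apply/idP/idP => [/set_mem|h]; first by rewrite /= in_itv.
  by apply/mem_set; rewrite /= in_itv.
by [].
Qed.

(** * Measures with Lipschitz distribution functions *)

Section lipschitz_stieltjes.
Context {R : realType} (F : R -> R).
Hypotheses (F_mono : forall x y, x <= y -> F x <= F y)
  (F_lip : forall x y, x <= y -> F y - F x <= y - x).

Lemma lip_continuous : continuous F.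
Proof.
move=> x; apply/cvgrPdist_le => e e0; near=> y.
apply: (@le_trans _ _ `|x - y|); last first.
  by near: y; apply: cvgr_dist_le => //; exact: cvg_id.
have [xy|yx] := leP x y.
- rewrite [leLHS]ler0_norm ?subr_le0 ?F_mono// opprB.
  by rewrite ler0_norm ?subr_le0// opprB F_lip.
- rewrite [leLHS]ger0_norm ?subr_ge0 ?F_mono ?(ltW yx)//.
  by rewrite ger0_norm ?subr_ge0 ?(ltW yx)// F_lip// ltW.
Unshelve. all: by end_near. Qed.

Let Fnd : {homo F : x y / x <= y}. Proof. exact: F_mono. Qed.
Let Frc : forall x, F @ at_right x --> F x.
Proof. exact: right_continuousW lip_continuous. Qed.

HB.instance Definition _ := isCumulative.Build R _ R F Fnd Frc.

Definition stieltjes : {measure set (measurableTypeR R) -> \bar R} :=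
  lebesgue_stieltjes_measure F.

Lemma stieltjes_itv a b : a <= b -> stieltjes `]a, b]%classic = (F b - F a)%:E.
Proof.
move=> ab; rewrite -[LHS]/(lebesgue_stieltjes_measure F `]a, b]%classic).
rewrite /lebesgue_stieltjes_measure /measure_extension/=.
by rewrite measurable_mu_extE/= ?wlength_itv_bnd//; exact: is_ocitv.
Qed.

(** Restricting the Stieltjes measure to a bounded interval yields finiteness at
once, and loses no mass. *)
Lemma stieltjes_finite_measure : (forall x, x <= 0 -> F x = 0) ->
  (forall x, 1 <= x -> F x = F 1) ->
  exists m : {finite_measure set (measurableTypeR R) -> \bar R},
    m (~` `[0, 1]%classic) = 0%E /\ forall x, cdf m x = F x.
Proof.
move=> F0 F1.
have mD : measurable (`]-1, 1]%classic : set (measurableTypeR R)) by [].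
have Doo : (stieltjes `](-1)%R, 1%R]%classic < +oo)%E.
  by rewrite stieltjes_itv ?ltry//; lra.
exists (mfrestr mD Doo); rewrite /mfrestr /mrestr/=; split.
  apply/eqP; rewrite eq_le measure_ge0 andbT.
  rewrite (_ : 0%E = stieltjes `]-1, 0]%classic); last first.
    by rewrite stieltjes_itv ?F0 ?subrr//; lra.
  apply: le_measure; rewrite ?inE//.
    by apply: measurableI => //; exact: measurableC.
  move=> x [/=]; rewrite !in_itv/= => /negP; rewrite negb_and -!ltNge.
  by move=> /orP[x0|x1] /andP[-> h]; [exact: ltW|move: h; rewrite leNgt x1].
move=> x; rewrite /cdf/= /mfrestr /mrestr.
have [x1|x1] := leP x (-1).
  rewrite (_ : _ `&` _ = set0) ?measure0 ?F0//; first by lra.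
  apply/seteqP; split => t //= []; rewrite !in_itv/= => tx /andP[t1 _].
  by have := lt_le_trans t1 (le_trans tx x1); rewrite ltxx.
have -> : `]-oo, x]%classic `&` `]-1, 1]%classic = `]-1, Num.min x 1]%classic.
  apply/seteqP; split => t /=; rewrite !in_itv/= le_min.
    by move=> [-> /andP[-> ->]].
  by move=> /andP[-> /andP[-> ->]].
rewrite stieltjes_itv/=; last by rewrite le_min (ltW x1)/=; lra.
rewrite (F0 (-1)) ?subr0; last by lra.
by have [//|x1'] := leP x 1; rewrite (F1 _ (ltW x1')).
Qed.

End lipschitz_stieltjes.

Section density.
Context {R : realType} (mu : {finite_measure set (measurableTypeR R) -> \bar R}).

Definition density (t : R) : R :=
  fine ('d (charge_of_finite_measure mu) '/d (@lebesgue_measure R) t).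

Hypothesis mu_dom : mu `<< @lebesgue_measure R.

Lemma density_integrable : (@lebesgue_measure R).-integrable setT (EFin \o density).
Proof.
apply: eq_integrable (Radon_Nikodym_integrable (nu := charge_of_finite_measure mu) mu_dom) => //.
by move=> t _; rewrite /= fineK// Radon_Nikodym_fin_num.
Qed.

Lemma density_integral A : measurable (A : set (measurableTypeR R)) ->
  (\int[@lebesgue_measure R]_(t in A) (density t)%:E)%E = mu A.
Proof.
move=> mA; have := Radon_Nikodym_integral (nu := charge_of_finite_measure mu) mu_dom mA.
move=> muE; apply: (etrans _ (esym muE)).
by apply: eq_integral => t _; rewrite fineK// Radon_Nikodym_fin_num.
Qed.

End density.

Section lipschitz_density.
Context {R : realType} (mu : {finite_measure set (measurableTypeR R) -> \bar R}).
Hypothesis mu_lip : forall x y, x <= y -> cdf mu y - cdf mu x <= y - x.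

(** A measure whose distribution function is 1-Lipschitz is completed to the
Lebesgue measure by another Stieltjes measure. *)
Lemma lipschitz_le_lebesgue (A : set (measurableTypeR R)) : measurable A ->
  (mu A <= lebesgue_measure A)%E.
Proof.
move=> mA; pose G x := x - cdf mu x.
have G_mono x y : x <= y -> G x <= G y.
  by move=> xy; have := mu_lip xy; rewrite /G; lra.
have G_lip x y : x <= y -> G y - G x <= y - x.
  by move=> xy; have := cdf_mono mu xy; rewrite /G; lra.
pose nu : {measure set (measurableTypeR R) -> \bar R} :=
  measure_add mu (stieltjes G_mono G_lip).
have nuE X : nu X = (mu X + stieltjes G_mono G_lip X)%E by exact: measure_addE.
rewrite (@lebesgue_measure_unique R nu _ A mA) ?nuE ?leeDl//.
move=> X; have [->|] := eqVneq X set0; first by rewrite !measure0.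
move=> X0 /ocitvP[XE|[[a b]/= ab ->]]; first by rewrite XE eqxx in X0.
have L : lebesgue_measure (`]a, b]%classic : set R) = (b - a)%:E.
  by rewrite lebesgue_measure_itv/= lte_fin ab EFinB.
rewrite [LHS]L nuE stieltjes_itv ?(ltW ab)//.
have := mu_itv mu (ltW ab) => /= E; rewrite [X in (X + _)%E]E.
by rewrite -EFinD /G; congr EFin; ring.
Qed.

Lemma lipschitz_dominated : mu `<< @lebesgue_measure R.
Proof.
apply/null_content_dominatesP => A mA A0; apply/eqP.
by rewrite eq_le measure_ge0 andbT -A0 lipschitz_le_lebesgue.
Qed.

(** Dyadic intervals are open on the left, to match distribution functions; the
ceiling chooses the one that contains [x]. *)
Definition dyadic_left (x : R) (j : nat) : R := (Num.ceil (x * 2 ^+ j) - 1)%:~R / 2 ^+ j.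

Lemma dyadic_left_lt x j : dyadic_left x j < x <= dyadic_left x j + (2 ^+ j)^-1.
Proof.
have p0 : 0 < 2 ^+ j :> R by rewrite exprn_gt0.
have /andP[h1 h2] := ceil_itv (x * 2 ^+ j).
rewrite /dyadic_left ltr_pdivrMr// h1/=.
rewrite -[X in _ <= _ + X]mul1r -mulrDl ler_pdivlMr// intrB subrK.
exact: h2.
Qed.

(** Lebesgue differentiation: the dyadic interval that contains [x] shrinks nicely
to [x], as it fills half of the ball of radius its length. *)
Lemma dyadic_density : {ae @lebesgue_measure R, forall x,
  2 ^+ j * (cdf mu (dyadic_left x j + (2 ^+ j)^-1) - cdf mu (dyadic_left x j))
    @[j --> \oo] --> density mu x}.
Proof.
have loc : locally_integrable setT (density mu).
  by apply: open_integrable_locally; [exact: openT|exact: density_integrable lipschitz_dominated].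
apply: (@filterS _ _ (ae_filter_ringOfSetsType (@lebesgue_measure R)) _ _ _
  (lebesgue_differentiation loc)) => x xpt.
pose E (x : R) j : set R := `]dyadic_left x j, dyadic_left x j + (2 ^+ j)^-1]%classic.
have p0 j : 0 < (2 ^+ j)^-1 :> R by rewrite invr_gt0 exprn_gt0.
have Emeas y j : lebesgue_measure (E y j) = ((2 ^+ j)^-1)%:E.
  by rewrite lebesgue_measure_itv/= lte_fin ltrDl p0 -EFinD addrAC subrr add0r.
have Enice y : nicely_shrinking y (E y).
  split; first by move=> j; exact: measurable_itv.
  exists (2, fun j => PosNum (p0 j)); split => //=.
  - have h := @cvg_geometric R 1 (2^-1).
    have {}h : (fun j => (2 ^+ j)^-1 : R) @ \oo --> (0 : R).
      rewrite (_ : (fun j => (2 ^+ j)^-1 : R) = geometric 1 (2^-1)).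
        by apply: h; rewrite ger0_norm ?invf_lt1//; lra.
      by apply/funext => j; rewrite /geometric/= mul1r exprVn.
    exact: h.
  - move=> j z; rewrite /E /= in_itv/= => /andP[z1 z2].
    have /andP[y1 y2] := dyadic_left_lt y j.
    rewrite /ball/= ltr_distlC; move: z1 z2 y1 y2.
    by move: (dyadic_left y j) (_ ^- j) => u p; lra.
  - move=> j; rewrite Emeas lebesgue_measure_ball ?(ltW (p0 j))//.
    by rewrite -EFinM lee_fin/= mulr_natl.
have := nice_lebesgue_differentiation Enice loc xpt.
have fE j : ((lebesgue_measure (E x j))^-1 *
     \int[lebesgue_measure]_(y in E x j) (density mu y)%:E =
   (2 ^+ j * (cdf mu (dyadic_left x j + (2 ^+ j)^-1) - cdf mu (dyadic_left x j)))%:E)%E.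
  rewrite Emeas (density_integral lipschitz_dominated); last exact: measurable_itv.
  have := mu_itv mu (ltW (_ : dyadic_left x j < dyadic_left x j + (2 ^+ j)^-1)).
  rewrite ltrDl p0 => /(_ isT) ->.
  by rewrite inver gt_eqF// invrK -EFinM.
under eq_fun do rewrite fE.
by move=> /fine_cvgP[].
Qed.

End lipschitz_density.

(** * Integrals of functions that may fail to be measurable *)

Section lower_integrals.
Import HBNNSimple.
Context d (T : measurableType d) (R : realType) (mu : {measure set T -> \bar R}).
Variables (D : set T) (f : T -> \bar R).
Hypotheses (mD : measurable D) (f0 : forall t, D t -> (0 <= f t)%E).

(** The rate along a density is an infimum over an uncountable family of fluxes.
Its integral is a lower integral, which simple functions control from both
sides. *)
Lemma integral_le_of_simple (c : \bar R) :
  (forall h : {nnsfun T >-> R}, (forall t, D t -> ((h t)%:E <= f t)%E) ->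
     (\int[mu]_(t in D) (h t)%:E <= c)%E) ->
  (\int[mu]_(t in D) f t <= c)%E.
Proof.
move=> hc; rewrite ge0_integralE//; apply: ge_ereal_sup => _ [h /= hf <-].
have hD t : D t -> ((h t)%:E <= f t)%E.
  by move=> Dt; have := hf t; rewrite /patch mem_set.
have hnD t : ~ D t -> h t = 0.
  move=> Dt; have := hf t; rewrite /patch memNset//= lee_fin => h0.
  by apply/eqP; rewrite eq_le h0/=; exact: fun_ge0.
rewrite (_ : sintegral mu h = \int[mu]_(t in D) (h t)%:E)%E; first exact: hc.
rewrite integral_nnsfun//; congr (sintegral mu _); apply/funext => t.
by rewrite /patch; case: ifPn => //; rewrite notin_setE => /hnD.
Qed.

Lemma integral_ge_simple (h : {nnsfun T >-> R}) :
  (forall t, D t -> ((h t)%:E <= f t)%E) ->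
  (\int[mu]_(t in D) (h t)%:E <= \int[mu]_(t in D) f t)%E.
Proof.
move=> hf; rewrite [leRHS]ge0_integralE//; apply: ereal_sup_ubound.
exists (proj_nnsfun h mD); last first.
  by rewrite integral_nnsfun// mrestrict.
move=> t; rewrite (_ : proj_nnsfun h mD t = (h \_ D) t); last by rewrite mrestrict.
by rewrite /patch; case: ifPn => // /set_mem; exact: hf.
Qed.

End lower_integrals.

Section fatou_nonmeasurable.
Import HBNNSimple.
Context {R : realType}.
Notation leb := (@lebesgue_measure R).

(** Fatou's lemma for an upper bound of [f] almost everywhere, applied to the simple
functions below [f]. *)
Lemma integral_le_fatou (D : set (measurableTypeR R)) (f : R -> \bar R) (g : nat -> R -> R)
    (c : R -> R) (l : R) : measurable D -> (forall t, D t -> (0 <= f t)%E) ->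
  (forall j, measurable_fun D (g j)) -> (forall j t, D t -> 0 <= g j t) ->
  (forall j, (\int[leb]_(t in D) (g j t)%:E <= l%:E)%E) ->
  {ae leb, forall t, D t -> g j t @[j --> \oo] --> c t /\ (f t <= (c t)%:E)%E} ->
  (\int[leb]_(t in D) f t <= l%:E)%E.
Proof.
move=> mD f0 mg g0 gl gc; apply: integral_le_of_simple => // h hf.
have mgE j : measurable_fun D (fun t => (g j t)%:E) by exact/measurable_EFinP.
have := @fatou _ _ _ leb D mD (fun j t => (g j t)%:E) mgE
  (fun j t Dt => g0 j t Dt).
move=> F; apply: le_trans (le_trans F _); last first.
  rewrite limn_einf_lim; apply: lime_le; first exact: is_cvg_einfs.
  apply: nearW => j; apply: le_trans (gl j); apply: ereal_inf_lbound.
  by exists j => //=.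
apply: ae_ge0_le_integral => //.
- by move=> t _; rewrite lee_fin; exact: fun_ge0.
- by apply/measurable_EFinP; exact: measurable_funTS.
- move=> t Dt; rewrite limn_einf_lim; apply: lime_ge; first exact: is_cvg_einfs.
  by apply: nearW => j; apply: le_ereal_inf_tmp => _ [k _ <-]; rewrite lee_fin g0.
- apply: (@emeasurable_fun_cvg _ _ _ _ (fun n t => einfs (fun j => (g j t)%:E) n)).
    exact: measurable_fun_einfs.
  by move=> t _; rewrite limn_einf_lim; exact: is_cvg_einfs.
- apply: (@filterS _ _ (ae_filter_ringOfSetsType leb) _ _ _ gc) => t h1 Dt.
  have [h2 h3] := h1 Dt.
  have gE : (g j t)%:E @[j --> \oo] --> (c t)%:E by apply: cvg_EFin => //; exact: nearW.
  have [-> _] := cvg_limn_einf_sup gE; exact: le_trans (hf t Dt) h3.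
Qed.

End fatou_nonmeasurable.

(** * Rate of the limits of the spatial measure *)

Lemma dyadic_sizeE (R : realType) j : (2 ^ j).-1.+1%:R = 2 ^+ j :> R.
Proof. by rewrite prednK ?expn_gt0// natrX. Qed.

Lemma dyadic_block (R : realType) (x : R) j : 0 < x <= 1 ->
  exists k : 'I_(2 ^ j).-1.+1,
    dyadic_left x j = k%:R / (2 ^ j).-1.+1%:R /\
    dyadic_left x j + (2 ^+ j)^-1 = k.+1%:R / (2 ^ j).-1.+1%:R.
Proof.
move=> /andP[x0 x1]; rewrite dyadic_sizeE.
have p0 : 0 < 2 ^+ j :> R by rewrite exprn_gt0.
have /andP[h1 _] := ceil_itv (x * 2 ^+ j).
have c1 : 0 < Num.ceil (x * 2 ^+ j) by rewrite ceil_gt0 mulr_gt0.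
have [k kE] : exists k : nat, Num.ceil (x * 2 ^+ j) - 1 = k%:Z.
  by exists `|Num.ceil (x * 2 ^+ j) - 1|%N; lia.
have kR : (k%:~R : R) < 2 ^+ j.
  by rewrite -kE; apply: lt_le_trans h1 _; rewrite ler_piMl// ltW.
have kj : (k < (2 ^ j).-1.+1)%N.
  by rewrite prednK ?expn_gt0// -(ltr_nat R) natrX.
exists (Ordinal kj); rewrite /dyadic_left kE; split => //=.
by rewrite -[k.+1%:R]natr1 mulrDl mul1r.
Qed.

Lemma in_block (R : realType) (x : R) m (k k' : nat) :
  k%:R / m.+1%:R < x <= k.+1%:R / m.+1%:R ->
  \1_(`]k'%:R / m.+1%:R, k'.+1%:R / m.+1%:R]%classic) x = (k' == k)%:R :> R.
Proof.
have m0 : 0 < m.+1%:R :> R by rewrite ltr0n.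
move=> /andP[kx xk]; rewrite indicE; congr (nat_of_bool _)%:R.
apply/idP/eqP => [/set_mem|->]; last by apply/mem_set; rewrite /= in_itv/= kx.
rewrite /= in_itv/= => /andP[kx' xk'].
have := lt_le_trans kx xk'; have := lt_le_trans kx' xk.
rewrite !ltr_pM2r ?invr_gt0// !ltr_nat; lia.
Qed.

Section flux_path_densities.
Context {R : realType} {S : finType} (G : R -> S * S -> R) (Gp : flux_path G).

(** All increments are nonnegative and they sum up to the length of the interval. *)
Lemma flux_path_sub_le (P : pred (S * S)) s t : s <= t ->
  \sum_(e | P e) (G t e - G s e) <= t - s.
Proof.
move=> st; pose s' := Num.max 0 s; pose t' := Num.min 1 t.
have [t0|t0] := leP t 0.
  rewrite big1 ?subr_ge0// => e _.
  by rewrite !(flux_path_le0 Gp) ?subrr//; exact: le_trans st t0.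
have [s1|s1] := leP 1 s.
  rewrite big1 ?subr_ge0// => e _.
  by rewrite !(flux_path_ge1 Gp e (t := _)) ?subrr//; exact: le_trans s1 st.
have s'E e : G s e = G s' e.
  by rewrite /s'; have [s0|//] := leP s 0; rewrite !(flux_path_le0 Gp).
have t'E e : G t e = G t' e.
  by rewrite /t'; have [t1|//] := leP 1 t; rewrite (flux_path_ge1 Gp e t1).
have s't' : s' <= t' by rewrite /s' /t' ge_max !le_min ler01 st (ltW t0) (ltW s1).
have s'01 : 0 <= s' <= 1 by rewrite /s' le_max lexx/= ge_max ler01 ltW.
have t'01 : 0 <= t' <= 1 by rewrite /t' ge_min lexx andbT le_min ler01 ltW.
apply: (@le_trans _ _ (\sum_e (G t' e - G s' e))).
  rewrite big_mkcond; apply: ler_sum => e _; rewrite s'E t'E.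
  by case: ifP => // _; rewrite subr_ge0 (flux_path_mono Gp).
rewrite sumrB !(flux_path_total Gp)//.
have h1 : s <= s' by rewrite /s' le_max lexx orbT.
have h2 : t' <= t by rewrite /t' ge_min lexx orbT.
lra.
Qed.

Lemma flux_path_lip e s t : s <= t -> G t e - G s e <= t - s.
Proof. by move=> /(flux_path_sub_le (pred1 e)); rewrite big_pred1_eq. Qed.

Lemma rescaled_increment_Mst m (k : 'I_m.+1) :
  Mst R S (fun e => m.+1%:R * increment G m k e).
Proof.
have m0 : 0 < m.+1%:R :> R by rewrite ltr0n.
have k01 (i : nat) : (i <= m.+1)%N -> 0 <= (i%:R / m.+1%:R : R) <= 1.
  by move=> im; rewrite divr_ge0//= ler_pdivrMr// mul1r ler_nat.
split.
- move=> e; rewrite mulr_ge0 ?(ltW m0)// subr_ge0 (flux_path_mono Gp)//.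
  by rewrite ler_pM2r ?invr_gt0// ler_nat.
- rewrite -mulr_sumr sumrB !(flux_path_total Gp) ?k01//; last by rewrite ltnW.
  by rewrite -mulrBl -[k.+1%:R]natr1 [_ + 1]addrC addrK mul1r divff ?gt_eqF.
- move=> s; rewrite -!mulr_sumr !sumrB.
  by rewrite (flux_path_st Gp) [X in _ * (_ - X) = _](flux_path_st Gp).
Qed.

End flux_path_densities.

Lemma Mst_closed (R : realType) (S : finType) (I : Type) (F : set_system I)
    {FF : ProperFilter F} (c : I -> S * S -> R) (d : S * S -> R) :
  (\forall i \near F, Mst R S (c i)) -> (forall e, c i e @[i --> F] --> d e) -> Mst R S d.
Proof.
move=> cst cd; split.
- move=> e; apply: (cvgr_to_ge (cd e)); near=> i.
  by have [] : Mst R S (c i) by near: i.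
- have h : \sum_e c i e @[i --> F] --> \sum_e d e by apply: cvg_sumr => e _; exact: cd.
  apply: (cvg_unique (@norm_hausdorff _ R^o) h).
  apply: (@cvg_trans _ ((fun=> 1 : R) @ F)); last exact: cvg_cst.
  by apply: near_eq_cvg; near=> i; have [_ -> _] : Mst R S (c i) by near: i.
- move=> s.
  have h : \sum_s' c i (s, s') @[i --> F] --> \sum_s' d (s, s').
    by apply: cvg_sumr => s' _; exact: cd.
  apply: (cvg_unique (@norm_hausdorff _ R^o) h).
  apply: (@cvg_trans _ ((fun i => \sum_s' c i (s', s)) @ F)).
    by apply: near_eq_cvg; near=> i; have [_ _ ->] : Mst R S (c i) by near: i.
  by apply: cvg_sumr => s' _; exact: cd.
Unshelve. all: by end_near. Qed.

Section path_upper.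
Context {R : realType} {A B : finType}.
Variables (M : A -> 'M[R]_#|B|) (x y : B -> R) (lam : R).
Hypotheses (A_gt0 : (0 < #|A|)%N) (B_gt0 : (0 < #|B|)%N)
  (M_ge0 : forall a, nonneg_mx (M a)) (M_irr : forall a, irreducible_mx (M a))
  (M_aper : forall a, aperiodic_mx (M a)) (x_gt0 : forall b, 0 < x b)
  (y_gt0 : forall b, 0 < y b) (lamP : perron_eigenvalue (\sum_a M a) lam).
Notation W := (edge_weight M).
Notation leb := (@lebesgue_measure R).

Lemma I2_ge0 nu : (0 <= I2 M lam nu)%E.
Proof.
have [nuP|nuP] := pselect (Mst R A nu).
  have [/(_ (exist _ nu (mem_set nuP)))//] := ldp_pair_measure A_gt0 B_gt0 M_ge0
    M_irr M_aper x_gt0 y_gt0 lamP.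
rewrite leNgt; apply/negP => /(I2_lt M_ge0)[C [Cst _ _ Cnu]]; apply: nuP.
by rewrite -(_ : pair_marginal C = nu); [exact: pair_marginal_Mst|exact/funext].
Qed.

(** The contraction [I2] of this cost is nonnegative, being a rate functional. *)
Lemma flux_cost_lam_ge0 C : Mst R (A * B)%type C -> carried W C ->
  0 <= flux_cost W C + ln lam.
Proof.
move=> Cst Ccar; rewrite -lee_fin; apply: le_trans (I2_ge0 (pair_marginal C)) _.
exact: (I2_le Cst Ccar).
Qed.

Variables (G : R -> (A * B) * (A * B) -> R) (l : R).
Hypotheses (Gp : flux_path G) (Gc : dyadic_cost_le W lam G l).

Let F (t : R) xi := pair_marginal (G t) xi.

Let F_mono xi s t : s <= t -> F s xi <= F t xi.
Proof. by move=> st; apply: ler_sum => e _; exact: flux_path_mono. Qed.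

Let F_lip xi s t : s <= t -> F t xi - F s xi <= t - s.
Proof. by move=> st; rewrite /F /pair_marginal -sumrB; exact: flux_path_sub_le. Qed.

Lemma path_measure_of_flux : exists t : path_measure R (A * A)%type,
  forall xi u, cdf (t xi) u = pair_marginal (G u) xi.
Proof.
have /choice[m mP] : forall xi, exists m : {finite_measure set (measurableTypeR R) -> \bar R},
    m (~` `[0, 1]%classic) = 0%E /\ forall u, cdf m u = F u xi.
  move=> xi; apply: (stieltjes_finite_measure (@F_mono xi) (@F_lip xi)).
    by move=> u u0; rewrite /F /pair_marginal big1// => e _; exact: (flux_path_le0 Gp).
  by move=> u u1; apply: eq_bigr => e _; exact: (flux_path_ge1 Gp).
exists (@PathMeasure R _ m (fun xi => (mP xi).1)) => xi u; exact: (mP xi).2.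
Qed.

Let q j (k : 'I_(2 ^ j).-1.+1) : R :=
  flux_cost W (fun e => (2 ^ j).-1.+1%:R * increment G (2 ^ j).-1 k e) + ln lam.

Let block j k : set (measurableTypeR R) :=
  `]k%:R / (2 ^ j).-1.+1%:R, k.+1%:R / (2 ^ j).-1.+1%:R]%classic.

(* Step functions whose integrals are the costs of the dyadic increments. *)
Let g j (u : R) : R := \sum_(k < (2 ^ j).-1.+1) q k * \1_(block j k) u.

Let q_ge0 j (k : 'I_(2 ^ j).-1.+1) : 0 <= q k.
Proof.
apply: flux_cost_lam_ge0; first exact: rescaled_increment_Mst.
by apply: carriedZ => //; exact: (Gc j).1.
Qed.

Let g_integral j : (\int[leb]_(u in `[0%R, 1%R]) (g j u)%:E <= l%:E)%E.
Proof.
have N0 : 0 < (2 ^ j).-1.+1%:R :> R by rewrite ltr0n.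
have -> : (\int[leb]_(u in `[0%R, 1%R]) (g j u)%:E =
    \sum_(k < (2 ^ j).-1.+1) \int[leb]_(u in `[0%R, 1%R]) (q k * \1_(block j k) u)%:E)%E.
  under eq_integral do rewrite /g -sumEFin.
  apply: ge0_integral_sum => //.
    move=> k; apply/measurable_EFinP; apply: measurable_funM => //.
    by apply: measurable_indic; exact: measurable_itv.
  by move=> k u _; rewrite lee_fin mulr_ge0.
apply: (@le_trans _ _ (\sum_(k < (2 ^ j).-1.+1)
    (q k * (2 ^ j).-1.+1%:R^-1)%:E)%E).
  apply: lee_sum => k _; under eq_integral do rewrite EFinM.
  rewrite ge0_integralZl_EFin//; last first.
    by apply/measurable_EFinP; apply: measurable_indic; exact: measurable_itv.
  rewrite integral_indic//; last exact: measurable_itv.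
  rewrite EFinM lee_wpmul2l ?lee_fin//.
  apply: (@le_trans _ _ (leb (block j k))).
    apply: le_measure; rewrite ?inE//.
      by apply: measurableI => //; exact: measurable_itv.
    exact: measurable_itv.
  rewrite lebesgue_measure_itv/= lte_fin ltr_pM2r ?invr_gt0// ltr_nat ltnSn.
  by rewrite -EFinB -mulrBl -[k.+1%:R]natr1 [_ + 1]addrC addrK mul1r.
rewrite sumEFin lee_fin; apply: le_trans (Gc j).2.
rewrite /q; under eq_bigr do rewrite flux_costZ ?(ltW N0)// mulrDl mulrAC divff
  ?gt_eqF// mul1r.
rewrite big_split/= lerD2l sumr_const card_ord -mulrnAl.
by rewrite -[X in X / _]mulr_natr mulfK ?gt_eqF.
Qed.

Section limit.
Variable t : path_measure R (A * A)%type.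
Hypothesis tF : forall xi u, cdf (t xi) u = pair_marginal (G u) xi.

Let t_lip xi u v : u <= v -> cdf (t xi) v - cdf (t xi) u <= v - u.
Proof. by rewrite !tF; exact: F_lip. Qed.

Let t_dom xi : t xi `<< leb.
Proof. exact: lipschitz_dominated (@t_lip xi). Qed.

Let D j u e : R := 2 ^+ j * (G (dyadic_left u j + (2 ^+ j)^-1) e - G (dyadic_left u j) e).

Let D_incr j u : 0 < u <= 1 -> exists k : 'I_(2 ^ j).-1.+1,
  D j u = (fun e => (2 ^ j).-1.+1%:R * increment G (2 ^ j).-1 k e) /\ g j u = q k.
Proof.
move=> u01; have [k [k1 k2]] := dyadic_block j u01; exists k; split.
  by apply/funext => e; rewrite /D k2 k1 dyadic_sizeE /increment dyadic_sizeE.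
have := dyadic_left_lt u j; rewrite k2 k1 => uk.
rewrite /g (bigD1 k)//= (in_block _ uk) eqxx mulr1 big1 ?addr0// => k' k'k.
by rewrite (in_block _ uk) (_ : (_ == _) = false) ?mulr0//; apply/negbTE.
Qed.

(** At almost every point the mean fluxes over the dyadic intervals converge, edge by
edge; the limit is an admissible flux for the density, and the cost is
continuous. *)
Lemma path_density_ae : {ae leb, forall u, u \in (`[0, 1] : interval R) ->
  exists c : R, Mst R A (path_density t u) /\ g j u @[j --> \oo] --> c /\
    (I2 M lam (path_density t u) <= c%:E)%E}.
Proof.
have /choice[T TP] : forall e, exists m : {finite_measure set (measurableTypeR R) -> \bar R},
    m (~` `[0, 1]%classic) = 0%E /\ forall u, cdf m u = G u e.
  move=> e; apply: stieltjes_finite_measure.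
  - by move=> u v; exact: (flux_path_mono Gp).
  - by move=> u v; exact: (flux_path_lip Gp).
  - by move=> u; exact: (flux_path_le0 Gp).
  - by move=> u; exact: (flux_path_ge1 Gp).
have T_lip e u v : u <= v -> cdf (T e) v - cdf (T e) u <= v - u.
  by rewrite !(TP e).2; exact: (flux_path_lip Gp).
have FL := ae_filter_ringOfSetsType leb.
have T_ae := @filter_forall _ _ _ _ FL (fun e => dyadic_density (@T_lip e)).
have t_ae := @filter_forall _ _ _ _ FL (fun xi => dyadic_density (@t_lip xi)).
have n0 : {ae leb, forall u : R, u != 0}.
  exists [set 0]; split => //; first exact: lebesgue_measure_set1.
  by move=> u /= /negP; rewrite negbK => /eqP.
apply: (@filterS3 _ _ FL _ _ _ _ _ T_ae t_ae n0) => u Tu tu u0.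
rewrite in_itv/= => /andP[u0' u1].
have u01 : 0 < u <= 1 by rewrite u1 lt_neqAle eq_sym u0 u0'.
pose c e := density (T e) u.
have Dc e : D j u e @[j --> \oo] --> c e.
  have := Tu e; under eq_fun do rewrite !(TP e).2.
  by [].
have Dst j : Mst R (A * B)%type (D j u).
  by have [k [-> _]] := D_incr j u01; exact: rescaled_increment_Mst.
have Dcar j : carried W (D j u).
  have [k [-> _]] := D_incr j u01; apply: carriedZ => //; exact: (Gc j).1.
have gD j : g j u = flux_cost W (D j u) + ln lam.
  by have [k [-> ->]] := D_incr j u01.
have cst : Mst R (A * B)%type c by apply: Mst_closed Dc; exact: nearW.
have [ccar ccvg] := flux_cost_cvg (nearW _ Dcar) Dc.
have cE : pair_marginal c = path_density t u.
  apply/funext => xi.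
  have h1 : pair_marginal (D j u) xi @[j --> \oo] --> pair_marginal c xi.
    by apply: cvg_sumr => e _; exact: Dc.
  apply: (cvg_unique (@norm_hausdorff _ R^o) h1).
  have := tu xi; under eq_fun do rewrite !tF /pair_marginal -sumrB mulr_sumr.
  by [].
exists (flux_cost W c + ln lam); rewrite -cE; split; first exact: pair_marginal_Mst.
split; last exact: (I2_le cst ccar).
under eq_fun do rewrite gD.
by apply: cvgD => //; exact: cvg_cst.
Qed.

Lemma J2_le_of_flux : (J2 M lam t <= l%:E)%E.
Proof.
have ae1 := path_density_ae; have FL := ae_filter_ringOfSetsType leb.
rewrite /J2 asboolT; last first.
  split; first exact: t_dom.
  by apply: (@filterS _ _ FL _ _ _ ae1) => u h /h[c []].
pose c u : R := limn (fun j => g j u).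
apply: (@integral_le_fatou R _ _ g c) => //.
- by move=> u _; exact: I2_ge0.
- move=> j; apply: measurable_sum => k; apply: measurable_funM => //.
  by apply: measurable_indic; exact: measurable_itv.
- by move=> j u _; apply: sumr_ge0 => k _; rewrite mulr_ge0.
- apply: (@filterS _ _ FL _ _ _ ae1) => u h u01; have [c' [_ [gc' Ic']]] := h u01.
  by rewrite /c (cvg_lim (@norm_hausdorff _ R^o) gc').
Qed.

End limit.

Lemma path_upper (I : Type) (U : set_system I) (nn : I -> nat)
    (eta : forall i, {ffun 'I_(nn i).+1 -> A}) : UltraFilter U ->
  (forall t xi, pairs_upto (eta i) t xi @[i --> U] -->
     \sum_(e | letter_pair e == xi) G t e) ->
  (exists t : path_measure R (A * A)%type, Pi2_hat R (eta i) @[i --> U] --> t) /\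
  (forall t : path_measure R (A * A)%type, Pi2_hat R (eta i) @[i --> U] --> t -> (J2 M lam t <= l%:E)%E).
Proof.
move=> UU etaG; have UP : ProperFilter U := @ultra_proper _ _ UU.
have ccvg xi u : cdf (Pi2_hat R (eta i) xi) u @[i --> U] --> pair_marginal (G u) xi.
  by under eq_fun do rewrite cdf_Pi2_hat; exact: etaG.
split.
  have [t tF] := path_measure_of_flux; exists t.
  by apply: cvg_path_measure_cdf => xi u; rewrite tF; exact: ccvg.
move=> t tcvg; apply: J2_le_of_flux.
exact: (path_measure_cdf_lim ccvg F_lip tcvg).
Qed.

End path_upper.

(** * Approximation of densities by finitely many fluxes *)

Section step_functions.
Import HBNNSimple.
Context d (T : measurableType d) (R : realType) (mu : {measure set T -> \bar R}).
Variables (I : finType) (E : I -> set T) (D : set T).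
Hypotheses (mD : measurable D) (mE : forall i, measurable (E i))
  (ED : forall i, E i `<=` D) (E_disj : forall u i j, E i u -> E j u -> i = j).

Definition step_fun (a : I -> R) (u : T) : R := \sum_i a i * \1_(E i) u.

Lemma step_funE a u i : E i u -> step_fun a u = a i.
Proof.
move=> Ei; rewrite /step_fun (bigD1 i)//= indicE mem_set// mulr1 big1 ?addr0// => j ji.
rewrite indicE memNset ?mulr0// => Ej.
by move/eqP: ji; apply; exact: E_disj Ej Ei.
Qed.

Lemma step_fun_out a u : (forall i, ~ E i u) -> step_fun a u = 0.
Proof. by move=> h; rewrite /step_fun big1// => i _; rewrite indicE memNset ?mulr0. Qed.

Lemma step_fun_measurable a D' : measurable_fun D' (step_fun a).
Proof.
by apply: measurable_sum => i; exact: measurable_funM.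
Qed.

Lemma step_fun_integral a : (forall i, 0 <= a i) ->
  (\int[mu]_(u in D) (step_fun a u)%:E = \sum_i (a i)%:E * mu (E i))%E.
Proof.
move=> a0; under eq_integral do rewrite /step_fun -sumEFin.
rewrite ge0_integral_sum//; last 2 first.
- by move=> i; apply/measurable_EFinP; exact: measurable_funM.
- by move=> i u _; rewrite lee_fin mulr_ge0.
apply: eq_bigr => i _; under eq_integral do rewrite EFinM.
rewrite ge0_integralZl_EFin//; last first.
  by apply/measurable_EFinP; exact: measurable_indic.
by rewrite integral_indic// (setIidl (@ED i)).
Qed.

Lemma step_nnsfun a : (forall i, 0 <= a i) ->
  exists h : {nnsfun T >-> R}, forall u, h u = step_fun a u.
Proof.
move=> a0; rewrite /step_fun; elim: (index_enum I) => [|i s [h hE]].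
  by exists nnsfun0 => u; rewrite big_nil.
exists (add_nnsfun (scale_nnsfun (indic_nnsfun R (mE i)) (a0 i)) h) => u.
by rewrite big_cons -hE.
Qed.

Variable F : T -> \bar R.
Hypotheses (F0 : forall u, D u -> (0 <= F u)%E) (E_fin : forall i, mu (E i) \is a fin_num).

(** The [r i] are the infima of [F] on the cells: they form a step function below
[F], whose integral is therefore less than [l]. *)
Lemma cell_infima (l e : R) : (\int[mu]_(u in D) F u < l%:E)%E -> 0 < e ->
  exists2 r : I -> R, \sum_i r i * fine (mu (E i)) < l &
    forall i, (0 < mu (E i))%E -> exists2 u, E i u & (F u < (r i + e)%:E)%E.
Proof.
move=> Fl e0.
have int_le a : (forall i, 0 <= a i) -> (forall i u, E i u -> ((a i)%:E <= F u)%E) ->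
    \sum_i a i * fine (mu (E i)) < l.
  move=> a0 aF; have [h hE] := step_nnsfun a0.
  rewrite -lte_fin; apply: le_lt_trans Fl.
  have hF u : D u -> ((h u)%:E <= F u)%E.
    move=> Du; rewrite hE; have [[i Ei]|nE] := pselect (exists i, E i u).
      by rewrite (step_funE a Ei); exact: aF.
    by rewrite step_fun_out ?F0// => i Ei; apply: nE; exists i.
  apply: le_trans (integral_ge_simple mu mD F0 hF).
  under eq_integral do rewrite hE.
  rewrite step_fun_integral// -sumEFin; apply: lee_sum => i _.
  by rewrite EFinM fineK.
have cell i : exists r : R, [/\ 0 <= r, forall u, E i u -> (r%:E <= F u)%E &
    (0 < mu (E i))%E -> exists2 u, E i u & (F u < (r + e)%:E)%E].
  have [Epos|E0] := pselect (0 < mu (E i))%E; last first.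
    by exists 0; split => // u /ED; exact: F0.
  have [[u0 Eu0 Fu0]|Foo] := pselect (exists2 u, E i u & (F u < +oo)%E).
    pose m := ereal_inf (F @` E i).
    have m0 : (0 <= m)%E by apply: le_ereal_inf_tmp => _ [u /ED Du <-]; exact: F0.
    have mu0 : (m <= F u0)%E by apply: ereal_inf_lbound; exists u0.
    have mfin : m \is a fin_num by rewrite ge0_fin_numE// (le_lt_trans mu0).
    exists (fine m); split; first exact: fine_ge0.
      by move=> u Eu; rewrite fineK//; apply: ereal_inf_lbound; exists u.
    move=> _; have : (m < (fine m + e)%:E)%E by rewrite EFinD fineK// lteDl// lte_fin.
    by move=> /ereal_inf_lt[_ [u Eu <-] ?]; exists u.
  have len0 : 0 < fine (mu (E i)) by rewrite -lte_fin fineK.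
  (* An infinite value on a whole cell would make the integral exceed [l]. *)
  pose K := (`|l| + 1) / fine (mu (E i)).
  have K0 : 0 <= K by rewrite divr_ge0// addr_ge0.
  have := int_le (fun j => if j == i then K else 0).
  rewrite (bigD1 i)//= eqxx big1 ?addr0; last first.
    by move=> j /negPf ->; rewrite mul0r.
  rewrite divfK ?gt_eqF// => abs.
  have : `|l| + 1 < l.
    apply: abs => j; first by case: ifP.
    move=> u; case: eqP => [-> Eu|_ /ED]; last exact: F0.
    rewrite leNgt; apply/negP => FK; apply: Foo; exists u => //.
    by apply: lt_trans FK _; rewrite ltry.
  by have := ler_norm l; lra.
have /choice[r rP] := cell.
exists r; last by move=> i; have [] := rP i.
by apply: int_le => i; have [] := rP i.
Qed.

End step_functions.

Lemma Mst_mix (R : realType) (S I : finType) (a : I -> R) (c : I -> S * S -> R) :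
  (forall i, 0 <= a i) -> \sum_i a i = 1 -> (forall i, a i != 0 -> Mst R S (c i)) ->
  Mst R S (fun e => \sum_i a i * c i e).
Proof.
move=> a0 a1 cst.
have swap (f : S -> S * S) : \sum_s \sum_i a i * c i (f s) =
    \sum_i a i * \sum_s c i (f s).
  by rewrite exchange_big/=; apply: eq_bigr => i _; rewrite mulr_sumr.
split.
- move=> e; apply: sumr_ge0 => i _; have [->|ai] := eqVneq (a i) 0; first by rewrite mul0r.
  by rewrite mulr_ge0//; have [h _ _] := cst i ai; exact: h.
- rewrite exchange_big/= -a1; apply: eq_bigr => i _; rewrite -mulr_sumr.
  have [->|ai] := eqVneq (a i) 0; first by rewrite mul0r.
  by have [_ -> _] := cst i ai; rewrite mulr1.
- move=> s; rewrite !swap; apply: eq_bigr => i _.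
  have [->|ai] := eqVneq (a i) 0; first by rewrite !mul0r.
  by have [_ _ ->] := cst i ai.
Qed.

Section density_cells.
Context {R : realType} {A B : finType}.
Notation leb := (@lebesgue_measure R).
Variables (t : path_measure R (A * A)%type) (N : set (measurableTypeR R)) (m q : nat).
Hypotheses (t_dom : forall xi, t xi `<< leb) (mN : measurable N) (N0 : leb N = 0%E)
  (t_st : forall u : R, 0 <= u <= 1 -> ~ N u -> Mst R A (path_density t u)).

Let grid (k : nat) : R := k%:R / m.+1%:R.

Let m0 : 0 < m.+1%:R :> R. Proof. by rewrite ltr0n. Qed.
Let q0 : 0 < q.+1%:R :> R. Proof. by rewrite ltr0n. Qed.

(** The null set [N] contains the points at which the density is not a stationary
probability. *)
Definition density_block (k : 'I_m.+1) : set (measurableTypeR R) :=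
  `]grid k, grid k.+1]%classic `\` N.

Lemma density_block_measurable k : measurable (density_block k).
Proof. by apply: measurableD => //; exact: measurable_itv. Qed.

Lemma density_block01 k u : density_block k u -> 0 <= u <= 1 /\ ~ N u.
Proof.
move=> [/=]; rewrite in_itv/= => /andP[ku uk] Nu; split => //; apply/andP; split.
  by apply: le_trans (ltW ku); rewrite divr_ge0.
by apply: le_trans uk _; rewrite ler_pdivrMr// mul1r ler_nat.
Qed.

Lemma null_setD (mu : {measure set (measurableTypeR R) -> \bar R}) k : mu N = 0%E ->
  mu (density_block k) = mu `]grid k, grid k.+1]%classic.
Proof.
move=> muN; have mI : measurable (`]grid k, grid k.+1]%classic : set (measurableTypeR R)).
  exact: measurable_itv.
rewrite [RHS](measureDI mu mI mN) [X in (_ + X)%E](_ : _ = 0%E) ?adde0//.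
apply/eqP; rewrite eq_le measure_ge0 andbT -muN; apply: le_measure; rewrite ?inE//.
exact: measurableI.
Qed.

Lemma leb_density_block k : leb (density_block k) = (m.+1%:R^-1)%:E.
Proof.
rewrite (null_setD (mu := leb))//.
have L : leb (`]grid k, grid k.+1]%classic : set R) = (grid k.+1 - grid k)%:E.
  by rewrite lebesgue_measure_itv/= lte_fin ltr_pM2r ?invr_gt0// ltr_nat ltnSn EFinB.
rewrite [LHS]L /grid -mulrBl.
by rewrite -[k.+1%:R]natr1 [_ + 1]addrC addrK mul1r.
Qed.

Lemma t_density_block k xi :
  t xi (density_block k) = (cdf (t xi) (grid k.+1) - cdf (t xi) (grid k))%:E.
Proof.
rewrite null_setD; first by apply: mu_itv; rewrite ler_pM2r ?invr_gt0// ler_nat.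
by have /null_content_dominatesP := t_dom xi; apply.
Qed.

Lemma path_density01 u xi : 0 <= u <= 1 -> ~ N u -> 0 <= path_density t u xi <= 1.
Proof.
move=> u01 Nu; have [d0 d1 _] := t_st u01 Nu; rewrite d0/= -d1 (bigD1 xi)//= lerDl.
exact: sumr_ge0.
Qed.

(** The density is almost constant on a cell, and one flux can stand for all points
of it. *)
Definition density_cell (c : 'I_m.+1 * {ffun A * A -> 'I_q.+2}) : set (measurableTypeR R) :=
  density_block c.1 `&` \bigcap_(xi in [set: A * A])
    [set u | (c.2 xi)%:R <= q.+1%:R * path_density t u xi < (c.2 xi).+1%:R].

Lemma density_cell_measurable c : measurable (density_cell c).
Proof.
apply: measurableI; first exact: density_block_measurable.
apply: fin_bigcap_measurable; first exact: finite_finset.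
move=> xi _.
have mf : measurable_fun setT (fun u => q.+1%:R * path_density t u xi).
  apply: measurable_funM => //.
  by have /integrableP[/measurable_EFinP] := density_integrable (t_dom xi).
have := mf measurableT `[(c.2 xi)%:R, (c.2 xi).+1%:R[%classic (measurable_itv _).
rewrite setTI; congr measurable; apply/seteqP; split => u /=; rewrite in_itv//=.
Qed.

Lemma density_cell_disj u c c' : density_cell c u -> density_cell c' u -> c = c'.
Proof.
case: c => k s; case: c' => k' s' [[/= + _] hs] [[/= + _] hs'].
rewrite !in_itv/= => ku ku'.
have kk' : k = k'.
  apply/val_inj => /=; have := @in_block R u m k' k ku'.
  rewrite indicE mem_set; last by rewrite /= in_itv.
  by case: eqP => // _ /eqP; rewrite oner_eq0.
rewrite kk'; congr pair; apply/ffunP => xi; apply/val_inj => /=.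
have /andP[h1 h2] := hs xi I; have /andP[h3 h4] := hs' xi I.
have := le_lt_trans h1 h4; have := le_lt_trans h3 h2; rewrite !ltr_nat /=; lia.
Qed.

Lemma density_cell_cover k u : density_block k u -> exists s, density_cell (k, s) u.
Proof.
move=> ku; have [u01 Nu] := density_block01 ku.
exists [ffun xi => inord (Num.truncn (q.+1%:R * path_density t u xi))].
split => // xi _ /=; have /andP[d0 d1] := path_density01 xi u01 Nu.
have qd0 : 0 <= q.+1%:R * path_density t u xi by rewrite mulr_ge0.
rewrite ffunE inordK; first by rewrite truncn_itv.
rewrite ltnS -(ler_nat R); apply: le_trans (_ : q.+1%:R * path_density t u xi <= _).
  by have /andP[] := truncn_itv qd0.
by rewrite ler_piMr// ltW.
Qed.

Definition cell_size c : R := fine (leb (density_cell c)).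

Lemma leb_density_cell c : leb (density_cell c) = (cell_size c)%:E.
Proof.
rewrite /cell_size fineK// ge0_fin_numE//; apply: (@le_lt_trans _ _ (leb (density_block c.1))).
  apply: le_measure; rewrite ?inE//; [exact: density_cell_measurable|
    exact: density_block_measurable|by move=> u []].
by rewrite leb_density_block ltry.
Qed.

Lemma cell_size_ge0 c : 0 <= cell_size c. Proof. exact: fine_ge0. Qed.

Definition cell_step k (a : {ffun A * A -> 'I_q.+2} -> R) : measurableTypeR R -> R :=
  step_fun (fun s => density_cell (k, s)) a.

Lemma cell_integral k (a : {ffun A * A -> 'I_q.+2} -> R) : (forall s, 0 <= a s) ->
  (\int[leb]_(u in density_block k) (cell_step k a u)%:E)%E =
  (\sum_s a s * cell_size (k, s))%:E.
Proof.
move=> a0; rewrite /cell_step step_fun_integral//; last 3 first.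
- exact: density_block_measurable.
- by move=> s; exact: density_cell_measurable.
- by move=> s u [].
by rewrite -sumEFin; apply: eq_bigr => s _; rewrite EFinM; congr (_ * _)%E;
  exact: leb_density_cell.
Qed.

Let block_step k u s (a : _ -> R) : density_cell (k, s) u ->
  cell_step k a u = a s.
Proof.
move=> us; apply: (step_funE (E := fun s => density_cell (k, s)) _ a us).
move=> v i j hi hj.
by have [] := density_cell_disj hi hj.
Qed.

Lemma cell_size_sum k : \sum_s cell_size (k, s) = m.+1%:R^-1.
Proof.
apply/eqP; rewrite -eqe; apply/eqP; rewrite -(leb_density_block k) -[RHS]mul1e -integral_cst//; last first.
  exact: density_block_measurable.
under eq_bigr do rewrite -[cell_size _]mul1r.
rewrite -cell_integral//; apply: eq_integral => u /set_mem /density_cell_cover[s us].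
by rewrite (block_step _ us).
Qed.

(** Both sums lie between the integrals of the step functions that round the density
down and up on the cells. *)
Lemma density_block_bounds k xi (v : {ffun A * A -> 'I_q.+2} -> R) :
  (forall s, 0 < cell_size (k, s) -> (s xi)%:R <= q.+1%:R * v s <= (s xi).+1%:R) ->
  `|\sum_s cell_size (k, s) * v s - (cdf (t xi) (grid k.+1) - cdf (t xi) (grid k))|
  <= m.+1%:R^-1 * q.+1%:R^-1.
Proof.
move=> hv; pose a (s : {ffun A * A -> 'I_q.+2}) : R := (s xi)%:R / q.+1%:R.
pose b (s : {ffun A * A -> 'I_q.+2}) : R := (s xi).+1%:R / q.+1%:R.
have a0 s : 0 <= a s by rewrite divr_ge0.
have b0 s : 0 <= b s by rewrite divr_ge0.
have mB := density_block_measurable k.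
have md : measurable_fun (density_block k) (EFin \o density (t xi)).
  by apply: measurable_funTS; have /integrableP[] := density_integrable (t_dom xi).
have ab u s : density_cell (k, s) u -> a s <= density (t xi) u <= b s.
  move=> [_ /(_ xi Logic.I)/= /andP[h1 h2]]; rewrite /a /b ler_pdivrMr// ler_pdivlMr//.
  by rewrite ![density _ _ * _]mulrC h1 ltW.
have d0 u : density_block k u -> (0 <= (density (t xi) u)%:E)%E.
  by move=> /density_block01[u01 Nu]; rewrite lee_fin; have /andP[] := path_density01 xi u01 Nu.
have mstep c : measurable_fun (density_block k)
    (EFin \o cell_step k c).
  apply/measurable_EFinP; apply: step_fun_measurable => s.
  exact: density_cell_measurable.
have step0 c (u : measurableTypeR R) : (forall s, 0 <= c s) -> density_block k u ->
    (0 <= (cell_step k c u)%:E)%E.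
  by move=> c0 /density_cell_cover[s us]; rewrite (block_step _ us) lee_fin.
have tE := t_density_block k xi; rewrite -(density_integral (t_dom xi) mB) in tE.
have lo : \sum_s a s * cell_size (k, s) <= cdf (t xi) (grid k.+1) - cdf (t xi) (grid k).
  rewrite -lee_fin -cell_integral// -tE; apply: ge0_le_integral => //.
  - by move=> u; exact: step0.
  - exact: mstep.
  - by move=> u /density_cell_cover[s us]; rewrite (block_step _ us) lee_fin; have /andP[] := ab u s us.
have hi : cdf (t xi) (grid k.+1) - cdf (t xi) (grid k) <= \sum_s b s * cell_size (k, s).
  rewrite -lee_fin -cell_integral// -tE; apply: ge0_le_integral => //.
  - exact: mstep.
  - by move=> u /density_cell_cover[s us]; rewrite (block_step _ us) lee_fin; have /andP[] := ab u s us.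
have gap : \sum_s b s * cell_size (k, s) = \sum_s a s * cell_size (k, s) +
    m.+1%:R^-1 * q.+1%:R^-1.
  rewrite -(cell_size_sum k) mulr_suml -big_split/=; apply: eq_bigr => s _.
  by rewrite /a /b -[(s xi).+1%:R]natr1 mulrDl mul1r mulrDl [q.+1%:R^-1 * _]mulrC.
have vab s : a s * cell_size (k, s) <= cell_size (k, s) * v s <= b s * cell_size (k, s).
  have := cell_size_ge0 (k, s); rewrite le_eqVlt => /predU1P[<-|c0].
    by rewrite !mulr0 !mul0r lexx.
  have /andP[v1 v2] := hv s c0.
  by rewrite ![_ * cell_size (k, s)]mulrC !ler_pM2l// /a /b ler_pdivrMr// ler_pdivlMr//
    ![v s * _]mulrC v1.
have vlo : \sum_s a s * cell_size (k, s) <= \sum_s cell_size (k, s) * v s.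
  by apply: ler_sum => s _; have /andP[] := vab s.
have vhi : \sum_s cell_size (k, s) * v s <= \sum_s b s * cell_size (k, s).
  by apply: ler_sum => s _; have /andP[] := vab s.
move: lo hi vlo vhi; rewrite gap ler_norml.
move: (\sum_s a s * _) (\sum_s _ * v s) (cdf _ _ - cdf _ _) (_^-1 * _) => u v' w z.
by move=> *; apply/andP; split; lra.
Qed.

End density_cells.

Section density_approx.
Context {R : realType} {A B : finType}.
Variables (M : A -> 'M[R]_#|B|) (x y : B -> R) (lam : R).
Hypotheses (A_gt0 : (0 < #|A|)%N) (B_gt0 : (0 < #|B|)%N)
  (M_ge0 : forall a, nonneg_mx (M a)) (M_irr : forall a, irreducible_mx (M a))
  (M_aper : forall a, aperiodic_mx (M a)) (x_gt0 : forall b, 0 < x b)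
  (y_gt0 : forall b, 0 < y b) (lamP : perron_eigenvalue (\sum_a M a) lam).
Notation W := (edge_weight M).
Notation leb := (@lebesgue_measure R).

Lemma J2_lt_dom (t : path_measure R (A * A)%type) (l : R) : (J2 M lam t < l%:E)%E ->
  [/\ forall xi, t xi `<< leb,
      {ae leb, forall u, (u : R) \in `[0, 1] -> Mst R A (path_density t u)} &
      (\int[leb]_(u in `[0%R, 1%R]) I2 M lam (path_density t u) < l%:E)%E].
Proof.
rewrite /J2; case: asboolP => [[h1 h2] h3|_]; first by split.
by rewrite ltNge leey.
Qed.

(** The fluxes chosen on the cells of a block are averaged; by convexity this
does not raise the cost. *)
Lemma density_approx (t : path_measure R (A * A)%type) (m : nat) (l d : R) :
  (J2 M lam t < l%:E)%E -> 0 < d ->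
  exists C : 'I_m.+1 -> (A * B) * (A * B) -> R,
    [/\ forall k, Mst R (A * B)%type (C k), forall k, carried W (C k),
        m.+1%:R^-1 * (\sum_k flux_cost W (C k)) + ln lam <= l &
        forall k xi, `|m.+1%:R^-1 * pair_marginal (C k) xi -
          (cdf (t xi) (k.+1%:R / m.+1%:R) - cdf (t xi) (k%:R / m.+1%:R))|
          <= m.+1%:R^-1 * d].
Proof.
move=> Jl d0; have [l' [Jl' l'l]] := ereal_between Jl; rewrite lte_fin in l'l.
have [t_dom [N [mN N0 Nae]] Fl] := J2_lt_dom Jl'.
have t_st (u : R) : 0 <= u <= 1 -> ~ N u -> Mst R A (path_density t u).
  move=> u01 Nu; apply: contrapT => h; apply: Nu; apply: Nae => /= /(_ _) h2.
  by apply: h; apply: h2; rewrite in_itv.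
pose q := Num.truncn d^-1.
have qd : q.+1%:R^-1 <= d.
  by rewrite -[leRHS]invrK lef_pV2 ?posrE ?invr_gt0// ltW// truncnS_gt.
have m0 : 0 < m.+1%:R :> R by rewrite ltr0n.
have q0 : 0 < q.+1%:R :> R by rewrite ltr0n.
pose E := @density_cell R A t N m q.
pose sz := @cell_size R A t N m q.
have szE c : leb (E c) = (sz c)%:E by exact: leb_density_cell.
have e0 : 0 < l - l' by rewrite subr_gt0.
have [||||||r rl rP] := @cell_infima _ _ R leb _ E
  (`[0%R, 1%R]%classic : set (measurableTypeR R)) _ _ _ _
  (fun u => I2 M lam (path_density t u)) _ _ l' (l - l') Fl e0.
- exact: measurable_itv.
- by move=> c; exact: density_cell_measurable.
- by move=> c u [/density_block01[u01 _] _]; rewrite /= in_itv.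
- by move=> u c c'; exact: density_cell_disj.
- by move=> u _; exact: (I2_ge0 A_gt0 B_gt0 M_ge0 M_irr M_aper x_gt0 y_gt0 lamP).
- by move=> c; change (leb (E c) \is a fin_num); rewrite szE.
have /choice[C CP] : forall c, exists C : (A * B) * (A * B) -> R, 0 < sz c ->
    [/\ Mst R (A * B)%type C, carried W C, flux_cost W C + ln lam <= r c + (l - l') &
      forall xi, (c.2 xi)%:R <= q.+1%:R * pair_marginal C xi <= (c.2 xi).+1%:R].
  move=> c; have [c0|nc] := pselect (0 < sz c); last by exists (fun=> 0) => /nc.
  have [|u Eu /(I2_lt M_ge0)[C [Cst Ccar Cl Cf]]] := rP c.
    by change (0 < leb (E c))%E; rewrite szE lte_fin.
  exists C => _; split => //; first exact: ltW.
  by move=> xi; rewrite Cf; have [_ /(_ xi Logic.I)/= /andP[-> /ltW]] := Eu.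
have sz0 c : 0 <= sz c by exact: cell_size_ge0.
have sz_pos c : sz c != 0 -> 0 < sz c by move=> cn; rewrite lt_neqAle eq_sym cn sz0.
have sz_sum k : \sum_s sz (k, s) = m.+1%:R^-1 by exact: cell_size_sum.
pose a k s := m.+1%:R * sz (k, s).
have a0 k s : 0 <= a k s by rewrite mulr_ge0// ltW.
have aP k s : a k s != 0 -> 0 < sz (k, s).
  by move=> an; apply: sz_pos; apply: contraNneq an => e; rewrite /a e mulr0.
have mix k := @flux_cost_sum R _ W _ (a k) (fun s => C (k, s)) (edge_weight_ge0 M_ge0)
  (a0 k) (fun s an => let: And4 _ h _ _ := CP (k, s) (aP k s an) in h).
exists (fun k e => \sum_s a k s * C (k, s) e); split.
- move=> k; apply: Mst_mix => //.
    by rewrite -mulr_sumr sz_sum divff// gt_eqF.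
  by move=> s /aP h; have [] := CP _ h.
- by move=> k; have [] := mix k.
- have pb (f : 'I_m.+1 * {ffun A * A -> 'I_q.+2} -> R) :
      \sum_c f c = \sum_k \sum_s f (k, s).
    by rewrite pair_bigA; apply: eq_bigr => -[].
  have cost k : flux_cost W (fun e => \sum_s a k s * C (k, s) e) <=
      m.+1%:R * \sum_s sz (k, s) * (r (k, s) + (l - l') - ln lam).
    apply: le_trans (mix k).2 _; rewrite mulr_sumr; apply: ler_sum => s _.
    rewrite /a -mulrA ler_wpM2l ?(ltW m0)//.
    have := sz0 (k, s); rewrite le_eqVlt => /predU1P[<-|c0]; first by rewrite !mul0r.
    by rewrite ler_pM2l//; have [_ _ h _] := CP _ c0; lra.
  have tot : m.+1%:R^-1 * \sum_k flux_cost W (fun e => \sum_s a k s * C (k, s) e) <=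
      \sum_c sz c * (r c + (l - l') - ln lam).
    rewrite -(ler_pM2l m0) mulrA divff ?gt_eqF// mul1r.
    by rewrite pb mulr_sumr; apply: ler_sum.
  have sz1 : \sum_c sz c = 1.
    rewrite pb; under eq_bigr do rewrite sz_sum.
    by rewrite sumr_const card_ord -[LHS]mulr_natr mulVf// gt_eqF.
  have split_sum : \sum_c sz c * (r c + (l - l') - ln lam) =
      \sum_c r c * sz c + (l - l') - ln lam.
    under eq_bigr do rewrite -addrA mulrDr [sz _ * r _]mulrC.
    by rewrite big_split/= -mulr_suml sz1 mul1r addrA.
  have rl' : \sum_c r c * sz c < l' by exact: rl.
  rewrite split_sum in tot; move: tot rl'.
  move: (\sum_c _) (_^-1 * _) => u v; lra.
- move=> k xi.
  have -> : m.+1%:R^-1 * pair_marginal (fun e => \sum_s a k s * C (k, s) e) xi =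
      \sum_s sz (k, s) * pair_marginal (C (k, s)) xi.
    rewrite /pair_marginal exchange_big/= mulr_sumr; apply: eq_bigr => s _.
    by rewrite -mulr_sumr mulrA /a mulrA mulVf ?gt_eqF// mul1r.
  apply: (@le_trans _ _ (m.+1%:R^-1 * q.+1%:R^-1)); last by rewrite ler_wpM2l// invr_ge0 ltW.
  apply: (@density_block_bounds R A t N m q t_dom mN N0 t_st k xi) => s s0.
  by have [_ _ _ h] := CP _ s0; exact: h.
Qed.

End density_approx.

(** * Lower bound for the spatial measure *)

Section test_neighbourhoods.
Context {R : realType}.

Lemma nbhs_path_measure (K : finType) (G : set (path_measure R K)) (t : path_measure R K) :
  open G -> G t -> exists (s : seq {classic (K * test_function R)%type}) (d : R), 0 < d /\
    forall Pi : path_measure R K,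
      (forall kf, kf \in s -> `|path_eval Pi kf - path_eval t kf| < d) -> G Pi.
Proof.
move=> [D oD DG] Gt.
have : nbhs (path_eval t : {ptws {classic (K * test_function R)%type} -> R}) D.
  by apply: open_nbhs_nbhs; split => //; rewrite -DG in Gt.
move=> /nbhs_ptws[s [d [d0 sD]]]; exists s, d; split => // Pi h.
by rewrite -DG; exact: sD.
Qed.

Lemma test_function_bounded (f : test_function R) :
  exists L : R, forall x, 0 <= x <= 1 -> `|sval f x| <= L.
Proof.
have /compact_bounded : compact (sval f @` `[0, 1]%classic : set R^o).
  by apply: continuous_compact; [exact: (svalP f)|exact: segment_compact].
move=> [L [Lr hL]]; exists (`|L| + 1) => x x01; apply: (hL (`|L| + 1)).
  by rewrite (le_lt_trans (ler_norm L))// ltrDl.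
by exists x => //; rewrite /= in_itv.
Qed.

(** A neighbourhood involves finitely many test functions, which are treated at a
common scale. *)
Lemma common_modulus (T : Type) (s : seq {classic (T * test_function R)%type}) (e : R) :
  0 < e -> exists d L : R, [/\ 0 < d, 1 <= L & forall kf, kf \in s ->
    (forall x y, 0 <= x <= 1 -> 0 <= y <= 1 -> `|x - y| <= d ->
       `|sval kf.2 x - sval kf.2 y| <= e) /\
    (forall x, 0 <= x <= 1 -> `|sval kf.2 x| <= L)].
Proof.
move=> e0; elim: s => [|kf s [d [L [d0 L1 IH]]]]; first by exists 1, 1.
have [d' d'0 fd'] := unif_continuous_itv kf.2 e0.
have [L' fL'] := test_function_bounded kf.2.
exists (Num.min d d'), (Num.max L L'); split.
- by rewrite lt_min d0.
- by rewrite le_max L1.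
move=> kf'; rewrite inE => /predU1P[->|/IH[h1 h2]]; split.
- by move=> x y x01 y01; rewrite le_min => /andP[_ xy]; exact: fd'.
- by move=> x x01; rewrite le_max fL' ?orbT.
- by move=> x y x01 y01; rewrite le_min => /andP[xy _]; exact: h1.
- by move=> x x01; rewrite le_max h2.
Qed.

Lemma cdf_telescope (mu : {finite_measure set (measurableTypeR R) -> \bar R}) m :
  \sum_(k < m.+1) (cdf mu (k.+1%:R / m.+1%:R) - cdf mu (k%:R / m.+1%:R)) =
  cdf mu 1 - cdf mu 0.
Proof.
rewrite -(big_mkord xpredT (fun k => cdf mu (k.+1%:R / m.+1%:R) - cdf mu (k%:R / m.+1%:R))).
by rewrite (telescope_sumr (fun k => cdf mu (k%:R / m.+1%:R)))// mul0r divff ?pnatr_eq0.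
Qed.

Lemma cdf0_dominated (mu : {finite_measure set (measurableTypeR R) -> \bar R}) :
  mu (~` `[0, 1]%classic) = 0%E -> mu `<< @lebesgue_measure R -> cdf mu 0 = 0.
Proof.
move=> mu01 /null_content_dominatesP dom; rewrite (cdf0E mu01) dom//.
exact: lebesgue_measure_set1.
Qed.

(** Both integrals are compared with the Riemann sums over the blocks. *)
Lemma integral_close (mu nu : {finite_measure set (measurableTypeR R) -> \bar R})
    (f : test_function R) (e d L b : R) m :
  mu (~` `[0, 1]%classic) = 0%E -> nu (~` `[0, 1]%classic) = 0%E ->
  (forall x y, 0 <= x <= 1 -> 0 <= y <= 1 -> `|x - y| <= d ->
    `|sval f x - sval f y| <= e) -> (forall x, 0 <= x <= 1 -> `|sval f x| <= L) ->
  0 <= e -> m.+1%:R^-1 <= d -> cdf mu 0 = 0 -> cdf nu 0 = 0 ->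
  (forall k : 'I_m.+1, `|(cdf mu (k.+1%:R / m.+1%:R) - cdf mu (k%:R / m.+1%:R)) -
     (cdf nu (k.+1%:R / m.+1%:R) - cdf nu (k%:R / m.+1%:R))| <= b) ->
  `|\int[mu]_(t in `[0, 1]%classic) sval f t - \int[nu]_(t in `[0, 1]%classic) sval f t|
  <= e * cdf mu 1 + e * cdf nu 1 + m.+1%:R * (L * b).
Proof.
move=> mu01 nu01 fd fL e0 md mu0 nu0 hb.
have := riemann_sum mu01 fd e0 md; have := riemann_sum nu01 fd e0 md.
rewrite mu0 nu0 !mulr0 !add0r.
set S := \sum_(k < _) _; set S' := \sum_(k < _) _ => h1 h2.
have h3 : `|S' - S| <= m.+1%:R * (L * b).
  rewrite /S /S' -sumrB; apply: le_trans (ler_norm_sum _ _ _) _.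
  apply: (@le_trans _ _ (\sum_(k < m.+1) L * b)); last first.
    by rewrite sumr_const card_ord mulr_natl.
  apply: ler_sum => k _.
  rewrite -mulrBr normrM ler_pM//.
  by apply: fL; rewrite divr_ge0//= ler_pdivrMr ?ltr0n// mul1r ler_nat.
move: h1 h2 h3; set X := \int[mu]_(_ in _) _; set Y := \int[nu]_(_ in _) _ => h1 h2 h3.
rewrite (_ : X - Y = (X - S') - (Y - S) + (S' - S)); last by ring.
apply: le_trans (ler_normD _ _) _; apply: lerD => //.
by apply: le_trans (ler_normB _ _) _; apply: lerD.
Qed.

End test_neighbourhoods.

Section path_lower.
Context {R : realType} {A B : finType}.
Variables (M : A -> 'M[R]_#|B|) (x y : B -> R) (lam : R).
Hypotheses (A_gt0 : (0 < #|A|)%N) (B_gt0 : (0 < #|B|)%N)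
  (M_ge0 : forall a, nonneg_mx (M a)) (M_irr : forall a, irreducible_mx (M a))
  (M_aper : forall a, aperiodic_mx (M a)) (x_gt0 : forall b, 0 < x b)
  (y_gt0 : forall b, 0 < y b) (lamP : perron_eigenvalue (\sum_a M a) lam).
Notation W := (edge_weight M).
Notation leb := (@lebesgue_measure R).

(** The blocks are chosen so fine that the test functions of a neighbourhood are
nearly constant on them; paths that follow the block averages of [density_approx]
then have their empirical measure in the neighbourhood. *)
Lemma path_lower (G : set (path_measure R (A * A)%type)) (t : path_measure R (A * A)%type)
    (l : R) : open G -> G t -> (J2 M lam t < l%:E)%E ->
  \forall n \near \oo, expR (- (n.+1%:R * l)) <=
    mass M x y [set eta : {ffun 'I_n.+1 -> A} | G (Pi2_hat R eta)].
Proof.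
move=> oG Gt Jl; have [s [d [d0 sG]]] := nbhs_path_measure oG Gt.
have [l' [Jl' l'l]] := ereal_between Jl; rewrite lte_fin in l'l.
have [t_dom _ _] := J2_lt_dom Jl'.
(* The moduli of continuity of the test function cost at most [3 e], and the blocks
   at most [3 e]. *)
pose e := d / 8; have e0 : 0 < e by rewrite divr_gt0.
have [w [L [w0 L1 fwL]]] := common_modulus s e0.
have L0 : 0 < L by apply: lt_le_trans L1.
pose m := Num.truncn w^-1.
have mw : m.+1%:R^-1 <= w.
  by rewrite -[leRHS]invrK lef_pV2 ?posrE ?invr_gt0// ltW// truncnS_gt.
have m0 : 0 < m.+1%:R :> R by rewrite ltr0n.
pose g := Num.min 1 (e / L).
have g0 : 0 < g by rewrite lt_min ltr01/= divr_gt0.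
have [C [Cst Ccar Cl Ct]] := density_approx A_gt0 B_gt0 M_ge0 M_irr M_aper x_gt0
  y_gt0 lamP m Jl' g0.
pose K := #|{: (A * B) * (A * B)}|.
pose d' := m.+1%:R^-1 * (e / L) / K.+1%:R.
have d'0 : 0 < d' by rewrite !(divr_gt0, mulr_gt0, invr_gt0).
have l'l0 : 0 < l - l' by rewrite subr_gt0.
have LB := @mpm_lower_bound R A B M x y lam A_gt0 B_gt0 M_ge0 M_irr M_aper x_gt0
  y_gt0 lamP m C d' _ Cst Ccar d'0 l'l0.
have t0 xi : cdf (t xi) 0 = 0 by apply: cdf0_dominated; [exact: path_carried|exact: t_dom].
have pm1 k xi : pair_marginal (C k) xi <= 1.
  have [pm0 pm1 _] := pair_marginal_Mst (Cst k).
  by rewrite -pm1 (bigD1 xi)//= lerDl; apply: sumr_ge0.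
have t1 xi : cdf (t xi) 1 <= 2.
  rewrite -[leLHS]subr0 -(t0 xi) -(cdf_telescope _ m).
  apply: (@le_trans _ _ (\sum_(k < m.+1) (2 * m.+1%:R^-1))).
    apply: ler_sum => k _; have := Ct k xi; rewrite ler_distlC => /andP[_ h].
    apply: le_trans h _; rewrite -mulrDr [leRHS]mulrC ler_wpM2l ?invr_ge0 ?(ltW m0)//.
    have : g <= 1 by rewrite /g ge_min lexx.
    by have := pm1 k xi; lra.
  by rewrite sumr_const card_ord -[leLHS]mulr_natr -mulrA mulVf ?gt_eqF// mulr1.
have d'K : d' *+ K <= m.+1%:R^-1 * (e / L).
  have : 0 < m.+1%:R^-1 * (e / L) by rewrite mulr_gt0 ?invr_gt0 ?divr_gt0.
  rewrite /d'; move: (_ * (e / L)) => v v0.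
  rewrite -[leLHS]mulr_natr -mulrA ler_piMr ?(ltW v0)// mulrC ler_pdivrMr//.
  by rewrite mul1r ler_nat.
near=> n.
apply: (@le_trans _ _ (expR (- (n.+1%:R * (m.+1%:R^-1 * (\sum_k flux_cost W (C k)) + ln lam + (l - l')))))).
  by rewrite ler_expR lerN2 ler_wpM2l//; move: Cl; move: (_ + ln lam) => u; lra.
rewrite -lee_fin; apply: (near LB n _) => //.
move=> p tr; apply: sG => -[xi f] kfs; rewrite /path_eval /=.
have [fw fL] := fwL _ kfs; rewrite /= in fw fL.
have N1 : 2 * n.+1%:R^-1 <= m.+1%:R^-1 * (e / L).
  have : n.+1%:R^-1 <= m.+1%:R^-1 * (e / L) / 2.
    rewrite -[leRHS]invrK lef_pV2 ?posrE ?invr_gt0 ?divr_gt0 ?mulr_gt0 ?invr_gt0 ?divr_gt0//.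
    by near: n; exact: near_natr_ge.
  by move: (n.+1%:R^-1 : R) (_ * (e / L)) => u v; lra.
have hat0 : cdf (Pi2_hat R (letters p) xi) 0 = 0 by rewrite cdf_Pi2_hat pairs_upto0.
have hat1 : cdf (Pi2_hat R (letters p) xi) 1 <= 1.
  rewrite cdf_Pi2_hat pairs_upto1; have [h0 <- _] := set_mem (emp_pair_Mst R (letters p)).
  by rewrite (bigD1 xi)//= lerDl; apply: sumr_ge0.
pose b := 3 * (m.+1%:R^-1 * (e / L)).
have hb (k : 'I_m.+1) :
  `|(cdf (Pi2_hat R (letters p) xi) (k.+1%:R / m.+1%:R) -
     cdf (Pi2_hat R (letters p) xi) (k%:R / m.+1%:R)) -
    (cdf (t xi) (k.+1%:R / m.+1%:R) - cdf (t xi) (k%:R / m.+1%:R))| <= b.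
  rewrite !cdf_Pi2_hat; have h1 := tracks_pairs k xi tr; have h2 := Ct k xi.
  have h3 : m.+1%:R^-1 * g <= m.+1%:R^-1 * (e / L).
    by rewrite ler_wpM2l ?invr_ge0 ?(ltW m0)// /g ge_min lexx orbT.
  move: h1 h2; set X := pairs_upto _ _ _ - _; set Z := _ * pair_marginal _ _.
  set Y := cdf _ _ - _ => h1 h2.
  rewrite (_ : X - Y = (X - Z) + (Z - Y)); last by ring.
  apply: le_trans (ler_normD _ _) _; apply: le_trans (lerD h1 h2) _.
  rewrite /b -/K; move: N1 d'K h3.
  by move: (2 * _) (d' *+ K) (_ * g) (_ * (e / L)) => u1 u2 u3 u4; lra.
apply: le_lt_trans (integral_close (path_carried (Pi2_hat R (letters p)) xi)
  (path_carried t xi) fw fL (ltW e0) mw hat0 (t0 xi) hb) _.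
have bE : m.+1%:R * (L * b) = 3 * e.
  have E (u v w' : R) : u != 0 -> v != 0 -> u * (v * (3 * (u^-1 * (w' / v)))) = 3 * w'.
    by move=> un vn; field; rewrite un vn.
  by rewrite /b E ?gt_eqF.
rewrite bE; have h1 := ler_wpM2l (ltW e0) hat1; have h2 := ler_wpM2l (ltW e0) (t1 xi).
have dE : d = 8 * e by rewrite /e; field.
apply: le_lt_trans (lerD (lerD h1 h2) (lexx _)) _; rewrite dE; lra.
Unshelve. all: by end_near. Qed.

Lemma ldp_spatial_measure : LDP (T := path_measure R (A * A)%type) (fun n => n.+1%:R)
  (fun n E => mpm_prob M x y [set eta : {ffun 'I_n.+1 -> A} | E (Pi2_hat R eta)])
  (J2 M lam).
Proof.
apply: (ldp_criterion A_gt0 B_gt0 M_ge0 M_irr M_aper x_gt0 y_gt0 lamP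
  (emp := fun n => @Pi2_hat R A n.+1)); first exact: path_lower.
move=> I U nn eta G l UU _ Gp Gc etaG.
exact: (path_upper A_gt0 B_gt0 M_ge0 M_irr M_aper x_gt0 y_gt0 lamP Gp Gc UU etaG).
Qed.

End path_lower.

Theorem theorem3p4 (R : realType) (A B : finType)
    (M : A -> 'M[R]_#|B|) (x y : B -> R) (lam : R)
    (A_gt0 : (0 < #|A|)%N) (B_gt0 : (0 < #|B|)%N)
    (M_ge0 : forall a, nonneg_mx (M a))
    (M_irr : forall a, irreducible_mx (M a))
    (M_aper : forall a, aperiodic_mx (M a))
    (x_gt0 : forall b, 0 < x b) (y_gt0 : forall b, 0 < y b)
    (lamP : perron_eigenvalue (\sum_(a : A) M a) lam) :
  LDP (T := Mst R A) (fun n => n.+1%:R)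
    (fun n E => mpm_prob M x y [set eta : {ffun 'I_n.+1 -> A} | E (nu2_hat R eta)])
    (fun nu => I2 M lam (set_val nu))
  /\
  LDP (T := path_measure R (A * A)%type) (fun n => n.+1%:R)
    (fun n E => mpm_prob M x y [set eta : {ffun 'I_n.+1 -> A} | E (Pi2_hat R eta)])
    (J2 M lam).
Proof.
split; [exact: (ldp_pair_measure A_gt0)|exact: (ldp_spatial_measure A_gt0)].
Qed.
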